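(* Assume (A2) $q_*(y)>0$ if and only if $\mathrm{numK}(y)=0$, and (A1) $L_{\mathrm{SE}}(\tilde v)\le\epsilon_{\mathrm{score}}^2$. Let $\epsilon\in(0,1)$ and suppose $$T=\ln(4d/\epsilon^2),\qquad \delta\le \epsilon/d,\qquad \epsilon_{\mathrm{score}}\le T^{-1/2}\epsilon,$$ and let $0=t_0<t_1<\dots<t_W=T-\delta$ be any partition. Then the distribution $\hat p$ of the output of the MATU algorithm run with this $T$, this partition and the estimator $\tilde v$ satisfies $\mathrm{TV}(q_*,\hat p)\le 2\epsilon$.
   Context: Setting. Integers $K\ge2$, $d\ge1$, $\mathcal{Y}=\{1,\dots,K\}^d$; the symbol $K$ is the mask token and $\mathrm{numK}(y)=\#\{i:y_i=K\}$. The masked forward process $(\mathbf{y}^\to_t)$ is the continuous-time Markov chain on $\mathcal{Y}$ with $\mathbf{y}^\to_0\sim q_*$ and rate function $R^\to(y,y')$ (rate of jumping from $y'$ to $y$): $R^\to(y,y')=1$ if $y,y'$ differ in exactly one coordinate $i$ with $y_i=K$; $R^\to(y,y)=-(d-\mathrm{numK}(y))$; $0$ otherwise. Marginals $q^\to_t$; reverse marginals $q^\gets_t:=q^\to_{T-t}$ for $t\in[0,T)$; true discrete score $v_{t,y}(y')=q^\gets_t(y')/q^\gets_t(y)$. Score estimator and loss. $\tilde v$ assigns a value $\tilde v_{t,y}(y')>0$ to each $t\in[0,T)$ and each pair $(y,y')$ with $R^\to(y,y')=1$ (i.e. $y'$ is obtained from $y$ by replacing one mask coordinate by a value in $\{1,\dots,K-1\}$),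 measurably in $t$. With $D_\phi(u\|w)=u\ln(u/w)-u+w$, $$L_{\mathrm{SE}}(\tilde v)=\frac1T\int_0^T\mathbb{E}_{\mathbf{y}\sim q^\to_t}\Big[\sum_{y'\neq\mathbf{y}}R^\to(\mathbf{y},y')\,D_\phi\big(v_{T-t,\mathbf{y}}(y')\,\|\,\tilde v_{T-t,\mathbf{y}}(y')\big)\Big]dt.$$ Estimated rates: $\tilde R_t(y',y)=R^\to(y,y')\tilde v_{t,y}(y')$ for $y'\neq y$, and $\tilde R_t(y)=\sum_{y'\neq y}\tilde R_t(y',y)$. MATU algorithm. Set $\hat y_{t_0}=(K,\dots,K)$. For $w=1,\dots,W$: let $\beta_w=K\,\mathrm{numK}(\hat y_{t_{w-1}})/(e^{T-t_w}-1)$; draw $N_w\sim\mathrm{Poisson}(\beta_w(t_w-t_{w-1}))$ (so $N_w=0$ if $\beta_w=0$); draw $N_w$ i.i.d. uniform points of $[t_{w-1},t_w]$ sorted as $\tau_1<\dots<\tau_{N_w}$; set $z_0=\hat y_{t_{w-1}}$; for $n=1,\dots,N_w$, with $z=z_{n-1}$ define the truncated rates $\hat R_{\tau_n}(y',z)=\tilde R_{\tau_n}(y',z)\min\{1,\beta_w/\tilde R_{\tau_n}(z)\}$ for $y'\neq z$, and set $z_n=y'$ with probability $\hat R_{\tau_n}(y',z)/\beta_w$ for each $y'\neq z$, and $z_n=z$ with the remaining probability $1-\sum_{y'\neq z}\hat R_{\tau_n}(y',z)/\beta_w$; then set $\hat y_{t_w}=z_{N_w}$. The output is $\hat y_{t_W}$,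 whose distribution is denoted $\hat p$. $\mathrm{TV}(p,q)=\sup_{S}|p(S)-q(S)|$. *)

(* Defs.v *)
From HB Require Import structures.
From mathcomp Require Import all_boot all_order all_algebra.
From mathcomp Require Import all_classical all_reals all_analysis.
Set Implicit Arguments. Unset Strict Implicit. Unset Printing Implicit Defensive.
Import Order.TTheory GRing.Theory Num.Theory.
Import numFieldNormedType.Exports.
Local Open Scope classical_set_scope.
Local Open Scope ring_scope.

(** State space Y = {1,...,K}^d.  Symbols are 0-indexed: the symbol k in
    {1,...,K} of the paper is the ordinal k-1 : 'I_K, so the mask token K is
    the ordinal with value K-1. *)
Definition state (K d : nat) := {ffun 'I_d -> 'I_K}.

Definition is_mask (K : nat) (a : 'I_K) : bool := (val a == K.-1)%N.

Definition numK (K d : nat) (y : state K d) : nat := #|[set i | is_mask (y i)]|.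

Definition unmask_pair (K d : nat) (y y' : state K d) : bool :=
  (#|[set i | y i != y' i]| == 1)%N && [forall i, (y i != y' i) ==> is_mask (y i)].

(** forward rate R^->(y,y') (rate of jumping from y' to y) *)
Definition Rfwd (R : realType) (K d : nat) (y y' : state K d) : R :=
  if y == y' then - ((d - numK y)%:R)
  else if unmask_pair y y' then 1 else 0.

Definition Dphi (R : realType) (u w : R) : R := u * ln (u / w) - u + w.

(** true discrete score v_{s,y}(y') = q<-_s(y') / q<-_s(y), with
    q<-_s = q->_{T-s}; q is the family of forward marginals *)
Definition score (R : realType) (K d : nat) (q : R -> state K d -> R) (T s : R)
  (y y' : state K d) : R := q (T - s) y' / q (T - s) y.

(** score-entropy loss L_SE(vt) (extended real; the integrand is >= 0) *)
Definition L_SE (R : realType) (K d : nat) (q : R -> state K d -> R) (T : R)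
  (vt : R -> state K d -> state K d -> R) : \bar R :=
  ((T^-1)%:E *
   \int[lebesgue_measure]_(t in (`[0%R, T] : set R))
     (\sum_(y : state K d) q t y *
        \sum_(y' : state K d | y' != y)
          Rfwd R y y' * Dphi (score q T (T - t) y y') (vt (T - t) y y'))%:E)%E.

Definition Rest (R : realType) (K d : nat) (vt : R -> state K d -> state K d -> R)
  (t : R) (y' y : state K d) : R := Rfwd R y y' * vt t y y'.

Definition Rest_tot (R : realType) (K d : nat) (vt : R -> state K d -> state K d -> R)
  (t : R) (y : state K d) : R := \sum_(y' : state K d | y' != y) Rest vt t y' y.

Definition Rhat (R : realType) (K d : nat) (vt : R -> state K d -> state K d -> R)
  (beta tau : R) (y' z : state K d) : R :=
  Rest vt tau y' z * Num.min 1 (beta / Rest_tot vt tau z).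

Definition step_kernel (R : realType) (K d : nat)
  (vt : R -> state K d -> state K d -> R) (beta tau : R) (z y' : state K d) : R :=
  if y' != z then Rhat vt beta tau y' z / beta
  else 1 - \sum_(x : state K d | x != z) Rhat vt beta tau x z / beta.

Definition step_dist (R : realType) (K d : nat)
  (vt : R -> state K d -> state K d -> R) (beta : R) (p : state K d -> R) (tau : R)
  : state K d -> R :=
  fun y' => \sum_(z : state K d) p z * step_kernel vt beta tau z y'.

(** Expectation over n i.i.d. uniform points of [a,b] of F(u_1,...,u_n),
    written as an iterated (Tonelli) integral. *)
Fixpoint unif_expect (R : realType) (a b : R) (n : nat) (F : seq R -> \bar R)
  : \bar R :=
  match n with
  | 0%N => F [::]
  | n'.+1 => (((b - a)^-1)%:E *
              \int[lebesgue_measure]_(u in (`[a, b] : set R))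
                 unif_expect a b n' (fun s => F (u :: s)))%E
  end.

(** Poisson pmf with parameter lam >= 0 (lam = 0 gives the Dirac mass at 0) *)
Definition pois (R : realType) (lam : R) (n : nat) : R :=
  expR (- lam) * lam ^+ n / (n`!)%:R.

Definition dirac_st (R : realType) (K d : nat) (z : state K d) : state K d -> R :=
  fun y => if y == z then 1 else 0.

(** beta_w = K numK(z) / (e^{T - t_w} - 1), z the state at time t_{w-1} *)
Definition beta_w (R : realType) (K d : nat) (T : R) (tp : nat -> R) (w : nat)
  (z : state K d) : R :=
  (K%:R * (numK z)%:R) / (expR (T - tp w) - 1).

(** transition probability of window w of MATU, from z0 (at time t_{w-1})
    to y' (at time t_w): draw N ~ Poisson(beta_w (t_w - t_{w-1})), N i.i.d.
    uniform times in [t_{w-1}, t_w], sort them, apply the thinning steps. *)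
Definition window_kernel (R : realType) (K d : nat)
  (vt : R -> state K d -> state K d -> R) (T : R) (tp : nat -> R) (w : nat)
  (z0 y' : state K d) : \bar R :=
  let beta := beta_w T tp w z0 in
  (\sum_(n <oo)
     (pois (beta * (tp w - tp w.-1)) n)%:E *
     unif_expect (tp w.-1) (tp w) n
       (fun s => (foldl (step_dist vt beta) (dirac_st R z0) (sort <=%R s) y')%:E))%E.

Fixpoint matu_law (R : realType) (K d : nat)
  (vt : R -> state K d -> state K d -> R) (T : R) (tp : nat -> R) (w : nat)
  : state K d -> \bar R :=
  match w with
  | 0%N => fun y => if [forall i, is_mask (y i)] then 1%E else 0%E
  | w'.+1 => fun y' => (\sum_(z : state K d)
                          matu_law vt T tp w' z * window_kernel vt T tp w'.+1 z y')%E
  end.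

Definition TV (R : realType) (K d : nat) (p : state K d -> R) (q : state K d -> \bar R)
  : \bar R :=
  (\big[Order.max/0%E]_(S : {set state K d})
     `| (\sum_(y in S) p y)%:E - \sum_(y in S) q y |)%E.

(* Main.v *)
Require Import Defs.
From HB Require Import structures.
From mathcomp Require Import all_boot all_order all_algebra.
From mathcomp Require Import all_classical all_reals all_analysis.
From mathcomp Require Import measurable_realfun ring lra.
Import Order.TTheory GRing.Theory Num.Theory.
Import numFieldNormedType.Exports.
Local Open Scope classical_set_scope.
Local Open Scope ring_scope.

(** Fix a set [S] of states and let [g_w z] be the mean of [exp (lam 1_S)] at the
    output of the algorithm given that it is at [z] at time [t_w].  Along the true
    reverse marginals, [E ln g_w] increases by at most the score entropy spent on
    the window, because [r ln x - r' (x - 1) <= r ln (r / r') - r + r'].  Truncating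
    the rates at [beta_w] does not hurt, since the true total rate
    [numK y / (e^(T-t) - 1)] stays below [beta_w].  Summing over the windows gives
    [lam q_delta(S) <= T L_SE + E_(q_T) ln g_0], and Hoeffding's lemma bounds
    [ln g_0] at the fully masked state by [lam p(S) + lam^2 / 8].  Take
    [lam = 2 eps]; the errors of starting at the mask and of stopping at [delta]
    are [eps^2 / 4] and [eps].

    The estimated rates are only measurable in time, so the window estimate is not
    obtained by differentiation: over a step of length [h] it holds up to
    [O(h^2)], and the errors vanish when the step tends to 0.  It needs only a
    lower bound on the uniformised chain, obtained by keeping the configurations
    with at most one point in the first step. *)

(** * Iterated integrals *)

(** The clock rate of a window is frozen at the state [z] in which the window starts, so inside a
    window the rates of the algorithm depend on [z] as well as on the current state. The entropy
    argument is therefore run for each [z] separately, along the joint law of the true reverse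
    process at the start of the window and at a later time. Given [z], that process only meets
    states with at most as many masks as [z], which is what places the true rates below the clock
    rate; summing over [z] restores the marginal law and hence the loss. Working with exponential
    moments instead of a divergence between path laws avoids densities on path space: only functions
    on the finite state space and their logarithms occur, and these functions stay positive because
    with positive probability the clock does not ring during a window. It is enough to bound q_*(S)
    - p(S) from above for every set of states, since complements give the other sign. *)

(* The unnormalised version of [unif_expect]. *)
Fixpoint iint (R : realType) (D : set R) (n : nat) (F : seq R -> \bar R) : \bar R :=
  match n with
  | 0%N => F [::]
  | n'.+1 => (\int[lebesgue_measure]_(u in D) iint R D n' (fun s => F (u :: s)))%E
  end.
Arguments iint {R}.

Definition measurable_list {d} {X : measurableType d} {R : realType}
    (fs : seq (X -> R)) : Prop :=
  forall i, measurable_fun setT (nth (cst 0) fs i).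

(** Lists of reals are given no sigma-algebra; measurability is tested by composing with lists of
    measurable functions on an arbitrary space. Quantifying over the space allows an induction in
    which integration variables become further coordinates of it. *)
Definition seq_measurable {R : realType} (F : seq R -> \bar R) : Prop :=
  forall d (X : measurableType d) (fs : seq (X -> R)),
    measurable_list fs -> measurable_fun setT (fun x => F [seq f x | f <- fs]).

Lemma measurable_list_cons d (X : measurableType d) (R : realType)
    (f : X -> R) (fs : seq (X -> R)) :
  measurable_fun setT f -> measurable_list fs -> measurable_list (f :: fs).
Proof. by move=> mf mfs [|i]; [exact: mf|exact: mfs]. Qed.

Lemma measurable_list_rcons d (X : measurableType d) (R : realType)
    (f : X -> R) (fs : seq (X -> R)) :
  measurable_fun setT f -> measurable_list fs -> measurable_list (rcons fs f).
Proof.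
move=> mf mfs i; rewrite nth_rcons; case: ltnP => _; first exact: mfs.
by case: eqP => _ //; exact: measurable_cst.
Qed.

Lemma measurable_list_comp d d' (X : measurableType d) (Y : measurableType d')
    (R : realType) (g : Y -> X) (fs : seq (X -> R)) :
  measurable_fun setT g -> measurable_list fs ->
  measurable_list [seq f \o g | f <- fs].
Proof.
move=> mg mfs i; have [ilt|ige] := ltnP i (size fs).
  by rewrite (nth_map (cst 0))//; exact: measurableT_comp (mfs i) mg.
by rewrite nth_default ?size_map//; exact: measurable_cst.
Qed.

Lemma iint_ge0 (R : realType) (D : set R) n (F : seq R -> \bar R) :
  (forall s, 0 <= F s)%E -> (0 <= iint D n F)%E.
Proof.
elim: n F => [|n IH] F F0 //=.
by apply: integral_ge0 => u _; apply: IH => s; exact: F0.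
Qed.

Lemma seq_measurable_cons (R : realType) (F : seq R -> \bar R) u :
  seq_measurable F -> seq_measurable (fun s => F (u :: s)).
Proof.
move=> mF d X fs mfs.
by apply: (mF _ _ (cst u :: fs)); apply: measurable_list_cons => //; exact: measurable_cst.
Qed.

Lemma measurable_fun_integral_snd d (X : measurableType d) (R : realType)
    (D : set R) (f : X * R -> \bar R) :
  measurable D -> (forall x, 0 <= f x)%E -> measurable_fun setT f ->
  measurable_fun setT (fun x => \int[lebesgue_measure]_(u in D) f (x, u))%E.
Proof.
move=> mD f0 mf.
have mg : measurable_fun setT (fun z : X * R => f z * (\1_D z.2)%:E)%E.
  apply: emeasurable_funM => //; apply/measurable_EFinP.
  by apply: measurableT_comp measurable_snd; exact: measurable_indic.
have := @measurable_fun_fubini_tonelli_F _ _ _ _ R lebesgue_measure _ mg.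
have H0 z : (0 <= f z * (\1_D z.2)%:E)%E.
  by rewrite mule_ge0// lee_fin.
move=> /(_ H0); congr measurable_fun; apply/funext => x.
rewrite /fubini_F [RHS]integral_mkcond; apply: eq_integral => u _ /=.
by rewrite patchE indicE; case: ifPn => _; rewrite ?mule1 ?mule0.
Qed.

(** The induction enlarges the parameter space from [X] to [X * R]: the outermost integration
    variable becomes the projection [snd], appended to the list of functions, and is then integrated
    out by Tonelli. *)
Lemma measurable_iint_cat (R : realType) (D : set R) (F : seq R -> \bar R) :
  measurable D -> (forall s, 0 <= F s)%E -> seq_measurable F ->
  forall n d (X : measurableType d) (fs : seq (X -> R)), measurable_list fs ->
  measurable_fun setT (fun x => iint D n (fun s => F ([seq f x | f <- fs] ++ s))).
Proof.
move=> mD F0 mF; elim=> [|n IH] d X fs mfs /=.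
  by under eq_fun do rewrite cats0; exact: mF.
pose fs' : seq (X * R -> R) := rcons [seq f \o fst | f <- fs] snd.
have mfs' : measurable_list fs'.
  apply: measurable_list_rcons; first exact: measurable_snd.
  by apply: measurable_list_comp => //; exact: measurable_fst.
pose f (z : X * R) := iint D n (fun s => F ([seq g z | g <- fs'] ++ s)).
have := @measurable_fun_integral_snd _ X R D f mD _ (IH _ _ _ mfs').
have H0 z : (0 <= f z)%E by exact: iint_ge0.
move=> /(_ H0); congr measurable_fun; apply/funext => x.
apply: eq_integral => u _; rewrite /f; congr iint; apply/funext => s.
by rewrite /fs' map_rcons cat_rcons -map_comp.
Qed.

Lemma measurable_iint_cons (R : realType) (D : set R) (F : seq R -> \bar R) n :
  measurable D -> (forall s, 0 <= F s)%E -> seq_measurable F ->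
  measurable_fun setT (fun u => iint D n (fun s => F (u :: s))).
Proof.
move=> mD F0 mF.
apply: (measurable_iint_cat R D F mD F0 mF n _ _ [:: id]).
by apply: measurable_list_cons; [exact: measurable_id|move=> [|i]; exact: measurable_cst].
Qed.

Lemma eq_iint (R : realType) (D : set R) n (F G : seq R -> \bar R) :
  (forall s, (forall u, u \in s -> D u) -> F s = G s) -> iint D n F = iint D n G.
Proof.
elim: n F G => [|n IH] F G FG /=; first exact: FG.
apply: eq_integral => u /set_mem Du; apply: IH => s Hs; apply: FG => v.
by rewrite in_cons => /orP[/eqP ->//|]; exact: Hs.
Qed.

Lemma le_iint (R : realType) (D : set R) n (F G : seq R -> \bar R) :
  measurable D ->
  (forall s, 0 <= F s)%E -> seq_measurable F -> seq_measurable G ->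
  (forall s, F s <= G s)%E -> (iint D n F <= iint D n G)%E.
Proof.
move=> mD; elim: n F G => [|n IH] F G F0 mF mG FG /=; first exact: FG.
have G0 s : (0 <= G s)%E by apply: le_trans (FG s).
apply: ge0_le_integral => //.
- by move=> u _; exact: iint_ge0.
- by apply: measurable_funTS; exact: measurable_iint_cons.
- by apply: measurable_funTS; exact: measurable_iint_cons.
- by move=> u _; apply: IH => //; exact: seq_measurable_cons.
Qed.

Lemma iint_cst (R : realType) (D : set R) n (c : R) : measurable D ->
  iint D n (fun=> c%:E) = (c%:E * lebesgue_measure D ^+ n)%E.
Proof.
move=> mD; elim: n => [|n IH]; first by rewrite mule1.
rewrite [LHS]/= IH integral_cst// -muleA; congr (_ * _)%E.
by rewrite expeS muleC.
Qed.

Lemma iint_add (R : realType) (D : set R) n (F G : seq R -> \bar R) :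
  measurable D -> (forall s, 0 <= F s)%E -> (forall s, 0 <= G s)%E ->
  seq_measurable F -> seq_measurable G ->
  iint D n (fun s => F s + G s)%E = (iint D n F + iint D n G)%E.
Proof.
move=> mD; elim: n F G => [|n IH] F G F0 G0 mF mG //=.
rewrite -ge0_integralD//.
- by apply: eq_integral => u _; apply: IH => //; exact: seq_measurable_cons.
- by move=> u _; exact: iint_ge0.
- by apply: measurable_funTS; exact: measurable_iint_cons.
- by move=> u _; exact: iint_ge0.
- by apply: measurable_funTS; exact: measurable_iint_cons.
Qed.

Lemma iint_scale (R : realType) (D : set R) n (c : R) (F : seq R -> \bar R) :
  measurable D -> 0 <= c -> (forall s, 0 <= F s)%E -> seq_measurable F ->
  iint D n (fun s => c%:E * F s)%E = (c%:E * iint D n F)%E.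
Proof.
move=> mD c0; elim: n F => [|n IH] F F0 mF //=.
rewrite -ge0_integralZl//.
- by apply: eq_integral => u _; apply: IH => //; exact: seq_measurable_cons.
- by apply: measurable_funTS; exact: measurable_iint_cons.
- by move=> u _; exact: iint_ge0.
Qed.

Lemma seq_measurable_scale (R : realType) (c : R) (F : seq R -> \bar R) :
  seq_measurable F -> seq_measurable (fun s => c%:E * F s)%E.
Proof. by move=> mF d X fs mfs; apply: measurable_funeM; exact: mF. Qed.

Lemma seq_measurable_sum (R : realType) (I : Type) (r : seq I)
    (F : I -> seq R -> \bar R) :
  (forall i, seq_measurable (F i)) -> seq_measurable (fun s => \sum_(i <- r) F i s)%E.
Proof. by move=> mF d X fs mfs; apply: emeasurable_sum => i; exact: mF. Qed.

Lemma iint_sum (R : realType) (D : set R) n (I : Type) (r : seq I)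
    (c : I -> R) (F : I -> seq R -> \bar R) :
  measurable D -> (forall i, 0 <= c i) -> (forall i s, 0 <= F i s)%E ->
  (forall i, seq_measurable (F i)) ->
  iint D n (fun s => \sum_(i <- r) (c i)%:E * F i s)%E =
  (\sum_(i <- r) (c i)%:E * iint D n (F i))%E.
Proof.
move=> mD c0 F0 mF; elim: r => [|i r IH].
  rewrite big_nil (_ : (fun _ => _) = (fun=> 0%E)) ?iint_cst ?mul0e//.
  by apply/funext => s; rewrite big_nil.
rewrite big_cons -IH -iint_scale// -iint_add//.
- by congr iint; apply/funext => s; rewrite big_cons.
- by move=> s; rewrite mule_ge0// lee_fin.
- by move=> s; apply: sume_ge0 => j _; rewrite mule_ge0// lee_fin.
- exact: seq_measurable_scale.
- by apply: seq_measurable_sum => j; exact: seq_measurable_scale.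
Qed.

(* Of n.+1 points of A `|` B, keep the configurations with no point in A or
   exactly one; which of the coordinates lies in A does not matter by symmetry. *)
Lemma iint_setU_ge (R : realType) (A B : set R) :
  measurable A -> measurable B -> [disjoint A & B] ->
  forall n (F : seq R -> \bar R), (forall s, 0 <= F s)%E -> seq_measurable F ->
  (forall s s', perm_eq s s' -> F s = F s') ->
  (iint B n.+1 F +
   (n.+1%:R)%:E * \int[lebesgue_measure]_(u in A) iint B n (fun s => F (u :: s))
   <= iint (A `|` B) n.+1 F)%E.
Proof.
move=> mA mB dAB; have mAB : measurable (A `|` B) by exact: measurableU.
elim=> [|n IH] F F0 mF symF.
  rewrite /= mul1e addeC ge0_integral_setU//.
  apply: measurable_funTS.
  by have := measurable_iint_cons R setT F 0 measurableT F0 mF.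
have miint D m : measurable D ->
    measurable_fun setT (fun u => iint D m (fun s => F (u :: s))).
  by move=> mD; exact: measurable_iint_cons.
have -> : iint (A `|` B) n.+2 F =
    (\int[lebesgue_measure]_(u in A) iint (A `|` B) n.+1 (fun s => F (u :: s)) +
     \int[lebesgue_measure]_(u in B) iint (A `|` B) n.+1 (fun s => F (u :: s)))%E.
  rewrite [LHS]/= ge0_integral_setU//.
  - by apply: measurable_funTS; exact: (miint _ n.+1 mAB).
  - by move=> u _; apply: integral_ge0 => w _; exact: iint_ge0.
pose W v u := iint B n (fun s => F (v :: u :: s)).
have W0 v u : (0 <= W v u)%E by exact: iint_ge0.
have mW : measurable_fun setT (fun z => W z.1 z.2).
  apply: (measurable_iint_cat R B F mB F0 mF n _ (R * R)%type [:: fst; snd]).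
  apply: measurable_list_cons; first exact: measurable_fst.
  apply: measurable_list_cons; first exact: measurable_snd.
  by move=> i; rewrite nth_nil; exact: measurable_cst.
have mIW : measurable_fun setT (fun v => \int[lebesgue_measure]_(u in A) W v u)%E.
  by apply: (measurable_fun_integral_snd _ _ _ _ (fun z => W z.1 z.2)).
(* First point in [A]: keep only the configurations whose remaining points all lie in [B]. *)
have HA : (\int[lebesgue_measure]_(u in A) iint B n.+1 (fun s => F (u :: s)) <=
   \int[lebesgue_measure]_(u in A) iint (A `|` B) n.+1 (fun s => F (u :: s)))%E.
  apply: ge0_le_integral => //.
  - by move=> u _; apply: integral_ge0 => w _; exact: iint_ge0.
  - by apply: measurable_funTS; exact: miint.
  - by apply: measurable_funTS; exact: miint.
  - move=> u _; apply: le_trans (IH _ _ _ _) => //; last first.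
      by move=> s s' ss'; apply: symF; rewrite perm_cons.
      exact: seq_measurable_cons.
    rewrite leeDl// mule_ge0 ?lee_fin//; apply: integral_ge0 => v _.
    exact: iint_ge0.
(* First point in [B]: by induction, the remaining points contribute none in [A], or one in [A] in
   [n.+1] equal ways. *)
have HB : (\int[lebesgue_measure]_(v in B) iint B n.+1 (fun s => F (v :: s)) +
    (n.+1%:R)%:E * \int[lebesgue_measure]_(v in B) \int[lebesgue_measure]_(u in A) W v u <=
   \int[lebesgue_measure]_(u in B) iint (A `|` B) n.+1 (fun s => F (u :: s)))%E.
  have IW0 v : (0 <= \int[lebesgue_measure]_(u in A) W v u)%E.
    by apply: integral_ge0.
  rewrite -ge0_integralZl// ?lee_fin//; last exact: measurable_funTS.
  rewrite -ge0_integralD//; last first.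
  - by apply: measurable_funTS; apply: measurable_funeM.
  - by move=> v _; rewrite mule_ge0 ?lee_fin.
  - by apply: measurable_funTS; exact: miint.
  - by move=> v _; apply: integral_ge0 => w _; exact: iint_ge0.
  apply: ge0_le_integral => //.
  - move=> v _; apply: adde_ge0; first by apply: integral_ge0 => w _; exact: iint_ge0.
    by rewrite mule_ge0 ?lee_fin.
  - apply: measurable_funTS; apply: emeasurable_funD; first exact: miint.
    exact: measurable_funeM.
  - by apply: measurable_funTS; exact: miint.
  - move=> u _; apply: IH => //; first exact: seq_measurable_cons.
    by move=> s s' ss'; apply: symF; rewrite perm_cons.
(* Fubini and the symmetry of [F] bring the point of [A] to the front, so the [n.+1] copies from
   [HB] join the single one from [HA]. *)
have swap : (\int[lebesgue_measure]_(v in B) \int[lebesgue_measure]_(u in A) W v u =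
     \int[lebesgue_measure]_(u in A) iint B n.+1 (fun s => F (u :: s)))%E.
  pose f z := (W z.1 z.2 * (\1_B z.1)%:E * (\1_A z.2)%:E)%E.
  have mf : measurable_fun setT f.
    apply: emeasurable_funM; first apply: emeasurable_funM => //.
    - apply/measurable_EFinP.
      by apply: (measurableT_comp _ measurable_fst); exact: measurable_indic.
    - apply/measurable_EFinP.
      by apply: (measurableT_comp _ measurable_snd); exact: measurable_indic.
  have f0 z : (0 <= f z)%E by rewrite /f !mule_ge0// lee_fin.
  have := @fubini_tonelli _ _ _ _ R lebesgue_measure lebesgue_measure f mf f0.
  move=> E; transitivity (\int[lebesgue_measure]_x \int[lebesgue_measure]_y f (x, y))%E.
    rewrite [LHS]integral_mkcond; apply: eq_integral => v _.
    rewrite patchE; case: ifPn => vB.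
      rewrite [LHS]integral_mkcond; apply: eq_integral => u _.
      rewrite patchE /f /= !indicE vB mule1.
      by case: ifPn => _; rewrite ?mule1 ?mule0.
    apply: esym; apply: integral0_eq => u _.
    by rewrite /f /= indicE (negbTE vB) mule0 mul0e.
  rewrite E [RHS]integral_mkcond; apply: eq_integral => u _.
  rewrite patchE; case: ifPn => uA /=.
    rewrite [RHS]integral_mkcond; apply: eq_integral => v _.
    rewrite patchE /f /= !indicE uA mule1 /W.
    case: ifPn => _; rewrite ?mule1 ?mule0; last by [].
    congr iint; apply/funext => s; apply: symF.
    by rewrite -[v :: u :: s]/([:: v; u] ++ s) -[u :: v :: s]/([:: u; v] ++ s)
      perm_cat2r (perm_catC [:: v] [:: u]).
  apply: integral0_eq => v _.
  by rewrite /f /= [X in (_ * X%:E)%E]indicE (negbTE uA) mule0.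
apply: le_trans (leeD HA HB); rewrite swap -/(iint B n.+2 F).
set X := (\int[lebesgue_measure]_(u in A) iint B n.+1 (fun s => F (u :: s)))%E.
rewrite -/(iint B n.+2 F) [leRHS]addeCA.
rewrite (_ : (n.+2%:R)%:E = (1 + (n.+1%:R)%:E)%E); last by rewrite -EFinD nat1r.
by rewrite ge0_muleDl ?lee_fin// mul1e.
Qed.

(** * Sorted points and the uniformised chain *)

(** Insertion written with minima and maxima instead of a comparison, so that each entry of the
    result is visibly a measurable function of the inputs; this is how sorting is shown to preserve
    measurability. *)
Fixpoint bubble_insert {R : realType} (u : R) (s : seq R) : seq R :=
  if s is v :: s' then Num.min u v :: bubble_insert (Num.max u v) s' else [:: u].

Lemma perm_bubble_insert (R : realType) (u : R) s :
  perm_eq (bubble_insert u s) (u :: s).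
Proof.
elim: s u => [|v s IH] u //=; case: (leP u v) => _.
  by rewrite perm_cons; exact: IH.
rewrite -[u :: v :: s]/([:: u] ++ [:: v] ++ s) perm_sym perm_catCA /=.
by rewrite perm_cons perm_sym; exact: IH.
Qed.

Lemma bubble_insert_sorted (R : realType) (u : R) s :
  sorted <=%R s -> sorted <=%R (bubble_insert u s).
Proof.
elim: s u => [|v s IH] u //= pvs.
rewrite path_sortedE; last exact: le_trans.
apply/andP; split; last by apply: IH; exact: path_sorted pvs.
apply/allP => x; rewrite (perm_mem (perm_bubble_insert R _ _)) in_cons.
move: pvs; rewrite path_sortedE; last exact: le_trans.
move=> /andP[/allP vs _] /orP[/eqP ->|/vs vx].
  by rewrite ge_min le_max lexx.
by rewrite ge_min vx orbT.
Qed.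

Lemma foldr_bubble_insert (R : realType) (s : seq R) :
  foldr bubble_insert [::] s = sort <=%R s.
Proof.
apply: (@sorted_eq _ <=%R) => //.
- exact: le_trans.
- exact: le_anti.
- by elim: s => //= u s IH; exact: bubble_insert_sorted.
- exact: sort_le_sorted.
rewrite perm_sym perm_sort; elim: s => //= u s IH.
by rewrite perm_sym (perm_trans (perm_bubble_insert R _ _))// perm_cons perm_sym.
Qed.

Lemma bubble_insert_measurable d (X : measurableType d) (R : realType)
    (f : X -> R) (fs : seq (X -> R)) :
  measurable_fun setT f -> measurable_list fs ->
  exists gs : seq (X -> R), measurable_list gs /\
    forall x, bubble_insert (f x) [seq g x | g <- fs] = [seq g x | g <- gs].
Proof.
elim: fs f => [|h fs IH] f mf mfs.
  exists [:: f]; split => //; apply: measurable_list_cons => //.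
have mh : measurable_fun setT h by exact: (mfs 0%N).
have [|gs [mgs gsE]] := IH (fun x => Num.max (f x) (h x)) _ (fun i => mfs i.+1).
  exact: measurable_maxr.
exists ((fun x => Num.min (f x) (h x)) :: gs); split => [|x /=].
  by apply: measurable_list_cons => //; exact: measurable_minr.
by rewrite gsE.
Qed.

Lemma seq_measurable_sort (R : realType) (F : seq R -> \bar R) :
  seq_measurable F -> seq_measurable (fun s => F (sort <=%R s)).
Proof.
move=> mF d X fs mfs.
suff [gs [mgs gsE]] : exists gs : seq (X -> R), measurable_list gs /\
    forall x, sort <=%R [seq g x | g <- fs] = [seq g x | g <- gs].
  by under eq_fun do rewrite gsE; exact: mF.
under eq_exists do under eq_forall do rewrite -foldr_bubble_insert.
elim: fs mfs => [|f fs IH] mfs; first by exists [::].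
have [gs [mgs gsE]] := IH (fun i => mfs i.+1).
have [hs [mhs hsE]] := bubble_insert_measurable _ X R f gs (mfs 0%N) mgs.
by exists hs; split => // x; rewrite /= gsE.
Qed.

(** The observable [G] pulled back through the jumps, the head of the list being the earliest time.
    It is dual to the forward pass [foldl (step_dist vt b)] of the algorithm, see
    [foldl_step_dist]. *)
Fixpoint bwd {R : realType} {S : finType} (M : R -> S -> S -> R) (G : S -> R)
    (s : seq R) (z : S) : R :=
  if s is u :: s' then \sum_(z' : S) M u z z' * bwd M G s' z' else G z.

Lemma seq_measurable_bwd (R : realType) (S : finType) (M : R -> S -> S -> R)
    (G : S -> R) (z : S) :
  (forall z z', measurable_fun setT (fun u => M u z z')) ->
  seq_measurable (fun s => (bwd M G s z)%:E).
Proof.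
move=> mM d X fs mfs; apply/measurable_EFinP.
elim: fs z mfs => [|f fs IH] z mfs /=; first exact: measurable_cst.
apply: measurable_sum => z'; apply: measurable_funM.
  by apply: (measurableT_comp (mM z z')); exact: (mfs 0%N).
by apply: IH => i; exact: (mfs i.+1).
Qed.

Lemma bwd_ge0 (R : realType) (S : finType) (M : R -> S -> S -> R)
    (G : S -> R) s z :
  (forall u z z', 0 <= M u z z') -> (forall z, 0 <= G z) -> 0 <= bwd M G s z.
Proof.
move=> M0 G0; elim: s z => [|u s IH] z //=.
by apply: sumr_ge0 => z' _; rewrite mulr_ge0.
Qed.

Lemma bwd_le (R : realType) (S : finType) (M : R -> S -> S -> R)
    (G : S -> R) (c : R) s z :
  (forall u z z', 0 <= M u z z') -> (forall u z, \sum_z' M u z z' = 1) ->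
  (forall z, G z <= c) -> bwd M G s z <= c.
Proof.
move=> M0 M1 Gc; elim: s z => [|u s IH] z //=.
rewrite -[c]mul1r -(M1 u z) mulr_suml; apply: ler_sum => z' _.
exact: ler_wpM2l.
Qed.

(** Left unnormalised: the factor (t - r)^-n of the uniform points cancels against the power of t -
    r in the Poisson weight, which is why [poisson_sum] has the weights b^n / n!. Without
    normalisation, integrals over [r, t] and [r', t] can be compared directly. *)
Definition iter_mean {R : realType} {S : finType} (M : R -> S -> S -> R) (G : S -> R)
    (t r : R) (n : nat) (z : S) : R :=
  fine (iint `[r, t] n (fun s => (bwd M G (sort <=%R s) z)%:E)).

Definition poisson_sum {R : realType} (b : R) (a : nat -> R) : R :=
  limn (series (fun n => b ^+ n / n`!%:R * a n)).

Lemma poisson_sum_cvg (R : realType) (b c h : R) (a : nat -> R) :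
  0 <= b -> 0 <= h -> 0 <= c -> (forall n, 0 <= a n <= c * h ^+ n) ->
  cvgn (series (fun n => b ^+ n / n`!%:R * a n)) /\
  poisson_sum b a <= c * expR (b * h).
Proof.
move=> b0 h0 c0 ab.
have t0 n : 0 <= b ^+ n / n`!%:R * a n.
  by rewrite mulr_ge0 ?divr_ge0 ?exprn_ge0//; have /andP[] := ab n.
have nd : nondecreasing_seq (series (fun n => b ^+ n / n`!%:R * a n)).
  apply/nondecreasing_seqP => n; rewrite !seriesEnat /= big_nat_recr//=.
  by rewrite lerDl.
have ub n : series (fun n => b ^+ n / n`!%:R * a n) n <= c * expR (b * h).
  rewrite (@le_trans _ _ (c * series (exp_coeff (b * h)) n))//.
    rewrite !seriesEnat /= mulr_sumr; apply: ler_sum => i _.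
    rewrite /exp_coeff /= exprMn mulrCA -!mulrA -mulrCA.
    have /andP[_ ai] := ab i.
    rewrite [leRHS](_ : _ = b ^+ i * ((i`!%:R)^-1 * (c * h ^+ i))); last by ring.
    by rewrite ler_wpM2l ?exprn_ge0// ler_wpM2l// invr_ge0.
  rewrite ler_wpM2l//; apply: nondecreasing_cvgn_le; last first.
    exact: is_cvg_series_exp_coeff.
  apply/nondecreasing_seqP => m; rewrite !seriesEnat /= big_nat_recr//=.
  by rewrite lerDl exp_coeff_ge0// mulr_ge0.
have cv : cvgn (series (fun n => b ^+ n / n`!%:R * a n)).
  apply: nondecreasing_is_cvgn => //.
  by exists (c * expR (b * h)) => _ [n _ <-].
by split => //; apply: limr_le => //; near=> n; exact: ub.
Unshelve. all: by end_near. Qed.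

(* [win M G b t r z] is the mean of [G] at the state reached at time [t] by the
   uniformised chain with clock rate [b] and jump kernels [M] started at [z] at
   time [r]. *)
Definition win {R : realType} {S : finType} (M : R -> S -> S -> R) (G : S -> R)
    (b t r : R) (z : S) : R :=
  expR (- (b * (t - r))) * poisson_sum b (fun n => iter_mean M G t r n z).

Lemma iint_bwd_bound (R : realType) (S : finType) (M : R -> S -> S -> R)
    (G : S -> R) (c r t : R) n z :
  (forall z z', measurable_fun setT (fun u => M u z z')) ->
  (forall u z z', 0 <= M u z z') -> (forall u z, \sum_z' M u z z' = 1) ->
  (forall z, 0 <= G z <= c) -> r <= t ->
  (0 <= iint `[r, t] n (fun s => (bwd M G (sort <=%R s) z)%:E) <=
    (c * (t - r) ^+ n)%:E)%E.
Proof.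
move=> mM M0 M1 Gc rt.
have mF : seq_measurable (fun s => (bwd M G (sort <=%R s) z)%:E).
  apply: (seq_measurable_sort R (fun s => (bwd M G s z)%:E)).
  exact: seq_measurable_bwd.
have F0 s : (0 <= (bwd M G (sort <=%R s) z)%:E)%E.
  by rewrite lee_fin bwd_ge0// => y; have /andP[] := Gc y.
rewrite iint_ge0//=.
have := iint_cst R `[r, t] n c (measurable_itv _).
rewrite [lebesgue_measure _]lebesgue_measure_itv /= lte_fin.
have -> : (if (r < t)%R then t%:E - r%:E else 0)%E = (t - r)%:E.
  by case: ltP => // tr; congr EFin; apply/esym; lra.
rewrite -EFin_expe -EFinM => <-; apply: le_iint => //.
by move=> s; rewrite lee_fin; apply: bwd_le => // y; have /andP[] := Gc y.
Qed.

Lemma iter_mean_bound (R : realType) (S : finType) (M : R -> S -> S -> R)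
    (G : S -> R) (c r t : R) n z :
  (forall z z', measurable_fun setT (fun u => M u z z')) ->
  (forall u z z', 0 <= M u z z') -> (forall u z, \sum_z' M u z z' = 1) ->
  (forall z, 0 <= G z <= c) -> r <= t ->
  iint `[r, t] n (fun s => (bwd M G (sort <=%R s) z)%:E) = (iter_mean M G t r n z)%:E
  /\ 0 <= iter_mean M G t r n z <= c * (t - r) ^+ n.
Proof.
move=> mM M0 M1 Gc rt.
have /andP[I0 I1] := iint_bwd_bound R S M G c r t n z mM M0 M1 Gc rt.
have E : iint `[r, t] n (fun s => (bwd M G (sort <=%R s) z)%:E) =
    (iter_mean M G t r n z)%:E.
  rewrite /iter_mean fineK// ge0_fin_numE//.
  exact: le_lt_trans I1 (ltry _).
by split => //; move: I0 I1; rewrite E !lee_fin => -> ->.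
Qed.

Lemma itv_cc_split (R : realType) (r r' t : R) : r <= r' -> r' <= t ->
  `[r, t]%classic = `[r, r'[%classic `|` `[r', t]%classic :> set R.
Proof.
move=> rr' r't; apply/seteqP; split => x /=; rewrite !in_itv /=.
  by case: (ltP x r') => h /andP[-> ->] /=; [left|right].
by case => /andP[h1 h2]; apply/andP; split; lra.
Qed.

(** Apply [iint_setU_ge] to [r, r'[ and [r', t]. A single point in the first interval precedes all
    the others, hence sorts to the head and is the first jump, which [bwd] splits off. The first
    interval is half-open for disjointness; its integrals do not see the endpoint. *)
Lemma iter_mean_step (R : realType) (S : finType) (M : R -> S -> S -> R)
    (G : S -> R) (c r r' t : R) n z :
  (forall z z', measurable_fun setT (fun u => M u z z')) ->
  (forall u z z', 0 <= M u z z') -> (forall u z, \sum_z' M u z z' = 1) ->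
  (forall z, 0 <= G z <= c) -> r <= r' -> r' <= t ->
  iter_mean M G t r' n.+1 z + n.+1%:R *
    (\sum_z' (\int[lebesgue_measure]_(u in `[r, r']) M u z z') * iter_mean M G t r' n z')
  <= iter_mean M G t r n.+1 z.
Proof.
move=> mM M0 M1 Gc rr' r't; have rt := le_trans rr' r't.
have G0 y : 0 <= G y by have /andP[] := Gc y.
have mF y : seq_measurable (fun s => (bwd M G (sort <=%R s) y)%:E).
  apply: (seq_measurable_sort R (fun s => (bwd M G s y)%:E)).
  exact: seq_measurable_bwd.
have F0 y s : (0 <= (bwd M G (sort <=%R s) y)%:E)%E by rewrite lee_fin bwd_ge0.
have [E1 _] := iter_mean_bound R S M G c r t n.+1 z mM M0 M1 Gc rt.
have [E2 _] := iter_mean_bound R S M G c r' t n.+1 z mM M0 M1 Gc r't.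
have mA : measurable (`[r, r'[ : set R) by exact: measurable_itv.
have mB : measurable (`[r', t] : set R) by exact: measurable_itv.
have dAB : [disjoint (`[r, r'[ : set R) & (`[r', t] : set R)].
  apply/disj_setPS => x [] /=; rewrite !in_itv /= => /andP[_ h1] /andP[h2 _].
  by move: (lt_le_trans h1 h2); rewrite ltxx.
have sF s s' : perm_eq s s' ->
    (bwd M G (sort <=%R s) z)%:E = (bwd M G (sort <=%R s') z)%:E.
  move=> ss'; congr (bwd M G _ z)%:E; apply/perm_sortP => //.
  - exact: le_total.
  - exact: le_trans.
  - exact: le_anti.
have := iint_setU_ge R _ _ mA mB dAB n _ (F0 z) (mF z) sF.
rewrite -(itv_cc_split R r r' t rr' r't) E1 E2.
have intM y : (\int[lebesgue_measure]_(u in `[r, r'[) (M u z y)%:E =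
    (\int[lebesgue_measure]_(u in `[r, r']) M u z y)%R%:E)%E.
  have mMy : measurable_fun setT (fun u => (M u z y)%:E) by exact/measurable_EFinP.
  rewrite integral_itv_bndo_bndc; last exact: measurable_funTS.
  rewrite /Rintegral fineK// ge0_fin_numE; last first.
    by apply: integral_ge0 => u _; rewrite lee_fin.
  apply: (@le_lt_trans _ _ (\int[lebesgue_measure]_(u in `[r, r']) 1%:E)%E).
    apply: ge0_le_integral => //.
    - by move=> u _; rewrite lee_fin.
    - exact: measurable_funTS.
    - by move=> u _; rewrite lee_fin -(M1 u z) (bigD1 y)//= lerDl sumr_ge0.
  rewrite integral_cst// mul1e /= lebesgue_measure_itv /=.
  by case: ifPn => _; exact: ltry.
suff -> : (\int[lebesgue_measure]_(u in `[r, r'[)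
      iint `[r', t] n (fun s => (bwd M G (sort <=%R (u :: s)) z)%:E) =
    (\sum_z' (\int[lebesgue_measure]_(u in `[r, r']) M u z z')%R *
        iter_mean M G t r' n z')%:E)%E.
  by rewrite -EFinM -EFinD lee_fin.
transitivity (\int[lebesgue_measure]_(u in `[r, r'[)
    \sum_z' (iter_mean M G t r' n z')%:E * (M u z z')%:E)%E.
  apply: eq_integral => u; rewrite inE /= in_itv /= => /andP[_ ur'].
  transitivity (iint `[r', t] n
      (fun s => \sum_z' (M u z z')%:E * (bwd M G (sort <=%R s) z')%:E)%E).
    apply: eq_iint => s Hs.
    (* The bounds [u < r'] and [r' <= v] for every other point [v] put [u] at the head. *)
    have -> : sort <=%R (u :: s) = u :: sort <=%R s.
      apply: (@sorted_eq _ <=%R).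
      - exact: le_trans.
      - exact: le_anti.
      - exact: sort_le_sorted.
      - rewrite /= path_sortedE; last exact: le_trans.
        rewrite sort_le_sorted andbT; apply/allP => v; rewrite mem_sort => /Hs /=.
        by rewrite in_itv /= => /andP[h _]; exact: le_trans (ltW ur') h.
      - by rewrite perm_sort perm_cons perm_sym perm_sort.
    by rewrite /= -sumEFin; apply: eq_bigr => y _; rewrite EFinM.
  rewrite iint_sum//; apply: eq_bigr => y _.
  by rewrite (proj1 (iter_mean_bound R S M G c r' t n y mM M0 M1 Gc r't)) muleC.
have a0 y : 0 <= iter_mean M G t r' n y.
  by have [_ /andP[]] := iter_mean_bound R S M G c r' t n y mM M0 M1 Gc r't.
rewrite ge0_integral_sum//.
- rewrite -sumEFin; apply: eq_bigr => y _.
  have M0y u : `[r, r'[%classic u -> (0 <= (M u z y)%:E)%E by rewrite lee_fin.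
  have mMy : measurable_fun `[r, r'[ (fun u => (M u z y)%:E).
    by apply: measurable_funTS; exact/measurable_EFinP.
  apply: (eq_trans (ge0_integralZl_EFin lebesgue_measure mA M0y mMy (a0 y))).
  by rewrite intM EFinM muleC.
- move=> y; have mMy : measurable_fun setT (fun u => (M u z y)%:E).
    exact/measurable_EFinP.
  by apply: measurable_funTS; exact: measurable_funeM mMy.
- by move=> y u _; rewrite mule_ge0// lee_fin.
Qed.

(** The lower bound is the contribution of the clock not ringing at all. It makes [win] positive
    when [G] is, so that logarithms can be taken, and at [r = t] it compares [win] with [G]
    itself. *)
Lemma win_bounds (R : realType) (S : finType) (M : R -> S -> S -> R)
    (G : S -> R) (b c r t : R) z :
  (forall z z', measurable_fun setT (fun u => M u z z')) ->
  (forall u z z', 0 <= M u z z') -> (forall u z, \sum_z' M u z z' = 1) ->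
  (forall z, 0 <= G z <= c) -> 0 <= b -> 0 <= c -> r <= t ->
  cvgn (series (fun n => b ^+ n / n`!%:R * iter_mean M G t r n z)) /\
  expR (- (b * (t - r))) * G z <= win M G b t r z <= c.
Proof.
move=> mM M0 M1 Gc b0 c0 rt.
have ab n : 0 <= iter_mean M G t r n z <= c * (t - r) ^+ n.
  by have [] := iter_mean_bound R S M G c r t n z mM M0 M1 Gc rt.
have rt0 : 0 <= t - r by lra.
have [cv le] := poisson_sum_cvg R b c (t - r) _ b0 rt0 c0 ab.
split => //; apply/andP; split; last first.
  rewrite -[leRHS](mulKf (lt0r_neq0 (expR_gt0 (b * (t - r))))) /win expRN.
  by rewrite ler_wpM2l ?invr_ge0 ?expR_ge0// mulrC.
rewrite /win ler_wpM2l ?expR_ge0//; apply: limr_ge => //.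
near=> n.
have n0 : (0 < n)%N by near: n; exact: nbhs_infty_gt.
rewrite seriesEnat /= -(prednK n0) big_nat_recl//= expr0 fact0 invr1 !mul1r.
rewrite lerDl sumr_ge0// => i _.
by rewrite mulr_ge0 ?divr_ge0 ?exprn_ge0//; have /andP[] := ab i.+1.
Unshelve. all: by end_near. Qed.

(** The two terms on the left correspond to no ring and exactly one ring of the clock before r'. The
    bound follows by summing [iter_mean_step] over the number of rings: the factor n + 1 turns
    b^(n+1) / (n+1)! into b times b^n / n!. *)
Lemma win_step (R : realType) (S : finType) (M : R -> S -> S -> R)
    (G : S -> R) (b c r r' t : R) z :
  (forall z z', measurable_fun setT (fun u => M u z z')) ->
  (forall u z z', 0 <= M u z z') -> (forall u z, \sum_z' M u z z' = 1) ->
  (forall z, 0 <= G z <= c) -> 0 <= b -> 0 <= c -> r <= r' -> r' <= t ->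
  expR (- (b * (r' - r))) * (win M G b t r' z +
    b * \sum_z' (\int[lebesgue_measure]_(u in `[r, r']) M u z z') * win M G b t r' z')
  <= win M G b t r z.
Proof.
move=> mM M0 M1 Gc b0 c0 rr' r't; have rt := le_trans rr' r't.
pose m z' := \int[lebesgue_measure]_(u in `[r, r']) M u z z'.
have cv y : cvgn (series (fun n => b ^+ n / n`!%:R * iter_mean M G t r' n y)).
  by have [] := win_bounds R S M G b c r' t y mM M0 M1 Gc b0 c0 r't.
have cvr : cvgn (series (fun n => b ^+ n / n`!%:R * iter_mean M G t r n z)).
  by have [] := win_bounds R S M G b c r t z mM M0 M1 Gc b0 c0 rt.
suff H : poisson_sum b (fun n => iter_mean M G t r' n z) +
     b * (\sum_z' m z' * poisson_sum b (fun n => iter_mean M G t r' n z')) <=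
   poisson_sum b (fun n => iter_mean M G t r n z).
  rewrite /win.
  have -> : expR (- (b * (t - r))) = expR (- (b * (r' - r))) * expR (- (b * (t - r'))).
    by rewrite -expRD; congr expR; ring.
  rewrite -[leRHS]mulrA ler_wpM2l ?expR_ge0//.
  apply: le_trans (ler_wpM2l (expR_ge0 _) H).
  rewrite le_eqVlt; apply/orP; left; apply/eqP.
  rewrite [RHS]mulrDr; congr (_ + _); rewrite [RHS]mulrCA; congr (_ * _).
  by rewrite mulr_sumr; apply: eq_bigr => y _; rewrite mulrCA.
have cvS : (fun N => series (fun n => b ^+ n / n`!%:R * iter_mean M G t r n z) N.+1)
    @ \oo --> poisson_sum b (fun n => iter_mean M G t r n z).
  by rewrite (cvg_shiftS (series _)); exact: cvr.
have cvS' : (fun N => series (fun n => b ^+ n / n`!%:R * iter_mean M G t r' n z) N.+1)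
    @ \oo --> poisson_sum b (fun n => iter_mean M G t r' n z).
  by rewrite (cvg_shiftS (series _)); exact: cv.
have cvL : (fun N => series (fun n => b ^+ n / n`!%:R * iter_mean M G t r' n z) N.+1 +
     b * (\sum_z' m z' * series (fun n => b ^+ n / n`!%:R * iter_mean M G t r' n z') N))
   @ \oo --> poisson_sum b (fun n => iter_mean M G t r' n z) +
     b * (\sum_z' m z' * poisson_sum b (fun n => iter_mean M G t r' n z')).
  apply: cvgD => //; apply: cvgMl_tmp; apply: cvg_big => [|y _].
    exact: add_continuous.
  by apply: cvgMl_tmp; exact: cv.
rewrite -(cvg_lim _ cvL)// -(cvg_lim _ cvS)//.
apply: ler_lim; [exact: cvgP cvL|exact: cvgP cvS|].
near=> N; rewrite !seriesEnat /=.
(* The terms with zero rings on the whole of [r, t] agree on both sides; the rest is matched with an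
   index shift, n + 1 rings after r against n rings after r' and one before. *)
rewrite big_nat_recl//= [leRHS]big_nat_recl//= -addrA lerD//.
under [X in _ + b * X]eq_bigr do rewrite seriesEnat /= mulr_sumr.
rewrite exchange_big /= mulr_sumr -big_split /=; apply: ler_sum => n _.
have := iter_mean_step R S M G c r r' t n z mM M0 M1 Gc rr' r't.
have fn : 0 <= b ^+ n.+1 / n.+1`!%:R by rewrite divr_ge0 ?exprn_ge0.
move=> /(ler_wpM2l fn); apply: le_trans; rewrite mulrDr lerD2l.
rewrite !mulr_sumr; apply: ler_sum => y _; rewrite le_eqVlt; apply/orP; left.
apply/eqP; rewrite /m factS natrM exprS; field.
by rewrite nat1r !pnatr_eq0 -!lt0n fact_gt0.
Unshelve. all: by end_near. Qed.

(** * Entropy along a time interval *)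

(** Use ln y <= y - 1 at y = 1 / (1 + x); the remainder x^2 / (1 + x) is at most 2 x^2 because 1 + x
    >= 1/2. *)
Lemma ln1Dx_ge (R : realType) (x : R) : - (1 / 2) <= x -> x - 2 * x ^+ 2 <= ln (1 + x).
Proof.
move=> hx; have x1 : 0 < 1 + x by lra.
have h : -1 < (1 + x)^-1 - 1 by rewrite ltrBrDl addrN invr_gt0.
have := le_ln1Dx h; rewrite addrC subrK lnV// => h1.
suff : (1 + x)^-1 - 1 <= - x + 2 * x ^+ 2 by lra.
rewrite -(ler_pM2r x1) mulrBl mulVf ?gt_eqF//.
have := sqr_ge0 x; nra.
Qed.

(** A substitute for a nonpositive derivative that needs no differentiability: n equal steps
    accumulate an error of at most C (t - s)^2 / n. *)
Lemma telescope_le (R : realType) (Psi : R -> R) (s t C h0 : R) :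
  s <= t -> 0 <= C -> 0 < h0 ->
  (forall r r', s <= r -> r <= r' -> r' <= t -> r' - r <= h0 ->
    Psi r' - Psi r <= C * (r' - r) ^+ 2) ->
  Psi t <= Psi s.
Proof.
move=> st C0 h00 H; rewrite leNgt; apply/negP => lt.
pose D := Psi t - Psi s; have D0 : 0 < D by rewrite subr_gt0.
(* More than [B] steps make each one no longer than [h0] and the total error smaller than the
   supposed increase [D]. *)
pose B := (t - s) / h0 + C * (t - s) ^+ 2 / D.
have ts0 : 0 <= t - s by lra.
have B1 : 0 <= (t - s) / h0 by rewrite divr_ge0// ltW.
have B2 : 0 <= C * (t - s) ^+ 2 / D by rewrite divr_ge0 ?mulr_ge0 ?sqr_ge0// ltW.
have B0 : 0 <= B by exact: addr_ge0.
pose n := (Num.Def.archi_bound B); have nB : B < n%:R by exact: archi_boundP.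
have n0 : 0 < n%:R :> R by exact: le_lt_trans nB.
pose h := (t - s) / n%:R; have hh0 : 0 <= h by rewrite divr_ge0// ltW.
have hle : h <= h0.
  rewrite ler_pdivrMr// mulrC -ler_pdivrMr//; apply: ltW; apply: le_lt_trans nB.
  by rewrite lerDl.
have key i : (i <= n)%N -> Psi (s + i%:R * h) - Psi s <= i%:R * (C * h ^+ 2).
  elim: i => [|i IH] ilt; first by rewrite !mul0r addr0 subrr.
  have ih : i.+1%:R * h <= t - s.
    by rewrite /h mulrCA ler_piMr// ler_pdivrMr// mul1r ler_nat.
  have i0 : 0 <= i%:R * h by exact: mulr_ge0.
  have e : i.+1%:R * h = i%:R * h + h by rewrite -natr1 mulrDl mul1r.
  have := IH (ltnW ilt); rewrite e -[i.+1%:R]natr1 mulrDl mul1r.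
  move: ih i0; rewrite e; set P := i%:R * h => ih i0.
  have := H (s + P) (s + (P + h)).
  rewrite (_ : s + (P + h) - (s + P) = h); last by ring.
  have a1 : s <= s + P by rewrite lerDl.
  have a2 : s + P <= s + (P + h) by rewrite lerD2l lerDl.
  have a3 : s + (P + h) <= t by rewrite -lerBrDl.
  move=> /(_ a1 a2 a3 hle) a4 a5.
  have -> : Psi (s + (P + h)) - Psi s =
    (Psi (s + P) - Psi s) + (Psi (s + (P + h)) - Psi (s + P)) by ring.
  exact: lerD.
have := key n (leqnn n).
have -> : s + n%:R * h = t by rewrite /h mulrC divfK ?gt_eqF//; ring.
rewrite -/D => le.
have : C * (t - s) ^+ 2 / D < n%:R.
  by apply: le_lt_trans nB; rewrite lerDr.
rewrite ltr_pdivrMr// => lt2.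
have e2 : n%:R * (C * h ^+ 2) * n%:R = C * (t - s) ^+ 2.
  by rewrite /h; field; rewrite gt_eqF.
have : n%:R * (C * h ^+ 2) < D.
  by rewrite -(ltr_pM2r n0) e2 [D * _]mulrC.
by move=> /(le_lt_trans le); rewrite ltxx.
Qed.

Lemma sum_le_card (R : realType) (S : finType) (F : S -> R) (B : R) :
  (forall y, F y <= B) -> \sum_y F y <= #|S|%:R * B.
Proof.
move=> FB; apply: (le_trans (ler_sum _ (fun y _ => FB y))).
by rewrite sumr_const mulr_natl.
Qed.

Lemma is_derive_sumr (R : realType) (I : Type) (r : seq I) (F : I -> R -> R)
    (dF : I -> R) (x : R) :
  (forall i, is_derive x (1 : R) (F i) (dF i)) ->
  is_derive x (1 : R) (fun v => \sum_(i <- r) F i v) (\sum_(i <- r) dF i).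
Proof.
move=> H; elim: r => [|i r IH].
  rewrite big_nil (_ : (fun _ => _) = cst 0); first exact: is_derive_cst.
  by apply/funext => v; rewrite big_nil.
rewrite big_cons (_ : (fun _ => _) = F i + (fun v => \sum_(i <- r) F i v)).
  exact: is_deriveD.
by apply/funext => v; rewrite big_cons.
Qed.

Lemma is_derive_scaler (R : realType) (c : R) (F : R -> R) (dF x : R) :
  is_derive x (1 : R) F dF -> is_derive x (1 : R) (fun v => F v * c) (dF * c).
Proof.
move=> H; have := is_deriveZ c H.
rewrite (_ : (fun v => _) = c \*: F); last first.
  by apply/funext => v; rewrite /= mulrC.
by rewrite /= mulrC.
Qed.

Lemma integrable_sum_scale (R : realType) (I : Type) (r : seq I) (D : set R)
    (c : I -> R) (F : I -> R -> R) : measurable (D : set (measurableTypeR R)) ->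
  (forall i, lebesgue_measure.-integrable D (EFin \o F i)) ->
  lebesgue_measure.-integrable D (EFin \o (fun u => \sum_(i <- r) c i * F i u)) /\
  \int[lebesgue_measure]_(u in D) (\sum_(i <- r) c i * F i u) =
  \sum_(i <- r) c i * \int[lebesgue_measure]_(u in D) F i u.
Proof.
move=> mD iF.
have iZ i : lebesgue_measure.-integrable D (EFin \o (fun u => c i * F i u)).
  by have := integrableZl mD (c i) (iF i).
elim: r => [|i r [IH1 IH2]].
  rewrite big_nil (_ : (fun u : R => _) = (fun=> 0)); last first.
    by apply/funext => v; rewrite big_nil.
  split; first exact: integrable0.
  by rewrite Rintegral_cst// mul0r.
rewrite big_cons (_ : (fun u : R => _) =
    (fun u => c i * F i u + \sum_(i <- r) c i * F i u)); last first.
  by apply/funext => v; rewrite big_cons.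
split; first by have := integrableD mD (iZ i) IH1.
by rewrite RintegralD// IH2 RintegralZl.
Qed.

Lemma integrable_itv_bounded (R : realType) (r r' b : R) (g : R -> R) :
  measurable_fun setT g -> (forall u, 0 <= g u <= b) ->
  lebesgue_measure.-integrable (`[r, r'] : set R) (EFin \o g).
Proof.
move=> mg gb; apply: measurable_bounded_integrable => //.
- by rewrite /= lebesgue_measure_itv /=; case: ifPn => _; exact: ltry.
- exact: measurable_funTS.
- exists b; split; first exact: num_real.
  move=> M bM u _ /=; have /andP[g0 gu] := gb u.
  by rewrite ger0_norm//; lra.
Qed.

Lemma Rintegral_itv_cst (R : realType) (r r' c : R) : r <= r' ->
  \int[lebesgue_measure]_(u in `[r, r']) c = c * (r' - r).
Proof.
move=> rr'; rewrite Rintegral_cst// /= lebesgue_measure_itv /= lte_fin.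
by case: ltP => //= h; congr (_ * _); lra.
Qed.

Lemma Rintegral_itv_bounds (R : realType) (r r' b : R) (g : R -> R) : r <= r' ->
  measurable_fun setT g -> (forall u, 0 <= g u <= b) ->
  0 <= \int[lebesgue_measure]_(u in `[r, r']) g u <= b * (r' - r).
Proof.
move=> rr' mg gb; apply/andP; split.
  by apply: Rintegral_ge0 => u _; have /andP[] := gb u.
rewrite -(Rintegral_itv_cst R r r' b rr'); apply: le_Rintegral => //.
- exact: (integrable_itv_bounded R r r' b).
- apply: (integrable_itv_bounded R r r' b) => // u; rewrite lexx andbT.
  by have /andP[h1 h2] := gb u; exact: le_trans h2.
- by move=> u _; have /andP[] := gb u.
Qed.

(** Discrete integration by parts. The convention is that [J y' y] is the flow from [y] to [y'], so
    the first factor on the left is inflow minus outflow. *)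
Lemma flux_by_parts (R : realType) (S : finType) (J : S -> S -> R) (f : S -> R) :
  \sum_y (\sum_y' (J y y' - J y' y)) * f y =
  \sum_y \sum_y' J y' y * (f y' - f y).
Proof.
under eq_bigr do rewrite mulr_suml.
under eq_bigr do under eq_bigr do rewrite mulrBl.
under [RHS]eq_bigr do under eq_bigr do rewrite mulrBr.
under eq_bigr do rewrite sumrB.
under [RHS]eq_bigr do rewrite sumrB.
by rewrite !sumrB; congr (_ - _); rewrite exchange_big.
Qed.

Lemma mul_le_half (R : realType) (x y : R) :
  0 <= x -> 0 <= y -> y <= (2 * (x + 1))^-1 -> x * y <= 1 / 2.
Proof.
move=> x0 y0; rewrite -[(_)^-1]mul1r ler_pdivlMr; last by rewrite mulr_gt0// ltr_wpDl.
nra.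
Qed.

(* One small time step.  The first-order terms of both contributions to the
   increment of [\sum_y Q y * ln (k y)] combine, under the integral sign, into
   the expression that [hpt] bounds by [l u]. *)
Lemma entropy_local (R : realType) (S : finType) (s t b c lo L : R)
    (k : R -> S -> R) (Rh : R -> S -> S -> R) (Q : R -> S -> R)
    (J : R -> S -> S -> R) (l : R -> R) :
  s <= t -> 0 <= b -> 0 < lo -> 0 <= L ->
  (forall r y, s <= r <= t -> lo <= k r y <= c) ->
  (forall y' y, measurable_fun setT (fun u => Rh u y' y)) ->
  (forall u y' y, 0 <= Rh u y' y <= b) ->
  (forall r r' y, s <= r -> r <= r' -> r' <= t ->
    expR (- (b * (r' - r))) * (k r' y * (1 + b * (r' - r)) +
      \sum_y' (\int[lebesgue_measure]_(u in `[r, r']) Rh u y' y) *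
        (k r' y' - k r' y)) <= k r y) ->
  (forall u y, s <= u <= t -> 0 <= Q u y <= 1) ->
  (forall r u y, s <= r -> r <= u -> u <= t -> `|Q u y - Q r y| <= L * (u - r)) ->
  (forall r u y' y, s <= r -> r <= u -> u <= t ->
    `|J u y' y - J r y' y| <= L * (u - r)) ->
  (forall u y, s <= u <= t ->
    is_derive u (1 : R) (fun v => Q v y) (\sum_y' (J u y y' - J u y' y))) ->
  (forall u f, s <= u <= t ->
    \sum_y \sum_y' (J u y' y * (f y' - f y) -
      Q u y * Rh u y' y * (expR (f y' - f y) - 1)) <= l u) ->
  lebesgue_measure.-integrable (`[s, t] : set R) (EFin \o l) ->
  exists C h0, [/\ 0 <= C, 0 < h0 &
  forall r r', s <= r -> r <= r' -> r' <= t -> r' - r <= h0 ->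
    \sum_y Q r' y * ln (k r' y) - \sum_y Q r y * ln (k r y) <=
    \int[lebesgue_measure]_(u in `[r, r']) l u + C * (r' - r) ^+ 2].
Proof.
move=> st b0 lo0 L0 hk mRh bRh hstep hQ lipQ lipJ dQ hpt il.
pose N : R := #|S|%:R; have N0 : 0 <= N by [].
(* [Lam] bounds |ln k|, [rho] bounds |k(y') / k(y) - 1|, and [C1 * h] the relative first-order
   change of k. [C2] collects the quadratic remainder of the logarithm and the variation of the
   flow, [C3] the cost of freezing [J] and [Q] at time r under the integral. The absolute value of
   [rho] gives nonnegative constants without a state from which [lo <= c] would be read off. *)
pose Lam : R := `|ln lo| + `|ln c|; have Lam0 : 0 <= Lam by rewrite addr_ge0.
pose rho : R := c / lo + 1.
pose C1 : R := b + N * (b * `|rho|).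
have C10 : 0 <= C1 by rewrite addr_ge0// !mulr_ge0.
pose C2 : R := N * (2 * C1 ^+ 2) + N * (N * (L * (2 * Lam))).
pose C3 : R := N * (N * (L * (2 * Lam) + L * b * `|rho|)).
(* This step size keeps [C1 * h] below 1/2, the range in which [ln1Dx_ge] applies. *)
exists (C2 + C3), (2 * (C1 + 1))^-1; split.
- by rewrite !addr_ge0// !mulr_ge0 ?sqr_ge0// addr_ge0// !mulr_ge0.
- by rewrite invr_gt0 mulr_gt0// ltr_wpDl.
move=> r r' sr rr' r't hs.
set h : R := r' - r; have h0 : 0 <= h by rewrite subr_ge0.
have C1h : C1 * h <= 1 / 2.
  exact: mul_le_half.
have r'in : s <= r' <= t by rewrite r't andbT; exact: le_trans rr'.
have rin : s <= r <= t by rewrite sr/=; exact: le_trans r't.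
pose f y : R := ln (k r' y).
have k0 v y : s <= v <= t -> 0 < k v y.
  by move=> /(hk v y) /andP[h1 _]; exact: lt_le_trans h1.
have fLam y : `|f y| <= Lam.
  have /andP[k1 k2] := hk r' y r'in; have kp := k0 r' y r'in.
  have c0 : 0 < c by exact: lt_le_trans k2.
  have l1 : ln lo <= f y by rewrite ler_ln.
  have l2 : f y <= ln c by rewrite ler_ln.
  rewrite ler_norml /Lam; have := ler_norm (ln c); have := ler_norm (- ln lo).
  have := normr_ge0 (ln c); have := normr_ge0 (ln lo); rewrite normrN.
  by move=> *; apply/andP; split; lra.
have dfLam y y' : `|f y' - f y| <= 2 * Lam.
  by rewrite (le_trans (ler_normB _ _))//; have := fLam y; have := fLam y'; lra.
have eE y y' : expR (f y' - f y) = k r' y' / k r' y.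
  by rewrite expRB !lnK// posrE k0.
have erho y y' : `|expR (f y' - f y) - 1| <= `|rho|.
  have /andP[k1 k2] := hk r' y r'in; have /andP[k3 k4] := hk r' y' r'in.
  have kp := k0 r' y r'in; have kp' := k0 r' y' r'in.
  have q0 : 0 < k r' y' / k r' y by rewrite divr_gt0.
  have qc : k r' y' / k r' y <= c / lo.
    by rewrite ler_pM// ?invr_ge0 ?(ltW kp)// ?(ltW kp')// lef_pV2.
  have rho1 : `|rho| = rho by rewrite ger0_norm// /rho; lra.
  by rewrite eE rho1 /rho ler_norml; apply/andP; split; lra.
pose A y' y : R := \int[lebesgue_measure]_(u in `[r, r']) Rh u y' y.
have Ab y' y : 0 <= A y' y <= b * h by exact: Rintegral_itv_bounds.
(* Dividing the bracket of [hstep] by [k r' y] gives exactly [1 + (b * h + X y)]. *)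
pose X y : R := \sum_y' A y' y * (expR (f y' - f y) - 1).
have Xb y : `|b * h + X y| <= C1 * h.
  rewrite (le_trans (ler_normD _ _))// /C1 mulrDl ger0_norm ?mulr_ge0// lerD2l.
  rewrite (le_trans (ler_norm_sum _ _ _))// -mulrA; apply: sum_le_card => y'.
  have /andP[A0 Ah] := Ab y' y.
  rewrite normrM (ger0_norm A0) [leRHS](_ : _ = (b * h) * `|rho|); last by ring.
  by rewrite ler_pM.
(* In the logarithm of [hstep], the [- b * h] from the exponential cancels the [b * h] of the
   bracket, so the clock rate disappears at first order. *)
have lnk y : f y + X y - 2 * (C1 ^+ 2 * h ^+ 2) <= ln (k r y).
  have Xb' := Xb y; rewrite ler_norml in Xb'; case/andP: Xb' => X1 X2.
  have p1 : - (1 / 2) <= b * h + X y by lra.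
  have kp := k0 r' y r'in.
  have := hstep r r' y sr rr' r't; rewrite -/h.
  have -> : \sum_y' (\int[lebesgue_measure]_(u in `[r, r']) Rh u y' y) *
        (k r' y' - k r' y) = k r' y * X y.
    rewrite /X mulr_sumr; apply: eq_bigr => y' _; rewrite eE -/(A y' y); field.
    by rewrite gt_eqF.
  rewrite -mulrDr -addrA => hh.
  have p0 : 0 < 1 + (b * h + X y) by lra.
  have : ln (expR (- (b * h)) * (k r' y * (1 + (b * h + X y)))) <= ln (k r y).
    by rewrite ler_ln ?posrE ?k0// !mulr_gt0// expR_gt0.
  rewrite !lnM ?posrE ?mulr_gt0 ?expR_gt0// expRK -/(f y).
  have := ln1Dx_ge R _ p1.
  have sq : (b * h + X y) ^+ 2 <= C1 ^+ 2 * h ^+ 2.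
    by rewrite -exprMn -real_normK ?num_real// lerXn2r ?nnegrE ?mulr_ge0// (Xb y).
  lra.
have part1 : \sum_y Q r y * (f y - ln (k r y)) <=
    - \sum_y Q r y * X y + N * (2 * C1 ^+ 2) * h ^+ 2.
  rewrite -sumrN -mulrA.
  have -> : N * (2 * C1 ^+ 2 * h ^+ 2) = \sum_(y : S) 2 * C1 ^+ 2 * h ^+ 2.
    by rewrite sumr_const /N mulr_natl.
  rewrite -big_split /=; apply: ler_sum => y _.
  have /andP[Q0 Q1] := hQ r y rin.
  have h1 : f y - ln (k r y) <= - X y + 2 * (C1 ^+ 2 * h ^+ 2) by have := lnk y; lra.
  apply: (le_trans (ler_wpM2l Q0 h1)); rewrite mulrDr mulrN lerD2l -[leRHS]mulrA.
  by rewrite ler_piMl// !mulr_ge0// sqr_ge0.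
pose F u := \sum_y \sum_y' J u y' y * (f y' - f y).
(* Mean value theorem for the mean of the fixed function [f] under [Q v]; its derivative at an
   intermediate time is moved to r by the Lipschitz bound on [J]. *)
have part2 : \sum_y (Q r' y - Q r y) * f y <= F r * h + N * (N * (L * (2 * Lam))) * h ^+ 2.
  pose g v := \sum_y Q v y * f y.
  have dg v : s <= v <= t -> is_derive v (1 : R) g (F v).
    move=> vin; rewrite /F -flux_by_parts; apply: is_derive_sumr => y.
    by apply: is_derive_scaler; exact: dQ.
  have [v||xi] := @MVT_segment R g F r r' rr'.
  - rewrite in_itv /= => /andP[v1 v2]; apply: dg; apply/andP; split; lra.
  - apply: derivable_within_continuous => v; rewrite in_itv /= => /andP[v1 v2].
    have vin : s <= v <= t by apply/andP; split; lra.
    by have [? _] := dg v vin.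
  rewrite in_itv /= => /andP[x1 x2].
  have -> : g r' - g r = \sum_y (Q r' y - Q r y) * f y.
    by rewrite /g -sumrB; apply: eq_bigr => y _; rewrite mulrBl.
  move=> ->; rewrite -/h.
  suff : F xi - F r <= N * (N * (L * (2 * Lam))) * h.
    by move: (F xi) (F r) (N * _) => ? ? ?; nra.
  rewrite /F -sumrB -[leRHS]mulrA; apply: sum_le_card => y.
  rewrite -sumrB -[leRHS]mulrA; apply: sum_le_card => y'.
  rewrite -mulrBl (le_trans (ler_norm _))// normrM.
  have h1 := lipJ r xi y' y sr x1 (le_trans x2 r't).
  rewrite [leRHS](_ : _ = (L * h) * (2 * Lam)); last by ring.
  apply: ler_pM => //; apply: (le_trans h1); apply: ler_wpM2l => //.
  by rewrite /h; lra.
have iRh y' y : lebesgue_measure.-integrable (`[r, r'] : set R) (EFin \o (Rh ^~ y' ^~ y)).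
  exact: (integrable_itv_bounded R r r' b).
pose cf (p : S * S) := Q r p.1 * (expR (f p.2 - f p.1) - 1).
have [iE intE] := integrable_sum_scale R _ (index_enum (S * S)%type) (`[r, r'] : set R) cf
  (fun p u => Rh u p.2 p.1) (measurable_itv _) (fun p => iRh p.2 p.1).
have mI : measurable (`[r, r'] : set (measurableTypeR R)) by exact: measurable_itv.
(* The left side is an integral over [r, r'] with [J] and [Q] frozen at r while the rates vary with
   u. Unfreezing costs a multiple of [h] pointwise, and then [hpt] applies at each u; the rates,
   which are only measurable, are never moved in time. *)
have part3 : F r * h - \sum_y Q r y * X y <=
    \int[lebesgue_measure]_(u in `[r, r']) l u + C3 * h ^+ 2.
  have -> : \sum_y Q r y * X y =
      \int[lebesgue_measure]_(u in `[r, r']) (\sum_(p : S * S) cf p * Rh u p.2 p.1).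
    transitivity (\sum_y \sum_y' cf (y, y') * A y' y); last by rewrite intE pair_bigA.
    apply: eq_bigr => y _; rewrite /X mulr_sumr; apply: eq_bigr => y' _.
    by rewrite /cf /=; ring.
  have icst v : lebesgue_measure.-integrable (`[r, r'] : set R) (EFin \o (fun=> v)).
    apply: measurable_bounded_integrable => //.
      by rewrite /= lebesgue_measure_itv /=; case: ifPn => _; exact: ltry.
    exists `|v|; split; first exact: num_real.
    by move=> M vM u _ /=; exact: ltW.
  have il' : lebesgue_measure.-integrable (`[r, r'] : set R) (EFin \o l).
    apply: (integrableS _ _ _ il) => //.
    by move=> v /=; rewrite !in_itv /= => /andP[v1 v2]; apply/andP; split; lra.
  have -> : C3 * h ^+ 2 = \int[lebesgue_measure]_(u in `[r, r']) (C3 * h).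
    by rewrite Rintegral_itv_cst// -/h; ring.
  rewrite -RintegralD// -/h -(Rintegral_itv_cst R r r' (F r) rr') -RintegralB//.
  apply: le_Rintegral => //.
  - by have := integrableB mI (icst (F r)) iE.
  - by have := integrableD mI il' (icst (C3 * h)).
  move=> u /=; rewrite in_itv /= => /andP[ru ur'].
  have uin : s <= u <= t by apply/andP; split; lra.
  apply: le_trans (lerD (hpt u f uin) (lexx _)); rewrite -lerBlDl.
  have -> : \sum_(p : S * S) cf p * Rh u p.2 p.1 = \sum_y \sum_y' cf (y, y') * Rh u y' y.
    by rewrite pair_bigA.
  rewrite /F.
  rewrite -!sumrB /C3 -mulrA; apply: sum_le_card => y.
  rewrite -!sumrB -mulrA; apply: sum_le_card => y'.
  have uh : u - r <= h by rewrite /h; lra.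
  have /andP[R0 Rb] := bRh u y' y.
  have e1 := lipJ r u y' y sr ru (le_trans ur' r't).
  have e2 := lipQ r u y sr ru (le_trans ur' r't).
  rewrite [leLHS](_ : _ = (J r y' y - J u y' y) * (f y' - f y) +
    (Q u y - Q r y) * Rh u y' y * (expR (f y' - f y) - 1)); last by rewrite /cf /=; ring.
  rewrite [leRHS]mulrDl; apply: lerD.
    rewrite (le_trans (ler_norm _))// normrM distrC.
    rewrite [leRHS](_ : _ = (L * h) * (2 * Lam)); last by ring.
    by apply: ler_pM => //; apply: (le_trans e1); apply: ler_wpM2l.
  rewrite (le_trans (ler_norm _))// !normrM [`|Rh _ _ _|]ger0_norm//.
  rewrite [leRHS](_ : _ = (L * h) * b * `|rho|); last by ring.
  apply: ler_pM => //; first by rewrite mulr_ge0.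
  by apply: ler_pM => //; apply: (le_trans e2); apply: ler_wpM2l.
(* Discrete product rule: [Q] is taken at r for the change of ln k, and ln k at r' for the change of
   [Q]. *)
have -> : \sum_y Q r' y * ln (k r' y) - \sum_y Q r y * ln (k r y) =
    \sum_y Q r y * (f y - ln (k r y)) + \sum_y (Q r' y - Q r y) * f y.
  by rewrite -big_split -sumrB /=; apply: eq_bigr => y _; rewrite /f; ring.
rewrite /C2; lra.
Qed.

(** Read [k] as a supersolution of the backward equation with rates [Rh], in integrated form, and
    [Q] as a solution of the forward equation with flow [J]. The mean of ln k under [Q], minus the
    accumulated [l], satisfies [telescope_le] by [entropy_local]. *)
Lemma entropy_bound (R : realType) (S : finType) (s t b c lo L : R)
    (k : R -> S -> R) (Rh : R -> S -> S -> R) (Q : R -> S -> R)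
    (J : R -> S -> S -> R) (l : R -> R) :
  s <= t -> 0 <= b -> 0 < lo -> 0 <= L ->
  (forall r y, s <= r <= t -> lo <= k r y <= c) ->
  (forall y' y, measurable_fun setT (fun u => Rh u y' y)) ->
  (forall u y' y, 0 <= Rh u y' y <= b) ->
  (forall r r' y, s <= r -> r <= r' -> r' <= t ->
    expR (- (b * (r' - r))) * (k r' y * (1 + b * (r' - r)) +
      \sum_y' (\int[lebesgue_measure]_(u in `[r, r']) Rh u y' y) *
        (k r' y' - k r' y)) <= k r y) ->
  (forall u y, s <= u <= t -> 0 <= Q u y <= 1) ->
  (forall r u y, s <= r -> r <= u -> u <= t -> `|Q u y - Q r y| <= L * (u - r)) ->
  (forall r u y' y, s <= r -> r <= u -> u <= t ->
    `|J u y' y - J r y' y| <= L * (u - r)) ->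
  (forall u y, s <= u <= t ->
    is_derive u (1 : R) (fun v => Q v y) (\sum_y' (J u y y' - J u y' y))) ->
  (forall u f, s <= u <= t ->
    \sum_y \sum_y' (J u y' y * (f y' - f y) -
      Q u y * Rh u y' y * (expR (f y' - f y) - 1)) <= l u) ->
  lebesgue_measure.-integrable (`[s, t] : set R) (EFin \o l) ->
  \sum_y Q t y * ln (k t y) - \sum_y Q s y * ln (k s y) <=
  \int[lebesgue_measure]_(u in `[s, t]) l u.
Proof.
move=> st b0 lo0 L0 hk mRh bRh hstep hQ lipQ lipJ dQ hpt il.
have [C [h0 [C0 h00 H]]] := entropy_local R S s t b c lo L k Rh Q J l st b0 lo0 L0 hk
  mRh bRh hstep hQ lipQ lipJ dQ hpt il.
pose Psi r := \sum_y Q r y * ln (k r y) - \int[lebesgue_measure]_(u in `[s, r]) l u.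
suff : Psi t <= Psi s.
  by rewrite /Psi set_itv1 Rintegral_set1 subr0; lra.
apply: (telescope_le R Psi s t C h0 st C0 h00) => r r' sr rr' r't hs.
have := H r r' sr rr' r't hs; rewrite /Psi.
suff -> : \int[lebesgue_measure]_(u in `[r, r']) l u =
  \int[lebesgue_measure]_(u in `[s, r']) l u -
  \int[lebesgue_measure]_(u in `[s, r]) l u by lra.
have il' : lebesgue_measure.-integrable (`[s, r'] : set R) (EFin \o l).
  apply: (integrableS _ _ _ il) => //.
  by move=> v /=; rewrite !in_itv /= => /andP[v1 v2]; apply/andP; split; lra.
rewrite Rintegral_itvB// ?bnd_simp// Rintegral_itv_obnd_cbnd//.
apply: (integrableS _ _ _ il') => // v /=; rewrite !in_itv /= => /andP[v1 v2].
by apply/andP; split; lra.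
Qed.

(** * The masking semigroup *)

Lemma is_mask_inj (K : nat) (a b : 'I_K) : is_mask a -> is_mask b -> a = b.
Proof. by rewrite /is_mask => /eqP ha /eqP hb; apply: val_inj; rewrite /= ha hb. Qed.

(* The set comprehensions in [numK] and [unmask_pair] are classical sets. *)
Lemma card_classical_set (T : finType) (P : pred T) :
  #|[set i | P i]%classic| = #|[set i | P i]%SET|.
Proof.
rewrite cardsE; apply: eq_card => i; rewrite [RHS]inE.
by apply/idP/idP => [/set_mem//|Pi]; apply/mem_set.
Qed.

Lemma numKE (K d : nat) (y : state K d) : numK y = #|[set i | is_mask (y i)]%SET|.
Proof. exact: card_classical_set. Qed.

Definition upd {K d : nat} (y : state K d) (i : 'I_d) (a : 'I_K) : state K d :=
  [ffun j => if j == i then a else y j].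

Lemma unmask_pairP (K d : nat) (y y' : state K d) :
  reflect (exists i a, [/\ is_mask (y i), ~~ is_mask a & y' = upd y i a])
    (unmask_pair y y').
Proof.
rewrite /unmask_pair card_classical_set.
apply: (iffP andP) => [[/cards1P[i Ei] /forallP H]|[i [a [mi ma ->]]]].
  have yi : y i != y' i by have := set11 i; rewrite -Ei inE.
  have mi : is_mask (y i) by have := H i; rewrite yi.
  exists i, (y' i); split => //.
    by apply: contraNN yi => my'; apply/eqP; exact: is_mask_inj.
  apply/ffunP => j; rewrite ffunE; case: eqP => [->//|/eqP ji].
  apply/eqP; rewrite eq_sym; apply: contraNT ji => yj.
  have : j \in [set i0 | y i0 != y' i0]%SET by rewrite inE.
  by rewrite Ei inE.
have yia : y i != a by apply: contraNN ma => /eqP <-.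
have -> : [set i0 | y i0 != upd y i a i0]%SET = [set i]%SET.
  apply/setP => j; rewrite !inE ffunE; case: (eqVneq j i) => [->|_]; rewrite ?yia//.
  by rewrite eqxx.
rewrite cards1; split => //; apply/forallP => j; rewrite ffunE.
case: (eqVneq j i) => [->|_]; first by rewrite mi implybT.
by rewrite eqxx.
Qed.

Lemma sum_unmask (R : realType) (K d : nat) (y : state K d) (f : state K d -> R) :
  \sum_(y' | unmask_pair y y') f y' =
  \sum_(i | is_mask (y i)) \sum_(a | ~~ is_mask a) f (upd y i a).
Proof.
rewrite (pair_big (fun i => is_mask (y i)) (fun a => ~~ is_mask a)
  (fun i a => f (upd y i a))) /=.
pose A := [set p : 'I_d * 'I_K | is_mask (y p.1) && ~~ is_mask p.2]%SET.
transitivity (\sum_(p in A) f (upd y p.1 p.2)); last by apply: eq_bigl => p; rewrite inE.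
rewrite -(@big_imset _ _ _ _ _ (fun p => upd y p.1 p.2) A f).
  apply: eq_bigl => y'; apply/unmask_pairP/imsetP.
    by move=> [i [a [mi ma ->]]]; exists (i, a) => //; rewrite inE /= mi ma.
  by move=> [[i a]]; rewrite inE /= => /andP[mi ma] ->; exists i, a.
move=> [i a] [j b]; rewrite !inE /= => /andP[mi ma] /andP[mj mb] /ffunP E.
have ij : i = j.
  have := E i; rewrite !ffunE eqxx; case: eqP => // _ e.
  by move: ma; rewrite e mi.
by subst j; have := E i; rewrite !ffunE eqxx => ->.
Qed.

Lemma sum_mask (R : realType) (K d : nat) (m : 'I_K) (y : state K d)
    (g : state K d -> R) : is_mask m ->
  \sum_(y' | unmask_pair y' y) g y' = \sum_(i | ~~ is_mask (y i)) g (upd y i m).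
Proof.
move=> hm; pose A := [set i | ~~ is_mask (y i)]%SET.
transitivity (\sum_(i in A) g (upd y i m)); last by apply: eq_bigl => p; rewrite inE.
rewrite -(@big_imset _ _ _ _ _ (fun i => upd y i m) A g).
  apply: eq_bigl => y'; apply/unmask_pairP/imsetP.
    move=> [i [a [mi ma E]]]; exists i; first by rewrite inE E ffunE eqxx.
    apply/ffunP => j; rewrite E !ffunE; case: eqP => [->|//].
    exact: is_mask_inj.
  move=> [i]; rewrite inE => mi ->; exists i, (y i); split => //.
    by rewrite ffunE eqxx.
  by apply/ffunP => j; rewrite !ffunE; case: eqP => [->|].
move=> i j; rewrite !inE => mi mj /ffunP E.
have := E i; rewrite !ffunE eqxx; case: eqP => // _ e.
by move: mi; rewrite -e hm.
Qed.

Lemma unmask_pair_neq (K d : nat) (y y' : state K d) : unmask_pair y y' -> y != y'.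
Proof.
move=> /unmask_pairP[i [a [mi ma ->]]]; apply: contraNN ma => /eqP /ffunP /(_ i).
by rewrite ffunE eqxx => <-.
Qed.

Lemma Rfwd_neq (R : realType) (K d : nat) (y y' : state K d) : y' != y ->
  Rfwd R y y' = (unmask_pair y y')%:R.
Proof. by rewrite /Rfwd eq_sym => /negbTE ->; case: ifP. Qed.

Lemma sum_Rfwd (R : realType) (K d : nat) (y : state K d) (f : state K d -> R) :
  \sum_y' Rfwd R y y' * f y' =
  \sum_(y' | unmask_pair y y') f y' - (d - numK y)%:R * f y.
Proof.
rewrite (bigD1 y)//= addrC [X in _ + X * _]/Rfwd eqxx mulNr; congr (_ - _).
rewrite [RHS]big_mkcond [RHS](bigD1 y)//= ifF; last first.
  by apply/negP => /unmask_pair_neq; rewrite eqxx.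
rewrite add0r; apply: eq_bigr => y' yy'; rewrite Rfwd_neq//.
by case: ifP => _; rewrite ?mul1r ?mul0r.
Qed.

Lemma card_unmasked (K d : nat) (y : state K d) :
  #|[pred i | ~~ is_mask (y i)]| = (d - numK y)%N.
Proof.
have := cardC [pred i | is_mask (y i)]; rewrite card_ord numKE cardsE => E.
by rewrite -[X in (X - _)%N]E addKn; exact: eq_card.
Qed.

Lemma numK_upd (K d : nat) (y : state K d) i a :
  is_mask (y i) -> ~~ is_mask a -> (numK (upd y i a) < numK y)%N.
Proof.
move=> mi ma; rewrite !numKE; apply: proper_card; apply/properP; split.
  apply/fintype.subsetP => j; rewrite !inE ffunE; case: eqP => [->|//].
  by move=> h; move: ma; rewrite h.
by exists i; rewrite inE// ffunE eqxx.
Qed.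

(* Transition probability from [a] to [b] of one coordinate in time [t]. *)
Definition kap {R : realType} {K : nat} (t : R) (a b : 'I_K) : R :=
  if is_mask a then (is_mask b)%:R
  else if b == a then expR (- t) else if is_mask b then 1 - expR (- t) else 0.

Definition dkap {R : realType} {K : nat} (t : R) (a b : 'I_K) : R :=
  if is_mask a then 0
  else if b == a then - expR (- t) else if is_mask b then expR (- t) else 0.

Lemma is_derive_expN (R : realType) (t : R) :
  is_derive t (1 : R) (fun s => expR (- s)) (- expR (- t)).
Proof.
have H : is_derive t (1 : R) (fun s : R => - s) (-1).
  by have := is_deriveN (is_derive_id t (1 : R)).
have := is_derive1_comp (is_derive_expR (- t)) H.
by rewrite mulrN1 => h; apply: is_derive_eq h _.
Qed.

Lemma is_derive_kap (R : realType) (K : nat) (t : R) (a b : 'I_K) :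
  is_derive t (1 : R) (fun s => kap s a b) (dkap t a b).
Proof.
rewrite /kap /dkap; case: ifP => _; first exact: is_derive_cst.
case: ifP => _; first exact: is_derive_expN.
case: ifP => _; last exact: is_derive_cst.
have := is_deriveB (is_derive_cst (1 : R) t (1 : R)) (is_derive_expN R t).
by rewrite opprK add0r.
Qed.

Lemma kap_bounds (R : realType) (K : nat) (t : R) (a b : 'I_K) :
  0 <= t -> 0 <= kap t a b <= 1.
Proof.
move=> t0; have e0 := expR_ge0 (- t).
have e1 : expR (- t) <= 1 by rewrite -expR0 ler_expR; lra.
rewrite /kap; case: ifP => _; first by rewrite ler0n lern1 leq_b1.
case: ifP => _; first by rewrite e0.
by case: ifP => _; [apply/andP; split; lra|rewrite lexx ler01].
Qed.

Lemma sum_kap_unmasked (R : realType) (K : nat) (t : R) (a : 'I_K) :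
  \sum_(b | ~~ is_mask b) kap t a b = (~~ is_mask a)%:R * expR (- t).
Proof.
case: (boolP (is_mask a)) => ma /=.
  rewrite mul0r big1// => b mb; rewrite /kap ma (negbTE mb).
  by [].
rewrite mul1r (bigD1 a)//= big1 ?addr0; first by rewrite /kap (negbTE ma) eqxx.
by move=> b /andP[mb ba]; rewrite /kap (negbTE ma) (negbTE ba) (negbTE mb).
Qed.

Lemma sum_kap (R : realType) (K : nat) (t : R) (m a : 'I_K) : is_mask m ->
  \sum_b kap t a b = 1.
Proof.
move=> hm; rewrite (bigID (@is_mask K)) /= sum_kap_unmasked.
rewrite (big_pred1 m); last first.
  move=> b; apply/idP/eqP => [mb|->//]; exact: is_mask_inj.
rewrite /kap; case: (boolP (is_mask a)) => ma; first by rewrite hm mul0r addr0.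
rewrite ifN; first by rewrite hm mul1r subrK.
by apply: contraNN ma => /eqP <-.
Qed.

(** Backward equation of one coordinate: an unmasked symbol first jumps to the mask, at rate 1. *)
Lemma dkap_bwd (R : realType) (K : nat) (t : R) (m a b : 'I_K) : is_mask m ->
  dkap t a b = (~~ is_mask a)%:R * (kap t m b - kap t a b).
Proof.
move=> hm; rewrite /dkap /kap hm; case: (boolP (is_mask a)) => ma /=.
  by rewrite mul0r.
rewrite mul1r; case: eqP => [->|_]; first by rewrite (negbTE ma) sub0r.
by case: ifP => _ /=; [ring|rewrite subrr].
Qed.

(** Forward equation of one coordinate: the mask collects, at rate 1, the mass of every unmasked
    symbol. *)
Lemma dkap_fwd (R : realType) (K : nat) (t : R) (a b : 'I_K) :
  dkap t a b = if is_mask b then \sum_(b' | ~~ is_mask b') kap t a b' else - kap t a b.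
Proof.
rewrite sum_kap_unmasked /dkap /kap; case: (boolP (is_mask a)) => ma /=.
  by case: (is_mask b); rewrite ?mul0r ?oppr0.
case: eqP => [->|_]; first by rewrite (negbTE ma).
by case: ifP => _; rewrite ?mul1r ?oppr0.
Qed.

(** Transition probability from [x] to [y] in time [t]; a product because coordinates are masked
    independently. *)
Definition Ptr {R : realType} {K d : nat} (t : R) (x y : state K d) : R :=
  \prod_i kap t (x i) (y i).

Definition Prest {R : realType} {K d : nat} (t : R) (x y : state K d) (i : 'I_d) : R :=
  \prod_(j | j != i) kap t (x j) (y j).

Lemma PtrD1 (R : realType) (K d : nat) (t : R) (x y : state K d) i :
  Ptr t x y = kap t (x i) (y i) * Prest t x y i.
Proof. by rewrite /Ptr (bigD1 i). Qed.

Lemma Ptr_updl (R : realType) (K d : nat) (t : R) (x y : state K d) i a :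
  Ptr t (upd x i a) y = kap t a (y i) * Prest t x y i.
Proof.
rewrite (PtrD1 _ _ _ _ _ _ i) ffunE eqxx; congr (_ * _).
by apply: eq_bigr => j ji; rewrite ffunE (negbTE ji).
Qed.

Lemma Ptr_updr (R : realType) (K d : nat) (t : R) (x y : state K d) i a :
  Ptr t x (upd y i a) = kap t (x i) a * Prest t x y i.
Proof.
rewrite (PtrD1 _ _ _ _ _ _ i) ffunE eqxx; congr (_ * _).
by apply: eq_bigr => j ji; rewrite ffunE (negbTE ji).
Qed.

Lemma is_derive_prodr (R : realType) (I : eqType) (r : seq I) (F : I -> R -> R)
    (dF : I -> R) (x : R) : uniq r ->
  (forall i, is_derive x (1 : R) (F i) (dF i)) ->
  is_derive x (1 : R) (fun v => \prod_(i <- r) F i v)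
    (\sum_(i <- r) dF i * \prod_(j <- r | j != i) F j x).
Proof.
move=> ur H; elim: r ur => [|i r IH] ur.
  rewrite big_nil (_ : (fun _ => _) = cst 1); first exact: is_derive_cst.
  by apply/funext => v; rewrite big_nil.
rewrite big_cons (_ : (fun _ => _) = F i * (fun v => \prod_(i <- r) F i v)); last first.
  by apply/funext => v; rewrite big_cons.
move: ur => /= /andP[ir ur].
apply: (is_derive_eq (is_deriveM (H i) (IH ur))).
rewrite addrC big_cons eqxx; congr (_ + _).
  rewrite [LHS]mulrC; congr (_ * _); rewrite big_seq [RHS]big_seq_cond.
  apply: eq_bigl => j; case: (boolP (j \in r)) => //= jr.
  by apply/esym; apply: contraNN ir => /eqP <-.
rewrite /GRing.scale /= mulr_sumr [LHS]big_seq [RHS]big_seq; apply: eq_bigr => j jr.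
rewrite big_cons ifT; first by ring.
by apply: contraNN ir => /eqP ->.
Qed.

Lemma is_derive_Ptr (R : realType) (K d : nat) (t : R) (x y : state K d) :
  is_derive t (1 : R) (fun s => Ptr s x y)
    (\sum_i dkap t (x i) (y i) * Prest t x y i).
Proof.
by apply: is_derive_prodr => [|i]; [exact: index_enum_uniq|exact: is_derive_kap].
Qed.

Lemma is_derive_Ptr_bwd (R : realType) (K d : nat) (m : 'I_K) (t : R) (x y : state K d) :
  is_mask m ->
  is_derive t (1 : R) (fun s => Ptr s x y)
    (\sum_(x' | unmask_pair x' x) Ptr t x' y - (d - numK x)%:R * Ptr t x y).
Proof.
move=> hm; apply: (is_derive_eq (is_derive_Ptr R K d t x y)).
rewrite (sum_mask R K d m)// -card_unmasked.
rewrite (_ : #|_|%:R * _ = \sum_(i | ~~ is_mask (x i)) Ptr t x y); last first.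
  by rewrite mulr_natl -sumr_const; apply: eq_bigl => i; rewrite inE.
rewrite -sumrB [RHS]big_mkcond; apply: eq_bigr => i _.
rewrite (dkap_bwd R K t m)// Ptr_updl (PtrD1 _ _ _ _ _ _ i).
by case: ifP => _; rewrite ?mul0r// mul1r mulrBl.
Qed.

Lemma is_derive_Ptr_fwd (R : realType) (K d : nat) (t : R) (x y : state K d) :
  is_derive t (1 : R) (fun s => Ptr s x y) (\sum_y' Rfwd R y y' * Ptr t x y').
Proof.
apply: (is_derive_eq (is_derive_Ptr R K d t x y)).
rewrite sum_Rfwd sum_unmask -card_unmasked.
rewrite (_ : #|_|%:R * _ = \sum_(i | ~~ is_mask (y i)) Ptr t x y); last first.
  by rewrite mulr_natl -sumr_const; apply: eq_bigl => i; rewrite inE.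
rewrite -sumrN [X in _ = X + _]big_mkcond [X in _ = _ + X]big_mkcond -big_split /=.
apply: eq_bigr => i _; rewrite dkap_fwd; case: ifP => mi /=.
  rewrite addr0 mulr_suml; apply: eq_bigr => a _; exact/esym/Ptr_updr.
by rewrite add0r mulNr -PtrD1.
Qed.

Lemma Ptr_bounds (R : realType) (K d : nat) (t : R) (x y : state K d) :
  0 <= t -> 0 <= Ptr t x y <= 1.
Proof.
move=> t0; apply/andP; split.
  by apply: prodr_ge0 => i _; have /andP[] := kap_bounds R K t (x i) (y i) t0.
by apply: prodr_ile1 => i _; exact: kap_bounds.
Qed.

Lemma sum_Ptr (R : realType) (K d : nat) (m : 'I_K) (t : R) (x : state K d) :
  is_mask m -> \sum_y Ptr t x y = 1.
Proof.
move=> hm; rewrite /Ptr -(bigA_distr_bigA (fun i b => kap t (x i) b)).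
by rewrite big1// => i _; rewrite (sum_kap _ _ _ m).
Qed.

Lemma Ptr0 (R : realType) (K d : nat) (x y : state K d) : Ptr (0 : R) x y = (x == y)%:R.
Proof.
have k0 (a b : 'I_K) : kap (0 : R) a b = (a == b)%:R.
  rewrite /kap oppr0 expR0 subrr; case: (boolP (is_mask a)) => ma.
    congr ((nat_of_bool _)%:R); apply/idP/eqP => [mb|<-//]; exact: is_mask_inj.
  by rewrite eq_sym; case: eqP => // _; case: ifP.
case: (eqVneq x y) => [->|].
  by rewrite /Ptr big1// => i _; rewrite k0 eqxx.
move=> xy; apply/eqP; rewrite /Ptr; apply/prodf_eq0 => /=.
suff [i xi] : exists i, x i != y i by exists i => //; rewrite k0 (negbTE xi).
apply/existsP; rewrite -negb_forall; apply: contraNN xy => /forallP H.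
by apply/eqP/ffunP => i; apply/eqP.
Qed.

(** The mask is absorbing in each coordinate. Read backwards in time, a reverse path starting at [y]
    never has more masks than [y], which controls the true rates throughout a window. *)
Lemma Ptr_neq0_numK (R : realType) (K d : nat) (t : R) (x y : state K d) :
  Ptr t x y != 0 -> (numK x <= numK y)%N.
Proof.
move=> /prodf_neq0 H; rewrite !numKE; apply: subset_leq_card; apply/fintype.subsetP => i.
rewrite !inE => mi; have := H i isT; rewrite /kap mi.
by case: is_mask => //; rewrite eqxx.
Qed.

Lemma lipschitz_derive (R : realType) (f df : R -> R) (B a b : R) :
  a <= b -> (forall x, is_derive x (1 : R) f (df x)) ->
  (forall x, a <= x <= b -> `|df x| <= B) -> `|f b - f a| <= B * (b - a).
Proof.
move=> ab df1 dB; have [|xi] := @MVT_segment R f df a b ab (fun v _ => df1 v).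
  by apply: derivable_within_continuous => v _; have [] := df1 v.
rewrite in_itv /= => /dB h ->; rewrite normrM (ger0_norm (_ : 0 <= b - a)) ?subr_ge0//.
by rewrite ler_wpM2r// subr_ge0.
Qed.

(** Each coordinate contributes at most 1 to the derivative, since all factors lie in [0, 1]. *)
Lemma Ptr_lip (R : realType) (K d : nat) (x y : state K d) (r u : R) :
  0 <= r -> r <= u -> `|Ptr u x y - Ptr r x y| <= d%:R * (u - r).
Proof.
move=> r0 ru; apply: (lipschitz_derive R (fun s => Ptr s x y)
  (fun t => \sum_i dkap t (x i) (y i) * Prest t x y i)) => //.
  by move=> t; exact: is_derive_Ptr.
move=> t /andP[rt _]; have t0 : 0 <= t by exact: le_trans rt.
rewrite (le_trans (ler_norm_sum _ _ _))//.
rewrite -[X in X%:R]card_ord -[leRHS]mulr1; apply: sum_le_card => i.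
have e0 := expR_ge0 (- t); have e1 : expR (- t) <= 1 by rewrite -expR0 ler_expR; lra.
have P0 : 0 <= Prest t x y i.
  by apply: prodr_ge0 => j _; have /andP[] := kap_bounds R K t (x j) (y j) t0.
have P1 : Prest t x y i <= 1 by apply: prodr_ile1 => j _; exact: kap_bounds.
have D1 : `|dkap t (x i) (y i)| <= 1.
  rewrite /dkap; case: ifP => _; first by rewrite normr0.
  case: ifP => _; first by rewrite normrN ger0_norm.
  by case: ifP => _; rewrite ?normr0// ger0_norm.
rewrite normrM (ger0_norm P0) -[leRHS]mulr1; exact: ler_pM.
Qed.

(** Uniqueness for the forward equation. The system is triangular: mass enters [y] only from states
    with fewer masks. By induction on [numK], the difference of two solutions obeys a scalar
    equation F' = - m F with F(0) = 0. *)
Lemma forward_marginal (R : realType) (K d : nat) (qstar : state K d -> R)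
    (q : R -> state K d -> R) :
  q 0 = qstar ->
  (forall (t : R) (y : state K d), is_derive t (1 : R) (fun s => q s y)
      (\sum_(y' : state K d) Rfwd R y y' * q t y')) ->
  forall t y, q t y = \sum_x Ptr t x y * qstar x.
Proof.
move=> q0 qode t y; pose F s y := q s y - \sum_x Ptr s x y * qstar x.
have dF s z : is_derive s (1 : R) (F ^~ z) (\sum_z' Rfwd R z z' * F s z').
  have H : is_derive s (1 : R) (fun v => \sum_x Ptr v x z * qstar x)
      (\sum_x (\sum_z' Rfwd R z z' * Ptr s x z') * qstar x).
    apply: is_derive_sumr => x; apply: is_derive_scaler.
    exact: is_derive_Ptr_fwd.
  apply: (is_derive_eq (is_deriveB (qode s z) H)).
  under [X in _ - X]eq_bigr do rewrite mulr_suml.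
  rewrite exchange_big /= -sumrB; apply: eq_bigr => z' _.
  by rewrite mulrBr mulr_sumr; congr (_ - _); apply: eq_bigr => x _; rewrite mulrA.
have F0 z : F 0 z = 0.
  rewrite /F q0 (bigD1 z)//= Ptr0 eqxx mul1r big1 ?addr0 ?subrr// => x xz.
  by rewrite Ptr0 (negbTE xz) mul0r.
suff FE : forall n z, (numK z < n)%N -> forall s, F s z = 0.
  by apply/eqP; rewrite -subr_eq0; apply/eqP; apply: (FE (numK y).+1).
elim=> // n IH z; rewrite ltnS => zn s.
pose m : R := (d - numK z)%:R.
have dz v : is_derive v (1 : R) (F ^~ z) (- (m * F v z)).
  apply: (is_derive_eq (dF v z)); rewrite sum_Rfwd sum_unmask big1 ?sub0r// => i mi.
  rewrite big1// => a ma; apply: IH; apply: leq_trans zn.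
  exact: numK_upd.
have de v : is_derive v (1 : R) (fun w => expR (m * w)) (expR (m * v) * m).
  have H : is_derive v (1 : R) (fun w : R => m * w) m.
    have := is_deriveZ m (is_derive_id v (1 : R)).
    by rewrite /GRing.scale /= mulr1.
  exact: (is_derive1_comp (is_derive_expR (m * v)) H).
(* Integrating factor: exp (m v) F(v) is constant. *)
have dg v : is_derive v (1 : R) ((fun w => expR (m * w)) * (F ^~ z)) 0.
  apply: (is_derive_eq (is_deriveM (de v) (dz v))).
  by rewrite /GRing.scale /=; ring.
have := is_derive_0_is_cst s 0 dg.
rewrite /GRing.mul /= F0 mulr0 => /eqP; rewrite mulf_eq0 => /orP[|/eqP//].
by rewrite gt_eqF// expR_gt0.
Qed.

Lemma bernoulli_ineq (R : realType) (x : R) n : 0 <= x <= 1 ->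
  1 - n%:R * x <= (1 - x) ^+ n.
Proof.
move=> /andP[x0 x1]; elim: n => [|n IH]; first by rewrite mul0r subr0 expr0.
rewrite exprS; have h : 0 <= 1 - x by lra.
apply: le_trans (ler_wpM2l h IH); rewrite -natr1.
have := ler0n R n; nra.
Qed.

(** * Positivity, total reverse rate and endpoint estimates of the forward marginals *)

Section MaskedMarginals.
Context {R : realType} {K d : nat} (m : 'I_K) (hm : is_mask m).
Context (qstar : state K d -> R) (q : R -> state K d -> R).
Hypothesis hq0 : forall y, 0 <= qstar y.
Hypothesis hq1 : \sum_(y : state K d) qstar y = 1.
Hypothesis hqE : forall t y, q t y = \sum_x Ptr t x y * qstar x.
Hypothesis hA2 : forall y, 0 < qstar y <-> numK y = 0%N.

Lemma marginal_bounds t y : 0 <= t -> 0 <= q t y <= 1.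
Proof.
move=> t0; rewrite hqE; apply/andP; split.
  apply: sumr_ge0 => x _; rewrite mulr_ge0//.
  by have /andP[] := Ptr_bounds R K d t x y t0.
rewrite -hq1; apply: ler_sum => x _; rewrite ler_piMl//.
by have /andP[] := Ptr_bounds R K d t x y t0.
Qed.

Lemma sum_marginal t : \sum_y q t y = 1.
Proof.
under eq_bigr do rewrite hqE.
rewrite exchange_big /= -hq1; apply: eq_bigr => x _.
by rewrite -mulr_suml (sum_Ptr _ _ _ m)// mul1r.
Qed.

Lemma marginal_lip y (r u : R) : 0 <= r -> r <= u ->
  `|q u y - q r y| <= d%:R * (u - r).
Proof.
move=> r0 ru; rewrite !hqE -sumrB (le_trans (ler_norm_sum _ _ _))//.
rewrite -[leRHS]mulr1 -[X in _ <= _ * X]hq1 mulr_sumr; apply: ler_sum => x _.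
rewrite -mulrBl normrM (ger0_norm (hq0 x)) ler_wpM2r//.
exact: Ptr_lip.
Qed.

Lemma qstar_neq0_unmasked x i : qstar x != 0 -> is_mask (x i) = false.
Proof.
move=> x0; have : numK x = 0%N by apply/hA2; rewrite lt_neqAle eq_sym x0 hq0.
rewrite numKE => /eqP; rewrite cards_eq0 => /eqP /setP /(_ i).
by rewrite !inE.
Qed.

Lemma marginal_gt0 (z : 'I_K) t y : ~~ is_mask z -> 0 < t -> 0 < q t y.
Proof.
(* Filling the masks of [y] with [z] gives a state charged by [qstar] from which [y] is reached by
   masking alone. *)
move=> mz t0; pose x : state K d := [ffun i => if is_mask (y i) then z else y i].
have mx i : ~~ is_mask (x i) by rewrite ffunE; case: ifPn.
have x0 : numK x = 0%N.
  by rewrite numKE; apply/eqP; rewrite cards_eq0; apply/eqP/setP => i;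
     rewrite !inE; apply/negbTE.
have qx : 0 < qstar x by apply/hA2.
rewrite hqE (bigD1 x)//= ltr_pwDl//; last first.
  apply: sumr_ge0 => x' _; rewrite mulr_ge0//.
  by have /andP[] := Ptr_bounds R K d t x' y (ltW t0).
rewrite mulr_gt0//; apply: prodr_gt0 => i _.
rewrite /kap (negbTE (mx i)); case: eqP => [_|/eqP yx]; first exact: expR_gt0.
case: ifPn => my; first by rewrite subr_gt0 -expR0 ltr_expR; lra.
by move: yx; rewrite ffunE (negbTE my) eqxx.
Qed.

(** Up to the factor [q t y], this is the total true reverse rate out of [y]. From data without
    masks, a coordinate is still unmasked with probability e^(-t) and masked with probability 1 -
    e^(-t); each masked coordinate contributes their ratio 1 / (e^t - 1). *)
Lemma sum_marginal_unmask t y : 0 < t ->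
  \sum_(y' | unmask_pair y y') q t y' = (numK y)%:R / (expR t - 1) * q t y.
Proof.
move=> t0; under eq_bigr do rewrite hqE.
rewrite exchange_big /= hqE mulr_sumr; apply: eq_bigr => x _.
case: (eqVneq (qstar x) 0) => [->|x0].
  by rewrite !mulr0 big1// => y' _; rewrite mulr0.
rewrite -mulr_suml mulrA; congr (_ * _).
have e1 : 0 < expR t - 1 by rewrite subr_gt0 -expR0 ltr_expR.
rewrite sum_unmask -[RHS]mulrA numKE cardsE.
have -> : #|[pred i | is_mask (y i)]|%:R * ((expR t - 1)^-1 * Ptr t x y) =
    \sum_(i | is_mask (y i)) (expR t - 1)^-1 * Ptr t x y.
  by rewrite mulr_natl -sumr_const; apply: eq_bigl => i; rewrite inE.
apply: eq_bigr => i mi.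
under eq_bigr do rewrite Ptr_updr.
rewrite -mulr_suml sum_kap_unmasked (PtrD1 _ _ _ _ _ _ i) mulrA; congr (_ * _).
have mx := qstar_neq0_unmasked x i x0.
rewrite /kap mx /= mul1r ifF; last by apply/negP => /eqP e; move: mi; rewrite e mx.
by rewrite mi expRN; field; rewrite !gt_eqF// expR_gt0.
Qed.

(** Nothing has been masked by time t with probability e^(-d t) >= 1 - d t. *)
Lemma marginal_small t y : 0 <= t -> qstar y * (1 - d%:R * t) <= q t y.
Proof.
move=> t0; case: (eqVneq (qstar y) 0) => [->|y0].
  by rewrite mul0r; have /andP[] := marginal_bounds t y t0.
rewrite hqE (bigD1 y)//= ler_wpDr//.
  apply: sumr_ge0 => x' _; rewrite mulr_ge0//.
  by have /andP[] := Ptr_bounds R K d t x' y t0.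
rewrite mulrC ler_wpM2r//.
have -> : Ptr t y y = expR (- (d%:R * t)).
  rewrite /Ptr (eq_bigr (fun=> expR (- t))); last first.
    by move=> i _; rewrite /kap qstar_neq0_unmasked// eqxx.
  by rewrite prodr_const card_ord -expRM_natl mulrN.
by have := expR_ge1Dx (- (d%:R * t)); lra.
Qed.

(** From data without masks, everything is masked by time t with probability (1 - e^(-t))^d;
    conclude by Bernoulli's inequality. *)
Lemma marginal_mask t (y : state K d) : 0 <= t -> [forall i, is_mask (y i)] ->
  1 - d%:R * expR (- t) <= q t y.
Proof.
move=> t0 /forallP my; rewrite hqE -[leLHS]mulr1 -[X in _ * X <= _]hq1 mulr_sumr.
apply: ler_sum => x _; case: (eqVneq (qstar x) 0) => [->|x0]; first by rewrite !mulr0.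
rewrite ler_wpM2r//.
have -> : Ptr t x y = (1 - expR (- t)) ^+ d.
  rewrite /Ptr (eq_bigr (fun=> 1 - expR (- t))); first by rewrite prodr_const card_ord.
  move=> i _; have mx := qstar_neq0_unmasked x i x0.
  rewrite /kap mx ifF ?my//; apply/negP => /eqP e.
  by have := my i; rewrite e mx.
apply: bernoulli_ineq; rewrite expR_ge0 /= -expR0 ler_expR; lra.
Qed.

End MaskedMarginals.

(** * Truncated rates *)

Lemma Dphi_ge0 (R : realType) (u w : R) : 0 < u -> 0 < w -> 0 <= Dphi u w.
Proof.
move=> u0 w0; rewrite /Dphi.
have h : -1 < w / u - 1 by rewrite ltrBrDl addrN divr_gt0.
have := le_ln1Dx h; rewrite addrC subrK -[u / w]invf_div lnV ?posrE ?divr_gt0//.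
move=> h1; have : u * (1 - w / u) <= u * - ln (w / u) by rewrite ler_pM2l//; lra.
by rewrite mulrBr mulr1 [u * (w / u)]mulrC divfK ?gt_eqF//; lra.
Qed.

(** This is [0 <= Dphi v (w * expR x)] with the logarithm expanded, the Fenchel inequality behind
    the entropy estimate. *)
Lemma entropy_dual (R : realType) (v w x : R) : 0 < v -> 0 < w ->
  v * x - w * (expR x - 1) <= v * ln (v / w) - v + w.
Proof.
move=> v0 w0; have := Dphi_ge0 R v (w * expR x) v0.
rewrite mulr_gt0 ?expR_gt0// => /(_ isT); rewrite /Dphi.
have -> : v / (w * expR x) = v / w * expR (- x).
  by rewrite expRN invfM mulrA.
by rewrite lnM ?posrE ?divr_gt0 ?expR_gt0// expRK; lra.
Qed.

(* Truncating the estimated rates at a level [b] above the true total rate does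
   not increase the score entropy. *)
Lemma truncated_entropy (R : realType) (I : finType) (A : pred I) (v w x : I -> R)
    (b : R) :
  (forall i, A i -> 0 < v i) -> (forall i, A i -> 0 < w i) ->
  \sum_(i | A i) v i <= b ->
  \sum_(i | A i) (v i * x i -
     w i * Num.min 1 (b / \sum_(i | A i) w i) * (expR (x i) - 1)) <=
  \sum_(i | A i) Dphi (v i) (w i).
Proof.
move=> v0 w0 vb; set W := \sum_(i | A i) w i; set c := Num.min 1 _.
set V := \sum_(i | A i) v i in vb *.
case: (pickP A) => [i0 Ai0|A0]; last by rewrite !big_pred0.
have W0 : 0 < W.
  rewrite /W (bigD1 i0)//= ltr_pwDl ?w0// sumr_ge0// => i /andP[Ai _].
  exact/ltW/w0.
have V0 : 0 < V.
  rewrite /V (bigD1 i0)//= ltr_pwDl ?v0// sumr_ge0// => i /andP[Ai _].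
  exact/ltW/v0.
have b0 : 0 < b by exact: lt_le_trans vb.
have c0 : 0 < c by rewrite lt_min ltr01 divr_gt0.
(* Replacing each [w i] by [w i * c] changes the sum of [Dphi] by the left side. If c = b / W < 1,
   then V <= b bounds it by b ln (W / b) + b - W, which is nonpositive by ln r <= r - 1. *)
have key : - ln c * V + (c - 1) * W <= 0.
  rewrite /c; case: (leP 1 (b / W)) => h.
    by rewrite ln1 oppr0 mul0r add0r subrr mul0r.
  have bW0 : 0 < b / W by rewrite divr_gt0.
  have h1 : ln (b / W) < 0 by rewrite ln_lt0// bW0 h.
  have h2 : -1 < W / b - 1 by rewrite ltrBrDl addrN divr_gt0.
  have := le_ln1Dx h2; rewrite addrC subrK -[W / b]invf_div lnV ?posrE// => h3.
  have h4 : - ln (b / W) * V <= - ln (b / W) * b by rewrite ler_pM2l// oppr_gt0.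
  have h5 : - ln (b / W) * b <= ((b / W)^-1 - 1) * b by rewrite ler_pM2r.
  have e1 : ((b / W)^-1 - 1) * b = W - b by field; rewrite !gt_eqF.
  have e2 : (b / W - 1) * W = b - W by field; rewrite gt_eqF.
  lra.
have : \sum_(i | A i) (v i * x i - w i * c * (expR (x i) - 1)) <=
    \sum_(i | A i) (Dphi (v i) (w i) + (- ln c * v i + (c - 1) * w i)).
  apply: ler_sum => i Ai; have vi := v0 i Ai; have wi := w0 i Ai.
  have wc : 0 < w i * c by rewrite mulr_gt0.
  have := entropy_dual R (v i) (w i * c) (x i) vi wc.
  rewrite invfM mulrA lnM ?posrE ?divr_gt0 ?invr_gt0// lnV ?posrE// /Dphi; lra.
move=> /le_trans; apply.
have -> : \sum_(i | A i) (Dphi (v i) (w i) + (- ln c * v i + (c - 1) * w i)) =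
    \sum_(i | A i) Dphi (v i) (w i) + (- ln c * V + (c - 1) * W).
  by rewrite !big_split /= /V /W !mulr_sumr.
by rewrite gerDl.
Qed.

(** Write 1 / x as x |x|^(-2), the power being expressed through exp and ln; at 0 the factor x gives
    the conventional value 0. *)
Lemma measurable_invr (R : realType) : measurable_fun setT (fun x : R => x^-1).
Proof.
have -> : (fun x : R => x^-1) = (fun x => x * expR (- (2 * ln `|x|))).
  apply/funext => x; case: (eqVneq x 0) => [->|x0]; first by rewrite invr0 mul0r.
  have a0 : 0 < `|x| by rewrite normr_gt0.
  rewrite mulr_natl mulr2n expRN expRD !lnK ?posrE//.
  by rewrite -expr2 real_normK ?num_real//; field.
apply: measurable_funM => //; apply: measurableT_comp => //.
apply: measurableT_comp => //; apply: measurable_funM => //.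
by apply: measurableT_comp => //; exact: measurable_normr.
Qed.

Lemma measurable_divr (R : realType) (f g : R -> R) :
  measurable_fun setT f -> measurable_fun setT g ->
  measurable_fun setT (fun x => f x / g x).
Proof.
move=> mf mg; apply: measurable_funM => //.
exact: (measurableT_comp (measurable_invr R) mg).
Qed.

Lemma measurable_is_derive (R : realType) (f df : R -> R) :
  (forall x, is_derive x (1 : R) f (df x)) -> measurable_fun setT f.
Proof.
move=> H; apply: continuous_measurable_fun => x.
apply: differentiable_continuous; apply/derivable1_diffP.
by have [] := H x.
Qed.

(** * The thinning kernel and its truncated rates *)

Section StepKernel.
Context {R : realType} {K d : nat}.
Context (vt : R -> state K d -> state K d -> R).
Hypothesis vt_gt0 : forall t y y', unmask_pair y y' -> 0 < vt t y y'.
Hypothesis vt_meas : forall y y', measurable_fun setT (fun t => vt t y y').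
Context (b : R).
Hypothesis b0 : 0 <= b.

Lemma Rest_ge0 u (y' y : state K d) : y' != y -> 0 <= Rest vt u y' y.
Proof.
move=> yy'; rewrite /Rest Rfwd_neq//; case: (boolP (unmask_pair y y')) => h.
  by rewrite mul1r ltW// vt_gt0.
by rewrite mul0r.
Qed.

Lemma Rest_tot_ge0 u (y : state K d) : 0 <= Rest_tot vt u y.
Proof. by apply: sumr_ge0 => y' yy'; exact: Rest_ge0. Qed.

(** [Rhat] with its diagonal set to 0: there [Rfwd] is the negative holding rate, not a jump rate.
    Sums can then range over all states. *)
Definition Rtrunc u (y' y : state K d) : R :=
  if y' == y then 0 else Rhat vt b u y' y.

Lemma Rtrunc_ge0 u y' y : 0 <= Rtrunc u y' y.
Proof.
rewrite /Rtrunc; case: ifPn => // yy'; rewrite /Rhat mulr_ge0 ?Rest_ge0//.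
by rewrite le_min ler01 divr_ge0// Rest_tot_ge0.
Qed.

Lemma sum_Rhat u z : \sum_(x | x != z) Rhat vt b u x z = \sum_x Rtrunc u x z.
Proof.
rewrite [RHS](bigD1 z)//= {1}/Rtrunc eqxx add0r; apply: eq_bigr => x xz.
by rewrite /Rtrunc (negbTE xz).
Qed.

Lemma sum_Rtrunc_le u z : \sum_x Rtrunc u x z <= b.
Proof.
rewrite -sum_Rhat /Rhat -mulr_suml -/(Rest_tot vt u z).
have := Rest_tot_ge0 u z; rewrite le_eqVlt => /orP[/eqP <-|W0].
  by rewrite mul0r.
rewrite (@le_trans _ _ (Rest_tot vt u z * (b / Rest_tot vt u z)))//.
  by rewrite ler_wpM2l ?(ltW W0)// ge_min lexx orbT.
by rewrite mulrC divfK// gt_eqF.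
Qed.

Lemma Rtrunc_le u y' y : Rtrunc u y' y <= b.
Proof.
apply: le_trans (sum_Rtrunc_le u y); rewrite (bigD1 y')//= lerDl.
by apply: sumr_ge0 => x _; exact: Rtrunc_ge0.
Qed.

Lemma step_kernelE u z z' : z' != z -> step_kernel vt b u z z' = Rtrunc u z' z / b.
Proof. by move=> zz'; rewrite /step_kernel zz' /Rtrunc (negbTE zz'). Qed.

Lemma step_kernel_diag u z :
  step_kernel vt b u z z = 1 - (\sum_x Rtrunc u x z) / b.
Proof. by rewrite /step_kernel eqxx /= -mulr_suml sum_Rhat. Qed.

Lemma step_kernel_ge0 u z z' : 0 <= step_kernel vt b u z z'.
Proof.
case: (eqVneq z' z) => [->|zz']; last first.
  by rewrite step_kernelE// divr_ge0// Rtrunc_ge0.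
rewrite step_kernel_diag subr_ge0; move: b0; rewrite le_eqVlt => /orP[/eqP <-|b1].
  by rewrite invr0 mulr0.
by rewrite ler_pdivrMr// mul1r sum_Rtrunc_le.
Qed.

Lemma sum_step_kernel u z : \sum_z' step_kernel vt b u z z' = 1.
Proof.
rewrite (bigD1 z)//= {1}/step_kernel eqxx /=.
rewrite [X in _ + X](eq_bigr (fun x => Rhat vt b u x z / b)) ?subrK//.
by move=> x xz; rewrite /step_kernel xz.
Qed.

(** The identity survives b = 0, when the clock never rings: the left side is 0 and [Rtrunc] is
    squeezed between 0 and b. *)
Lemma Rtrunc_kernel u z z' : z' != z -> b * step_kernel vt b u z z' = Rtrunc u z' z.
Proof.
move=> zz'; rewrite step_kernelE//; case: (eqVneq b 0) => [e|b1]; last first.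
  by rewrite mulrC divfK.
rewrite {1}e mul0r; apply/eqP; rewrite eq_le Rtrunc_ge0 /=.
by rewrite -e; exact: Rtrunc_le.
Qed.

Lemma measurable_Rtrunc y' y : measurable_fun setT (fun u => Rtrunc u y' y).
Proof.
rewrite /Rtrunc; case: (y' == y); first exact: measurable_cst.
have mR (x z : state K d) : measurable_fun setT (fun u => Rest vt u x z).
  by apply: measurable_funM => //; exact: measurable_cst.
apply: measurable_funM => //; apply: measurable_minr; first exact: measurable_cst.
apply: measurable_divr; first exact: measurable_cst.
rewrite /Rest_tot; under eq_fun do rewrite -big_filter.
by apply: measurable_sum => x; exact: mR.
Qed.

Lemma measurable_step_kernel z z' :
  measurable_fun setT (fun u => step_kernel vt b u z z').
Proof.
case: (eqVneq z' z) => [->|zz'].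
  under eq_fun do rewrite step_kernel_diag.
  apply: measurable_funB; first exact: measurable_cst.
  apply: measurable_funM; last exact: measurable_cst.
  by apply: measurable_sum => x; exact: measurable_Rtrunc.
under eq_fun do rewrite step_kernelE//.
by apply: measurable_funM; [exact: measurable_Rtrunc|exact: measurable_cst].
Qed.

End StepKernel.

(** * One window *)

(** [win_step] in terms of rates. The time integrals of the kernel out of [z] add up to r' - r, so
    the sum over targets becomes [b * (r' - r)] times the value at [z] plus a sum of differences, in
    which the diagonal drops out. *)
Lemma win_step_rates (R : realType) (K d : nat)
    (vt : R -> state K d -> state K d -> R)
    (G : state K d -> R) (b c r r' t : R) (z : state K d) :
  (forall t y y', unmask_pair y y' -> 0 < vt t y y') ->
  (forall y y', measurable_fun setT (fun t => vt t y y')) ->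
  (forall z, 0 <= G z <= c) -> 0 <= b -> 0 <= c -> r <= r' -> r' <= t ->
  expR (- (b * (r' - r))) * (win (step_kernel vt b) G b t r' z * (1 + b * (r' - r)) +
    \sum_y' (\int[lebesgue_measure]_(u in `[r, r']) Rtrunc vt b u y' z) *
      (win (step_kernel vt b) G b t r' y' - win (step_kernel vt b) G b t r' z))
  <= win (step_kernel vt b) G b t r z.
Proof.
move=> vt0 mvt Gc b0 c0 rr' r't.
set M := step_kernel vt b; set k := win M G b t r'.
have mM x y : measurable_fun setT (fun u => M u x y) by exact: measurable_step_kernel.
have M0 u x y : 0 <= M u x y by exact: step_kernel_ge0.
have M1 u x : \sum_y M u x y = 1 by exact: sum_step_kernel.
have Mle u x y : 0 <= M u x y <= 1.
  by rewrite M0 /= -(M1 u x) (bigD1 y)//= lerDl sumr_ge0.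
apply: le_trans (win_step R _ M G b c r r' t z mM M0 M1 Gc b0 c0 rr' r't).
rewrite ler_wpM2l ?expR_ge0// -/k.
pose m y := \int[lebesgue_measure]_(u in `[r, r']) M u z y.
have iM y : lebesgue_measure.-integrable (`[r, r'] : set R) (EFin \o (fun u => M u z y)).
  exact: (integrable_itv_bounded R r r' 1).
have summ : \sum_y m y = r' - r.
  have [_] := integrable_sum_scale R _ (index_enum (state K d)) (`[r, r'] : set R)
    (fun=> 1) (fun y u => M u z y) (measurable_itv _) iM.
  under [X in _ = X -> _]eq_bigr do rewrite mul1r.
  move=> <-; rewrite -[RHS]mul1r -Rintegral_itv_cst//; apply: eq_Rintegral => u _.
  by rewrite -[RHS](M1 u z); apply: eq_bigr => y _; rewrite mul1r.
have Rm y : y != z -> \int[lebesgue_measure]_(u in `[r, r']) Rtrunc vt b u y z = b * m y.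
  move=> yz; rewrite -RintegralZl//; apply: eq_Rintegral => u _.
  by rewrite Rtrunc_kernel.
rewrite le_eqVlt; apply/orP; left; apply/eqP.
rewrite (eq_bigr (fun y => b * (m y * (k y - k z)))); last first.
  move=> y _; case: (eqVneq y z) => [->|yz]; first by rewrite subrr !mulr0.
  by rewrite Rm// mulrA.
rewrite -mulr_sumr; under eq_bigr do rewrite mulrBr.
rewrite sumrB -mulr_suml summ -/m; ring.
Qed.

Section Window.
Context {R : realType} {K d : nat} (m : 'I_K) (hm : is_mask m)
  (z1 : 'I_K) (hz1 : ~~ is_mask z1).
Context (qstar : state K d -> R) (q : R -> state K d -> R).
Hypothesis hq0 : forall y, 0 <= qstar y.
Hypothesis hq1 : \sum_(y : state K d) qstar y = 1.
Hypothesis hqE : forall t y, q t y = \sum_x Ptr t x y * qstar x.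
Hypothesis hA2 : forall y, 0 < qstar y <-> numK y = 0%N.
Hypothesis hqode : forall (t : R) (y : state K d),
  is_derive t (1 : R) (fun s => q s y) (\sum_(y' : state K d) Rfwd R y y' * q t y').
Context (vt : R -> state K d -> state K d -> R).
Hypothesis vt_gt0 : forall t y y', unmask_pair y y' -> 0 < vt t y y'.
Hypothesis vt_meas : forall y y', measurable_fun setT (fun t => vt t y y').
Context (T : R).

(** The loss integrand in the time u of the reverse process, kept state by state because the
    estimate for a given start of the window weights each state by its probability of leading back
    to that start. *)
Definition node_loss (u : R) (y : state K d) : R :=
  q (T - u) y * \sum_(y' | y' != y) Rfwd R y y' * Dphi (score q T u y y') (vt u y y').

Definition loss (u : R) : R := \sum_y node_loss u y.

Lemma node_lossE u y : node_loss u y =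
  q (T - u) y * \sum_(y' | unmask_pair y y') Dphi (q (T - u) y' / q (T - u) y) (vt u y y').
Proof.
rewrite /node_loss; congr (_ * _).
rewrite [RHS]big_mkcond [RHS](bigD1 y)//= ifF; last first.
  by apply/negP => /unmask_pair_neq; rewrite eqxx.
rewrite add0r; apply: eq_bigr => y' yy'; rewrite Rfwd_neq//.
by case: ifP => _; rewrite ?mul1r ?mul0r.
Qed.

Lemma node_loss_ge0 u y : u < T -> 0 <= node_loss u y.
Proof.
move=> uT; have T0 : 0 < T - u by rewrite subr_gt0.
have qp := marginal_gt0 qstar q hq0 hqE hA2 z1 (T - u) _ hz1 T0.
rewrite node_lossE mulr_ge0 ?(ltW (qp y))//; apply: sumr_ge0 => y' yy'.
by apply: Dphi_ge0; [rewrite divr_gt0|exact: vt_gt0].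
Qed.

Lemma measurable_marginal y : measurable_fun setT (fun u : R => q (T - u) y).
Proof.
have mq : measurable_fun setT (fun t => q t y).
  exact: (measurable_is_derive R _ _ (fun t => hqode t y)).
apply: (measurableT_comp mq); apply: measurable_funB => //.
Qed.

Lemma measurable_node_loss y : measurable_fun setT (fun u => node_loss u y).
Proof.
under eq_fun do rewrite node_lossE -big_filter.
apply: measurable_funM; first exact: measurable_marginal.
apply: measurable_sum => y'; rewrite /Dphi.
have ms : measurable_fun setT (fun u : R => q (T - u) y' / q (T - u) y).
  by apply: measurable_divr; exact: measurable_marginal.
apply: measurable_funD => //; apply: measurable_funB => //.
apply: measurable_funM => //; apply: (measurableT_comp (@measurable_ln R)).
exact: measurable_divr.
Qed.

Lemma mul_lip (p p' r r' L : R) : 0 <= p <= 1 -> 0 <= r' <= 1 ->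
  `|p - p'| <= L -> `|r - r'| <= L -> `|p * r - p' * r'| <= 2 * L.
Proof.
move=> /andP[p0 p1] /andP[r0 r1] hp hr.
have -> : p * r - p' * r' = p * (r - r') + (p - p') * r' by ring.
rewrite (le_trans (ler_normD _ _))// !normrM (ger0_norm p0) (ger0_norm r0).
have h1 : p * `|r - r'| <= L by apply: le_trans hr; rewrite ler_piMl.
have h2 : `|p - p'| * r' <= L by apply: le_trans hp; rewrite ler_piMr.
lra.
Qed.

Context (s t : R) (st : s <= t) (tT : t < T).

(* Joint law of the true reverse process at times [s] and [u]: [z0] at time [s],
   [y] at time [u]; [flux] is the probability flow from [y] to [y'] in it. *)
Definition joint (z0 : state K d) (u : R) (y : state K d) : R :=
  q (T - u) y * Ptr (u - s) y z0.

Definition flux (z0 : state K d) (u : R) (y' y : state K d) : R :=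
  (unmask_pair y y')%:R * (q (T - u) y' * Ptr (u - s) y z0).

(** The marginal follows the forward equation run backwards and [Ptr] the backward equation; in the
    product rule the holding terms [d - numK y] cancel and only the flows remain. *)
Lemma is_derive_joint z0 u y :
  is_derive u (1 : R) (fun v => joint z0 v y) (\sum_y' (flux z0 u y y' - flux z0 u y' y)).
Proof.
have d1 : is_derive u (1 : R) (fun v => T - v) (-1).
  have := is_deriveB (is_derive_cst T u (1 : R)) (is_derive_id u (1 : R)).
  by rewrite sub0r.
have d2 : is_derive u (1 : R) (fun v => v - s) 1.
  have := is_deriveB (is_derive_id u (1 : R)) (is_derive_cst s u (1 : R)).
  by rewrite subr0.
have D1 := @is_derive1_comp R (fun v => q v y) (fun v => T - v) u _ _ (hqode (T - u) y) d1.
have D2 := @is_derive1_comp R (fun v => Ptr v y z0) (fun v => v - s) u _ _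
  (is_derive_Ptr_bwd R K d m (u - s) y z0 hm) d2.
apply: (is_derive_eq (is_deriveM D1 D2)).
rewrite /GRing.scale /= sum_Rfwd sumrB.
have -> : \sum_y' flux z0 u y y' =
    q (T - u) y * \sum_(y' | unmask_pair y' y) Ptr (u - s) y' z0.
  rewrite mulr_sumr [RHS]big_mkcond; apply: eq_bigr => y' _; rewrite /flux.
  by case: ifP => _; rewrite ?mul1r ?mul0r.
have -> : \sum_y' flux z0 u y' y =
    (\sum_(y' | unmask_pair y y') q (T - u) y') * Ptr (u - s) y z0.
  rewrite mulr_suml [RHS]big_mkcond; apply: eq_bigr => y' _; rewrite /flux.
  by case: ifP => _; rewrite ?mul1r ?mul0r.
ring.
Qed.

(** Two states [x] and [y] are allowed so that the bound serves both [joint], where they coincide,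
    and [flux]. *)
Lemma pair_lip (z0 x y : state K d) (r u : R) : s <= r -> r <= u -> u <= t ->
  `|q (T - u) x * Ptr (u - s) y z0 - q (T - r) x * Ptr (r - s) y z0| <=
  2 * (d%:R * (u - r)).
Proof.
have tT' := tT; have st' := st.
move=> sr ru ut; apply: mul_lip.
- by apply: (marginal_bounds qstar q hq0 hq1 hqE); lra.
- by apply: Ptr_bounds; lra.
- rewrite distrC (_ : u - r = (T - r) - (T - u)); last by ring.
  by apply: (marginal_lip qstar q hq0 hq1 hqE); lra.
- rewrite (_ : u - r = (u - s) - (r - s)); last by ring.
  by apply: Ptr_lip; lra.
Qed.

Lemma Rest_totE u y : Rest_tot vt u y = \sum_(y' | unmask_pair y y') vt u y y'.
Proof.
rewrite /Rest_tot [RHS]big_mkcond [RHS](bigD1 y)//= ifF; last first.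
  by apply/negP => /unmask_pair_neq; rewrite eqxx.
rewrite add0r; apply: eq_bigr => y' yy'; rewrite /Rest Rfwd_neq//.
by case: ifP => _; rewrite ?mul1r ?mul0r.
Qed.

Lemma RtruncE b u y' y : Rtrunc vt b u y' y =
  (unmask_pair y y')%:R * (vt u y y' *
    Num.min 1 (b / \sum_(y' | unmask_pair y y') vt u y y')).
Proof.
rewrite /Rtrunc; case: eqP => [->|/eqP yy'].
  rewrite (_ : unmask_pair y y = false) ?mul0r//.
  by apply/negP => /unmask_pair_neq; rewrite eqxx.
by rewrite /Rhat /Rest Rfwd_neq// Rest_totE mulrA.
Qed.

(** State by state this is [truncated_entropy], since the flow out of [y] is [joint] times the true
    score. Its hypothesis holds because the true total rate numK y / (e^(T-u) - 1) grows with u and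
    with the number of masks, and numK y <= numK z0 wherever [z0] is reachable from [y]. *)
Lemma rate_inequality z0 (b u : R) f :
  s <= u <= t -> (K%:R * (numK z0)%:R) / (expR (T - t) - 1) = b ->
  \sum_y \sum_y' (flux z0 u y' y * (f y' - f y) -
      joint z0 u y * Rtrunc vt b u y' y * (expR (f y' - f y) - 1)) <=
  \sum_y Ptr (u - s) y z0 * node_loss u y.
Proof.
have tT' := tT; have st' := st.
move=> /andP[su ut] bE; apply: ler_sum => y _.
have T0 : 0 < T - u by lra.
have qp := marginal_gt0 qstar q hq0 hqE hA2 z1 (T - u) _ hz1 T0.
have us0 : 0 <= u - s by lra.
have /andP[P0 _] := Ptr_bounds R K d (u - s) y z0 us0.
(* If [y] cannot lead to [z0], both the flow and the joint probability vanish. *)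
have [P1|P1] := eqVneq (Ptr (u - s) y z0) 0.
  by rewrite P1 mul0r big1// => y' _; rewrite /flux /joint P1; ring.
have ny := Ptr_neq0_numK R K d (u - s) y z0 P1.
pose v y' := q (T - u) y' / q (T - u) y.
pose c := Num.min 1 (b / \sum_(y' | unmask_pair y y') vt u y y').
have -> : \sum_y' (flux z0 u y' y * (f y' - f y) -
      joint z0 u y * Rtrunc vt b u y' y * (expR (f y' - f y) - 1)) =
    Ptr (u - s) y z0 * (q (T - u) y * \sum_(y' | unmask_pair y y')
      (v y' * (f y' - f y) - vt u y y' * c * (expR (f y' - f y) - 1))).
  rewrite !mulr_sumr [RHS]big_mkcond; apply: eq_bigr => y' _.
  rewrite /flux /joint RtruncE -/c; case: (unmask_pair y y') => /=; last by ring.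
  by rewrite /v; field; rewrite gt_eqF.
rewrite ler_wpM2l// node_lossE ler_wpM2l ?(ltW (qp y))//.
apply: truncated_entropy => [y' _|y' yy'|]; first by rewrite divr_gt0.
  exact: vt_gt0.
rewrite -mulr_suml (sum_marginal_unmask qstar q hq0 hqE hA2)// mulfK ?gt_eqF//.
have e1 : 0 < expR (T - t) - 1 by rewrite subr_gt0 -expR0 ltr_expR; lra.
have e2 : expR (T - t) - 1 <= expR (T - u) - 1 by rewrite lerD2r ler_expR; lra.
rewrite -bE ler_pM ?invr_ge0//.
- by apply: ltW; exact: lt_le_trans e2.
- rewrite -natrM ler_nat (leq_trans ny)// leq_pmull//.
  exact: leq_ltn_trans (ltn_ord m).
- by rewrite lef_pV2// posrE; exact: lt_le_trans e2.
Qed.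

Definition wbeta (z0 : state K d) : R := (K%:R * (numK z0)%:R) / (expR (T - t) - 1).

Lemma wbeta_ge0 z0 : 0 <= wbeta z0.
Proof.
have tT' := tT; have st' := st.
by rewrite divr_ge0 ?mulr_ge0// subr_ge0 -expR0 ler_expR; lra. Qed.

(** Each starting state [z0] has its own clock rate, hence its own function [k] and its own
    application of [entropy_bound], with the share [lz z0] of the loss. As the probabilities
    [Ptr (u - s) y z0] sum to 1 over [z0], the shares add up to the loss. *)
Lemma window_entropy (G : state K d -> R) (glo c : R) :
  0 < glo -> (forall z, glo <= G z <= c) ->
  lebesgue_measure.-integrable (`[s, t] : set R) (EFin \o loss) ->
  \sum_y q (T - t) y * ln (G y) -
  \sum_z q (T - s) z * ln (win (step_kernel vt (wbeta z)) G (wbeta z) t s z) <=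
  \int[lebesgue_measure]_(u in `[s, t]) loss u.
Proof.
have tT' := tT; have st' := st.
move=> glo0 Gc il.
have G0 z : 0 < G z by have /andP[h _] := Gc z; exact: lt_le_trans h.
have Gc' z : 0 <= G z <= c by have /andP[_ ->] := Gc z; rewrite ltW.
have [y0 _|S0] := pickP (fun y : state K d => true); last first.
  move: hq1; rewrite big_pred0 => [/eqP|y]; last by have := S0 y.
  by rewrite eq_sym oner_eq0.
have c0 : 0 <= c by have /andP[h1 h2] := Gc' y0; exact: le_trans h2.
pose lz z0 u := \sum_y Ptr (u - s) y z0 * node_loss u y.
have mP y z0 : measurable_fun setT (fun u : R => Ptr (u - s) y z0).
  have mq : measurable_fun setT (fun t : R => Ptr t y z0).
    apply: (measurable_is_derive R _
      (fun t => \sum_i dkap t (y i) (z0 i) * Prest t y z0 i)) => v.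
    exact: is_derive_Ptr.
  by apply: (measurableT_comp mq); apply: measurable_funB.
have mlz z0 : measurable_fun setT (lz z0).
  apply: measurable_sum => y; apply: measurable_funM => //.
  exact: measurable_node_loss.
have mI : measurable (`[s, t] : set (measurableTypeR R)) by exact: measurable_itv.
have ilz z0 : lebesgue_measure.-integrable (`[s, t] : set R) (EFin \o lz z0).
  have mE : measurable_fun setT (EFin \o lz z0) by exact/measurable_EFinP.
  apply: (le_integrable mI _ _ il); first exact: measurable_funTS mE.
  move=> u /=; rewrite in_itv /= => /andP[su ut]; rewrite lee_fin.
  have us0 : 0 <= u - s by lra.
  have uT : u < T by lra.
  have h1 y : 0 <= Ptr (u - s) y z0 * node_loss u y.
    rewrite mulr_ge0 ?node_loss_ge0//.
    by have /andP[] := Ptr_bounds R K d (u - s) y z0 us0.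
  rewrite !ger0_norm; last 2 first.
  - by apply: sumr_ge0 => y _; exact: node_loss_ge0.
  - by apply: sumr_ge0 => y _; exact: h1.
  apply: ler_sum => y _; rewrite ler_piMl ?node_loss_ge0//.
  by have /andP[] := Ptr_bounds R K d (u - s) y z0 us0.
have key z0 : \sum_y joint z0 t y * ln (G y) -
    q (T - s) z0 * ln (win (step_kernel vt (wbeta z0)) G (wbeta z0) t s z0) <=
    \int[lebesgue_measure]_(u in `[s, t]) lz z0 u.
  set b := wbeta z0; have b0 : 0 <= b by exact: wbeta_ge0.
  pose k r y := win (step_kernel vt b) G b t r y.
  have kb r y : s <= r <= t -> expR (- (b * (t - r))) * G y <= k r y <= c.
    move=> /andP[sr rt].
    have [] := win_bounds R _ (step_kernel vt b) G b c r t y _ _ _ Gc' b0 c0 rt => //.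
    - by move=> x x'; exact: measurable_step_kernel.
    - by move=> *; exact: step_kernel_ge0.
    - by move=> *; exact: sum_step_kernel.
  pose lo := expR (- (b * (t - s))) * glo.
  have lo0 : 0 < lo by rewrite mulr_gt0// expR_gt0.
  have kb2 r y : s <= r <= t -> lo <= k r y <= c.
    move=> rin; have /andP[h1 ->] := kb r y rin; rewrite andbT.
    apply: le_trans h1; have /andP[g1 _] := Gc y; case/andP: rin => sr rt.
    rewrite ler_pM ?expR_ge0 ?(ltW glo0)// ler_expR lerN2 ler_wpM2l//; lra.
  have := entropy_bound R _ s t b c lo (2 * d%:R) k (Rtrunc vt b) (joint z0) (flux z0) (lz z0)
    st b0 lo0.
  have L0 : 0 <= 2 * d%:R :> R by rewrite mulr_ge0.
  have mRh y' y : measurable_fun setT (fun u => Rtrunc vt b u y' y).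
    exact: measurable_Rtrunc.
  have bRh u y' y : 0 <= Rtrunc vt b u y' y <= b by rewrite Rtrunc_ge0// Rtrunc_le.
  have hstep r r' y : s <= r -> r <= r' -> r' <= t ->
    expR (- (b * (r' - r))) * (k r' y * (1 + b * (r' - r)) +
      \sum_y' (\int[lebesgue_measure]_(u in `[r, r']) Rtrunc vt b u y' y) *
        (k r' y' - k r' y)) <= k r y.
    by move=> sr rr' r't; exact: (win_step_rates R K d vt G b c).
  have Q01 u y : s <= u <= t -> 0 <= joint z0 u y <= 1.
    move=> /andP[su ut]; rewrite /joint.
    have Tu : 0 <= T - u by lra.
    have us : 0 <= u - s by lra.
    have /andP[h1 h2] := marginal_bounds qstar q hq0 hq1 hqE (T - u) y Tu.
    have /andP[h3 h4] := Ptr_bounds R K d (u - s) y z0 us.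
    by rewrite mulr_ge0//= mulr_ile1.
  have lipQ r u y : s <= r -> r <= u -> u <= t ->
      `|joint z0 u y - joint z0 r y| <= 2 * d%:R * (u - r).
    by move=> *; rewrite -mulrA; exact: pair_lip.
  have lipJ r u y' y : s <= r -> r <= u -> u <= t ->
      `|flux z0 u y' y - flux z0 r y' y| <= 2 * d%:R * (u - r).
    move=> sr ru ut; rewrite /flux -mulrBr normrM normr_nat.
    rewrite -[leRHS]mul1r; apply: ler_pM => //; first by rewrite lern1 leq_b1.
    by rewrite -mulrA; exact: pair_lip.
  have dQ u y : s <= u <= t -> is_derive u (1 : R) (fun v => joint z0 v y)
      (\sum_y' (flux z0 u y y' - flux z0 u y' y)).
    by move=> _; exact: is_derive_joint.
  have hpt u f : s <= u <= t -> \sum_y \sum_y' (flux z0 u y' y * (f y' - f y) -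
      joint z0 u y * Rtrunc vt b u y' y * (expR (f y' - f y) - 1)) <= lz z0 u.
    by move=> uin; exact: rate_inequality.
  move=> /(_ L0 kb2 mRh bRh hstep Q01 lipQ lipJ dQ hpt (ilz z0)).
  (* At the end of the window the no-ring bound gives [G y <= k t y]; at its start [Ptr 0] is the
     identity, so the joint law is concentrated at [z0]. *)
  apply: le_trans; apply: lerB.
    apply: ler_sum => y _; have tin : s <= t <= t by rewrite st lexx.
    have /andP[h1 _] := Q01 t y tin; have /andP[h2 _] := kb t y tin.
    rewrite ler_wpM2l// ler_ln ?posrE//; last first.
      by have /andP[h3 _] := kb2 t y tin; exact: lt_le_trans h3.
    by move: h2; rewrite subrr mulr0 oppr0 expR0 mul1r.
  rewrite (bigD1 z0)//= /joint subrr Ptr0 eqxx mulr1 big1 ?addr0// => y yz.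
  by rewrite Ptr0 (negbTE yz) mulr0 mul0r.
have := ler_sum (index_enum (state K d)) (fun z (_ : true) => key z).
rewrite sumrB exchange_big /=.
have -> : \sum_y \sum_z0 joint z0 t y * ln (G y) = \sum_y q (T - t) y * ln (G y).
  apply: eq_bigr => y _; rewrite -mulr_suml /joint -mulr_sumr (sum_Ptr _ _ _ m)//.
  by rewrite mulr1.
move=> /le_trans; apply.
have [_] := integrable_sum_scale R _ (index_enum (state K d)) (`[s, t] : set R)
  (fun=> 1) lz mI ilz.
under [X in _ = X -> _]eq_bigr do rewrite mul1r.
move=> <-; rewrite le_eqVlt; apply/orP; left; apply/eqP; apply: eq_Rintegral => u _.
under eq_bigr do rewrite mul1r.
rewrite exchange_big /=; apply: eq_bigr => y _.
by rewrite -mulr_suml (sum_Ptr _ _ _ m)// mul1r.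
Qed.

End Window.

(** * The law of the output *)

Definition delta {R : realType} {S : finType} (y z : S) : R := (z == y)%:R.

Lemma unif_expectE (R : realType) (a b : R) n (F : seq R -> \bar R) :
  a < b -> (forall s, 0 <= F s)%E -> seq_measurable F ->
  unif_expect a b n F = (((b - a)^-1 ^+ n)%:E * iint `[a, b] n F)%E.
Proof.
move=> ab; have h0 : 0 <= (b - a)^-1 by rewrite invr_ge0 subr_ge0 ltW.
elim: n F => [|n IH] F F0 mF; first by rewrite expr0 mul1e.
rewrite [LHS]/= exprS EFinM -muleA; congr (_ * _)%E.
have mI : measurable_fun setT (fun u => iint `[a, b] n (fun s => F (u :: s))).
  by apply: measurable_iint_cons => //; exact: measurable_itv.
rewrite [RHS]/= -ge0_integralZl_EFin//.
- apply: eq_integral => u _; apply: IH => //; exact: seq_measurable_cons.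
- by move=> u _; exact: iint_ge0.
- exact: measurable_funTS mI.
- exact: exprn_ge0.
Qed.

Lemma foldl_step_dist (R : realType) (K d : nat) (vt : R -> state K d -> state K d -> R)
    (b : R) (s : seq R) (p : state K d -> R) y' :
  foldl (step_dist vt b) p s y' = \sum_z p z * bwd (step_kernel vt b) (delta y') s z.
Proof.
elim: s p => [|u s IH] p /=.
  rewrite (bigD1 y')//= /delta eqxx mulr1 big1 ?addr0// => z zy.
  by rewrite (negbTE zy) mulr0.
rewrite IH /step_dist /=; under eq_bigr do rewrite mulr_suml.
rewrite exchange_big /=; apply: eq_bigr => z _; rewrite mulr_sumr.
by apply: eq_bigr => z' _; rewrite mulrA.
Qed.

Lemma foldl_dirac (R : realType) (K d : nat) (vt : R -> state K d -> state K d -> R)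
    (b : R) (s : seq R) z0 y' :
  foldl (step_dist vt b) (dirac_st R z0) s y' = bwd (step_kernel vt b) (delta y') s z0.
Proof.
rewrite foldl_step_dist (bigD1 z0)//= /dirac_st eqxx mul1r big1 ?addr0// => z zz.
by rewrite (negbTE zz) mul0r.
Qed.

Lemma delta_bounds (R : realType) (S : finType) (y z : S) :
  0 <= (delta y z : R) <= 1.
Proof. by rewrite /delta ler0n lern1 leq_b1. Qed.

Lemma bwd_delta (R : realType) (S : finType) (M : R -> S -> S -> R) (G : S -> R) s z :
  bwd M G s z = \sum_y bwd M (delta y) s z * G y.
Proof.
elim: s z => [|u s IH] z /=.
  rewrite (bigD1 z)//= /delta eqxx mul1r big1 ?addr0// => y yz.
  by rewrite eq_sym (negbTE yz) mul0r.
under eq_bigr do rewrite IH mulr_sumr.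
rewrite exchange_big /=; apply: eq_bigr => y _; rewrite mulr_suml.
by apply: eq_bigr => z' _; rewrite mulrA.
Qed.

Lemma iter_mean_delta (R : realType) (S : finType) (M : R -> S -> S -> R)
    (G : S -> R) (c r t : R) n z :
  (forall z z', measurable_fun setT (fun u => M u z z')) ->
  (forall u z z', 0 <= M u z z') -> (forall u z, \sum_z' M u z z' = 1) ->
  (forall z, 0 <= G z <= c) -> r <= t ->
  iter_mean M G t r n z = \sum_y G y * iter_mean M (delta y) t r n z.
Proof.
move=> mM M0 M1 Gc rt.
have [E1 _] := iter_mean_bound R S M G c r t n z mM M0 M1 Gc rt.
have E2 y := proj1 (iter_mean_bound R S M (delta y) 1 r t n z mM M0 M1
  (delta_bounds R S y) rt).
have G0 y : 0 <= G y by have /andP[] := Gc y.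
have D0 (y x : S) : 0 <= (delta y x : R) by have /andP[] := delta_bounds R S y x.
apply: EFin_inj; rewrite -E1 -sumEFin.
under [RHS]eq_bigr do rewrite EFinM -E2.
rewrite -iint_sum//.
- congr iint; apply/funext => s; rewrite bwd_delta -sumEFin; apply: eq_bigr => y _.
  by rewrite EFinM muleC.
- by move=> y s; rewrite lee_fin bwd_ge0.
- move=> y; apply: (seq_measurable_sort R (fun s => (bwd M (delta y) s z)%:E)).
  exact: seq_measurable_bwd.
Qed.

Lemma win_delta (R : realType) (S : finType) (M : R -> S -> S -> R)
    (G : S -> R) (b c r t : R) z :
  (forall z z', measurable_fun setT (fun u => M u z z')) ->
  (forall u z z', 0 <= M u z z') -> (forall u z, \sum_z' M u z z' = 1) ->
  (forall z, 0 <= G z <= c) -> 0 <= b -> r <= t ->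
  win M G b t r z = \sum_y win M (delta y) b t r z * G y.
Proof.
move=> mM M0 M1 Gc b0 rt; rewrite /win.
under [RHS]eq_bigr do rewrite -mulrA.
rewrite -mulr_sumr; congr (_ * _).
have cv y : cvgn (series (fun n => b ^+ n / n`!%:R * iter_mean M (delta y) t r n z)).
  by have [] := win_bounds R S M (delta y) b 1 r t z mM M0 M1 (delta_bounds R S y) b0
    ler01 rt.
have cvL : (fun N => \sum_y series (fun n => b ^+ n / n`!%:R *
      iter_mean M (delta y) t r n z) N * G y)
   @ \oo --> \sum_y poisson_sum b (fun n => iter_mean M (delta y) t r n z) * G y.
  apply: cvg_big => [|y _]; first exact: add_continuous.
  by apply: cvgMr_tmp; exact: cv.
rewrite -(cvg_lim _ cvL)//; congr (limn _); apply/funext => N.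
rewrite seriesEnat /=; under [RHS]eq_bigr do rewrite seriesEnat /= mulr_suml.
rewrite exchange_big /=; apply: eq_bigr => n _.
rewrite (iter_mean_delta R S M G c)// mulr_sumr; apply: eq_bigr => y _; ring.
Qed.

Lemma window_kernelE (R : realType) (K d : nat) (vt : R -> state K d -> state K d -> R)
    (T : R) (tp : nat -> R) w (z0 y' : state K d) :
  (forall t y y', unmask_pair y y' -> 0 < vt t y y') ->
  (forall y y', measurable_fun setT (fun t => vt t y y')) ->
  tp w.-1 < tp w -> 0 <= beta_w T tp w z0 ->
  window_kernel vt T tp w z0 y' =
  (win (step_kernel vt (beta_w T tp w z0)) (delta y') (beta_w T tp w z0)
     (tp w) (tp w.-1) z0)%:E.
Proof.
move=> vt0 mvt tw b0; rewrite /window_kernel.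
set b := beta_w T tp w z0 in b0 *; set M := step_kernel vt b.
have mM x y : measurable_fun setT (fun u => M u x y) by exact: measurable_step_kernel.
have M0 u x y : 0 <= M u x y by exact: step_kernel_ge0.
have M1 u x : \sum_y M u x y = 1 by exact: sum_step_kernel.
have D01 := delta_bounds R _ y'.
have [cv _] := win_bounds R _ M (delta y') b 1 (tp w.-1) (tp w) z0 mM M0 M1 D01 b0
  ler01 (ltW tw).
set h := tp w - tp w.-1; have h0 : 0 < h by rewrite subr_gt0.
have F0 s : (0 <= (bwd M (delta y') (sort <=%R s) z0)%:E)%E.
  by rewrite lee_fin bwd_ge0// => x; have /andP[] := D01 x.
have mF : seq_measurable (fun s => (bwd M (delta y') (sort <=%R s) z0)%:E).
  apply: (seq_measurable_sort R (fun s => (bwd M (delta y') s z0)%:E)).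
  exact: seq_measurable_bwd.
have term n : ((pois (b * h) n)%:E * unif_expect (tp w.-1) (tp w) n
       (fun s => (foldl (step_dist vt b) (dirac_st R z0) (sort <=%R s) y')%:E))%E =
    (expR (- (b * h)) * (b ^+ n / n`!%:R * iter_mean M (delta y') (tp w) (tp w.-1) n z0))%:E.
  have -> : (fun s => (foldl (step_dist vt b) (dirac_st R z0) (sort <=%R s) y')%:E) =
      (fun s => (bwd M (delta y') (sort <=%R s) z0)%:E).
    by apply/funext => s; rewrite foldl_dirac.
  rewrite unif_expectE//.
  rewrite (proj1 (iter_mean_bound R _ M (delta y') 1 (tp w.-1) (tp w) n z0 mM M0 M1 D01
    (ltW tw))) -!EFinM; congr EFin.
  rewrite /pois exprMn exprVn -/h; field.
  by rewrite pnatr_eq0 -lt0n fact_gt0 expf_neq0// gt_eqF.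
under eq_eseriesr do rewrite term.
pose a n := b ^+ n / n`!%:R * iter_mean M (delta y') (tp w) (tp w.-1) n z0.
have cvz : (fun N => expR (- (b * h)) * series a N) @ \oo -->
    expR (- (b * h)) * limn (series a) by apply: cvgMl_tmp; exact: cv.
transitivity (limn (EFin \o (fun N => expR (- (b * h)) * series a N))).
  congr (limn _); apply/funext => N /=.
  by rewrite seriesEnat /= mulr_sumr -sumEFin.
by rewrite EFin_lim ?(cvg_lim _ cvz)//; exact: cvgP cvz.
Qed.

Lemma ler_ndecr (R : realType) (f df : R -> R) (a b : R) : a <= b ->
  (forall x, is_derive x (1 : R) f (df x)) ->
  (forall x, a <= x <= b -> 0 <= df x) -> f a <= f b.
Proof.
move=> ab df1 d0; have [|xi] := @MVT_segment R f df a b ab (fun v _ => df1 v).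
  by apply: derivable_within_continuous => v _; have [] := df1 v.
rewrite in_itv /= => /d0 h E; rewrite -subr_ge0 E mulr_ge0// subr_ge0//.
Qed.

(** The difference of the two sides vanishes at 0 together with its derivative, and its second
    derivative is 1/4 minus the variance of the tilted Bernoulli law. That variance has the form a b
    / (a + b)^2 with a = 1 - p and b = p e^x, hence is at most 1/4. *)
Lemma bernoulli_hoeffding (R : realType) (p lam : R) : 0 <= p <= 1 -> 0 <= lam ->
  ln (1 - p + p * expR lam) <= lam * p + lam ^+ 2 / 8.
Proof.
move=> /andP[p0 p1] l0.
pose D (x : R) := 1 - p + p * expR x.
have D0 x : 0 < D x.
  have e0 := expR_gt0 x; rewrite /D; have [->|pn] := eqVneq p 0; first by lra.
  have : 0 < p by rewrite lt_neqAle eq_sym pn.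
  by move=> pp; have : 0 < p * expR x by [rewrite mulr_gt0]; lra.
have dD x : is_derive x (1 : R) D (p * expR x).
  have := is_deriveD (is_derive_cst (1 - p) x (1 : R))
    (is_deriveZ p (is_derive_expR x)).
  by rewrite add0r.
pose dF (x : R) := p + x / 4 - p * expR x / D x.
have dlin (c x : R) : is_derive x (1 : R) (fun v : R => v * c) c.
  have := is_derive_scaler R c id 1 x (is_derive_id x (1 : R)).
  by rewrite mul1r.
have dq (x : R) : is_derive x (1 : R) (fun v : R => v ^+ 2 / 8) (x / 4).
  apply: (is_derive_eq (is_derive_scaler R 8^-1 (fun v => v * v) (x + x) x _)).
    apply: (is_derive_eq (is_deriveM (is_derive_id x (1 : R)) (is_derive_id x (1 : R)))).
    by rewrite /GRing.scale /= !mulr1.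
  by field.
have dF1 x : is_derive x (1 : R) (fun v => v * p + v ^+ 2 / 8 - ln (D v)) (dF x).
  have d1 := @is_derive1_comp R (@ln R) D x _ _ (is_derive1_ln (D0 x)) (dD x).
  apply: (is_derive_eq (is_deriveB (is_deriveD (dlin p x) (dq x)) d1)).
  by rewrite /dF [X in _ = _ - X]mulrC.
have ddF x : is_derive x (1 : R) dF (1 / 4 - p * expR x * (1 - p) / D x ^+ 2).
  have Dn : D x != 0 by rewrite gt_eqF.
  have d1 := is_deriveM (is_deriveZ p (is_derive_expR x)) (is_deriveV Dn (dD x)).
  have d2 := is_deriveD (is_derive_cst p x (1 : R)) (dlin 4^-1 x).
  apply: (is_derive_eq (is_deriveB d2 d1)).
  rewrite /GRing.scale /= (_ : p *: expR x = p * expR x)// /D; field.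
  by move: Dn; rewrite /D.
have ddF0 x : 0 <= 1 / 4 - p * expR x * (1 - p) / D x ^+ 2.
  rewrite subr_ge0 ler_pdivrMr ?exprn_gt0// /D.
  have := sqr_ge0 (1 - p - p * expR x); lra.
have dF0 x : 0 <= x -> 0 <= dF x.
  move=> x0; have := ler_ndecr R dF _ 0 x x0 ddF (fun v _ => ddF0 v).
  by rewrite {1}/dF /D expR0 !mulr1 subrK divr1 mul0r addr0 subrr.
have dF0' x : 0 <= x <= lam -> 0 <= dF x by move=> /andP[x0 _]; exact: dF0.
have := ler_ndecr R _ dF 0 lam l0 dF1 dF0'.
by rewrite /D expR0 mulr1 subrK ln1 mul0r expr0n /= mul0r addr0 subr0 subr_ge0.
Qed.

Lemma finite_lower_bound (R : realType) (S : finType) (G : S -> R) :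
  (forall z, 0 < G z) -> exists2 lo, 0 < lo & forall z, lo <= G z.
Proof.
move=> G0; suff [lo lo0 H] : exists2 lo, 0 < lo & forall z, z \in enum S -> lo <= G z.
  by exists lo => // z; apply: H; rewrite mem_enum.
elim: (enum S) => [|z r [lo lo0 H]]; first by exists 1.
exists (Num.min lo (G z)); first by rewrite lt_min lo0 G0.
move=> y; rewrite in_cons => /orP[/eqP ->|/H h]; first by rewrite ge_min lexx orbT.
by rewrite ge_min h.
Qed.

(** Real-valued counterpart of [matu_law], identified with it in [matu_lawE], so that real
    arithmetic and logarithms apply. *)
Fixpoint rlaw {R : realType} {K d : nat} (vt : R -> state K d -> state K d -> R)
    (T : R) (tp : nat -> R) (w : nat) (y : state K d) : R :=
  match w with
  | 0%N => ([forall i, is_mask (y i)])%:R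
  | w'.+1 => \sum_z rlaw vt T tp w' z *
      win (step_kernel vt (beta_w T tp w'.+1 z)) (delta y) (beta_w T tp w'.+1 z)
        (tp w'.+1) (tp w') z
  end.

Lemma partition_le (R : realType) (tp : nat -> R) W :
  (forall w, (w < W)%N -> tp w < tp w.+1) ->
  forall w w', (w <= w')%N -> (w' <= W)%N -> tp w <= tp w'.
Proof.
move=> inc w; elim=> [|w' IH]; first by rewrite leqn0 => /eqP ->.
rewrite leq_eqVlt => /orP[/eqP ->//|]; rewrite ltnS => ww' w'W.
apply: le_trans (IH ww' (ltnW w'W)) _; exact/ltW/inc.
Qed.

Lemma beta_w_ge0 (R : realType) (K d : nat) (T : R) (tp : nat -> R) w (z : state K d) :
  tp w < T -> 0 <= beta_w T tp w z.
Proof.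
by move=> h; rewrite /beta_w divr_ge0 ?mulr_ge0// subr_ge0 -expR0 ler_expR subr_ge0 ltW.
Qed.

Lemma matu_lawE (R : realType) (K d : nat) (vt : R -> state K d -> state K d -> R)
    (T : R) (tp : nat -> R) W :
  (forall t y y', unmask_pair y y' -> 0 < vt t y y') ->
  (forall y y', measurable_fun setT (fun t => vt t y y')) ->
  (forall w, (w < W)%N -> tp w < tp w.+1) -> tp W < T ->
  forall w y, (w <= W)%N -> matu_law vt T tp w y = (rlaw vt T tp w y)%:E.
Proof.
move=> vt0 mvt inc WT; elim=> [|w IH] y wW /=; first by case: ifP.
rewrite -sumEFin; apply: eq_bigr => z _; rewrite IH ?(ltnW wW)// window_kernelE//.
  exact: inc.
apply: beta_w_ge0; apply: le_lt_trans WT; exact: (partition_le _ _ W).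
Qed.

(** Moves the last window from the law to the test function; iteration leads back to the fully
    masked start. *)
Lemma rlaw_duality (R : realType) (K d : nat) (vt : R -> state K d -> state K d -> R)
    (T : R) (tp : nat -> R) w (G : state K d -> R) (c : R) :
  (forall t y y', unmask_pair y y' -> 0 < vt t y y') ->
  (forall y y', measurable_fun setT (fun t => vt t y y')) ->
  tp w < tp w.+1 -> tp w.+1 < T -> (forall z, 0 <= G z <= c) ->
  \sum_y rlaw vt T tp w.+1 y * G y =
  \sum_z rlaw vt T tp w z *
    win (step_kernel vt (beta_w T tp w.+1 z)) G (beta_w T tp w.+1 z) (tp w.+1) (tp w) z.
Proof.
move=> vt0 mvt tw twT Gc /=; under eq_bigr do rewrite mulr_suml.
rewrite exchange_big /=; apply: eq_bigr => z _.
have b0 := beta_w_ge0 R K d T tp w.+1 z twT.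
rewrite (win_delta R _ _ G _ c)//; last 4 first.
- by move=> x y; exact: measurable_step_kernel.
- by move=> *; exact: step_kernel_ge0.
- by move=> *; exact: sum_step_kernel.
- exact: ltW.
by rewrite mulr_sumr; apply: eq_bigr => y _; rewrite mulrA.
Qed.

Lemma win_pos_le (R : realType) (K d : nat) (vt : R -> state K d -> state K d -> R)
    (G : state K d -> R) (b c r t : R) z :
  (forall t y y', unmask_pair y y' -> 0 < vt t y y') ->
  (forall y y', measurable_fun setT (fun t => vt t y y')) ->
  (forall z, 0 < G z <= c) -> 0 <= b -> r <= t ->
  0 < win (step_kernel vt b) G b t r z <= c.
Proof.
move=> vt0 mvt Gc b0 rt.
have G0 y : 0 <= G y <= c by have /andP[h ->] := Gc y; rewrite ltW.
have c0 : 0 <= c by have /andP[h1 h2] := G0 z; exact: le_trans h2.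
have [|||_ /andP[h1 ->]] := win_bounds R _ (step_kernel vt b) G b c r t z _ _ _ G0 b0 c0 rt.
- by move=> x y; exact: measurable_step_kernel.
- by move=> *; exact: step_kernel_ge0.
- by move=> *; exact: sum_step_kernel.
rewrite andbT; apply: lt_le_trans h1; rewrite mulr_gt0 ?expR_gt0//.
by have /andP[] := Gc z.
Qed.

Lemma bwd_one (R : realType) (S : finType) (M : R -> S -> S -> R) s z :
  (forall u z, \sum_z' M u z z' = 1) -> bwd M (fun=> 1) s z = 1.
Proof.
move=> M1; elim: s z => [|u s IH] z //=; rewrite -[RHS](M1 u z).
by apply: eq_bigr => z' _; rewrite IH mulr1.
Qed.

Lemma win_one (R : realType) (S : finType) (M : R -> S -> S -> R) (b r t : R) z :
  (forall u z, \sum_z' M u z z' = 1) -> r <= t -> win M (fun=> 1) b t r z = 1.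
Proof.
move=> M1 rt.
have E n : iter_mean M (fun=> 1) t r n z = (t - r) ^+ n.
  rewrite /iter_mean (_ : (fun s : seq R => _) = (fun=> 1%:E)); last first.
    by apply/funext => s; rewrite bwd_one.
  rewrite iint_cst; last exact: measurable_itv.
  rewrite [lebesgue_measure _]lebesgue_measure_itv /= lte_fin.
  have -> : (if (r < t)%R then t%:E - r%:E else 0)%E = (t - r)%:E.
    by case: ltP => // tr; congr EFin; apply/esym; lra.
  by rewrite -EFin_expe mul1e.
rewrite /win /poisson_sum (_ : series _ = series (exp_coeff (b * (t - r)))).
  by rewrite -/(expR _) expRN mulVf// gt_eqF// expR_gt0.
by congr series; apply/funext => n; rewrite E /exp_coeff /= exprMn mulrAC.
Qed.

Lemma rlaw_ge0 (R : realType) (K d : nat) (vt : R -> state K d -> state K d -> R)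
    (T : R) (tp : nat -> R) W :
  (forall t y y', unmask_pair y y' -> 0 < vt t y y') ->
  (forall y y', measurable_fun setT (fun t => vt t y y')) ->
  (forall w, (w < W)%N -> tp w < tp w.+1) -> tp W < T ->
  forall w y, (w <= W)%N -> 0 <= rlaw vt T tp w y.
Proof.
move=> vt0 mvt inc WT; elim=> [|w IH] y wW //=.
apply: sumr_ge0 => z _; rewrite mulr_ge0 ?IH ?(ltnW wW)//.
have b0 : 0 <= beta_w T tp w.+1 z.
  by apply: beta_w_ge0; apply: le_lt_trans WT; exact: (partition_le _ _ W).
have [|||_ /andP[h1 _]] := win_bounds R _ (step_kernel vt (beta_w T tp w.+1 z))
  (delta y) _ 1 _ _ z _ _ _ (delta_bounds R _ y) b0 ler01 (ltW (inc w wW)).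
- by move=> x x'; exact: measurable_step_kernel.
- by move=> *; exact: step_kernel_ge0.
- by move=> *; exact: sum_step_kernel.
by apply: le_trans h1; rewrite mulr_ge0 ?expR_ge0// ler0n.
Qed.

Lemma sum_rlaw0 (R : realType) (K d : nat) (vt : R -> state K d -> state K d -> R)
    (T : R) (tp : nat -> R) (m : 'I_K) (G : state K d -> R) : is_mask m ->
  \sum_y rlaw vt T tp 0 y * G y = G [ffun=> m].
Proof.
move=> hm; rewrite (bigD1 [ffun=> m])//= (_ : [forall i, _] = true); last first.
  by apply/forallP => i; rewrite ffunE.
rewrite mul1r big1 ?addr0// => y ym; rewrite (_ : [forall i, _] = false) ?mul0r//.
apply: contraNF ym => /forallP my; apply/eqP/ffunP => i; rewrite ffunE.
exact: is_mask_inj.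
Qed.

Lemma sum_rlaw (R : realType) (K d : nat) (vt : R -> state K d -> state K d -> R)
    (T : R) (tp : nat -> R) W (m : 'I_K) : is_mask m ->
  (forall t y y', unmask_pair y y' -> 0 < vt t y y') ->
  (forall y y', measurable_fun setT (fun t => vt t y y')) ->
  (forall w, (w < W)%N -> tp w < tp w.+1) -> tp W < T ->
  forall w, (w <= W)%N -> \sum_y rlaw vt T tp w y = 1.
Proof.
move=> hm vt0 mvt inc WT; elim=> [|w IH] wW.
  by rewrite -[RHS](sum_rlaw0 R K d vt T tp m (fun=> 1))//; apply: eq_bigr => y _;
     rewrite mulr1.
have wT : tp w.+1 < T by apply: le_lt_trans WT; exact: (partition_le _ _ W).
have one (z : state K d) : 0 <= (1 : R) <= 1 by rewrite ler01 lexx.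
have := rlaw_duality R K d vt T tp w (fun=> 1) 1 vt0 mvt (inc w wW) wT one.
under eq_bigr do rewrite mulr1.
move=> ->; rewrite -[RHS](IH (ltnW wW)); apply: eq_bigr => z _.
rewrite win_one ?mulr1//; last exact/ltW/inc.
by move=> *; exact: sum_step_kernel.
Qed.

(** * All windows *)

(** By uniqueness of Lebesgue measure it suffices to treat ]a, b], whose preimage [T - b, T - a[ has
    the same length. *)
Lemma lebesgue_measure_reflect (R : realType) (T : R) (A : set R) :
  measurable A ->
  pushforward lebesgue_measure ((fun x => T - x) : _ -> measurableTypeR R) A =
  lebesgue_measure A.
Proof.
move=> mA.
have mphi : measurable_fun setT ((fun x => T - x) : R -> measurableTypeR R).
  exact: measurable_funB.
apply/esym; apply: (@lebesgue_measure_unique R (pushforward lebesgue_measure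
  ((fun x => T - x) : measurableTypeR R -> measurableTypeR R))) => //= _ [[a b]] _ <-.
rewrite /pushforward.
have -> : (fun x => T - x) @^-1` `]a, b]%classic = `[T - b, T - a[%classic :> set R.
  apply/seteqP; split => x /=; rewrite !in_itv /= => /andP[h1 h2];
    by apply/andP; split; lra.
rewrite !lebesgue_measure_itv /= !lte_fin ltrD2l ltrN2.
by case: ifP => // _; rewrite -!EFinB; congr EFin; ring.
Qed.

Lemma ge0_integral_reflect (R : realType) (T : R) (f : R -> \bar R) :
  measurable_fun setT f -> (forall u, 0 <= u <= T -> (0 <= f u)%E) ->
  (\int[lebesgue_measure]_(t in `[0%R, T]) f (T - t)%R =
   \int[lebesgue_measure]_(u in `[0%R, T]) f u)%E.
Proof.
move=> mf f0.
have mphi : measurable_fun setT ((fun x => T - x) : measurableTypeR R -> measurableTypeR R).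
  exact: measurable_funB.
have E : ((fun x => T - x) : measurableTypeR R -> measurableTypeR R) @^-1` `[0%R, T]%classic
    = `[0%R, T]%classic.
  apply/seteqP; split => x /=; rewrite !in_itv /= => /andP[h1 h2];
    by apply/andP; split; lra.
transitivity (\int[pushforward lebesgue_measure
    ((fun x => T - x)%R : measurableTypeR R -> measurableTypeR R)]_(u in `[0%R, T]) f u)%E.
  rewrite ge0_integral_pushforward// ?E//.
  - exact: measurable_funTS mf.
  - by move=> u; rewrite inE /= in_itv /=; exact: f0.
apply: eq_measure_integral => A mA _; exact: lebesgue_measure_reflect.
Qed.

Section Chain.
Context {R : realType} {K d : nat} (m : 'I_K) (hm : is_mask m)
  (z1 : 'I_K) (hz1 : ~~ is_mask z1).
Context (qstar : state K d -> R) (q : R -> state K d -> R).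
Hypothesis hq0 : forall y, 0 <= qstar y.
Hypothesis hq1 : \sum_(y : state K d) qstar y = 1.
Hypothesis hqE : forall t y, q t y = \sum_x Ptr t x y * qstar x.
Hypothesis hA2 : forall y, 0 < qstar y <-> numK y = 0%N.
Hypothesis hqode : forall (t : R) (y : state K d),
  is_derive t (1 : R) (fun s => q s y) (\sum_(y' : state K d) Rfwd R y y' * q t y').
Context (vt : R -> state K d -> state K d -> R).
Hypothesis vt_gt0 : forall t y y', unmask_pair y y' -> 0 < vt t y y'.
Hypothesis vt_meas : forall y y', measurable_fun setT (fun t => vt t y y').
Context (T : R) (tp : nat -> R) (W : nat).
Hypothesis tp0 : tp 0%N = 0.
Hypothesis tpW : tp W < T.
Hypothesis tp_incr : forall w, (w < W)%N -> tp w < tp w.+1.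

(** [g] is [G] pulled back through the first [w] windows. The induction is over all [G]: the last
    window replaces [G] by its pull-back, to which the hypothesis for the earlier windows applies,
    and the entropy differences telescope. *)
Lemma chain_entropy w (G : state K d -> R) (c : R) :
  lebesgue_measure.-integrable (`[0, tp W] : set R) (EFin \o loss q vt T) ->
  (w <= W)%N -> (forall z, 0 < G z <= c) ->
  exists g : state K d -> R, [/\ forall z, 0 < g z <= c,
    \sum_y rlaw vt T tp w y * G y = \sum_y rlaw vt T tp 0 y * g y &
    \sum_y q (T - tp w) y * ln (G y) - \sum_z q T z * ln (g z) <=
    \int[lebesgue_measure]_(u in `[0, tp w]) loss q vt T u].
Proof.
move=> il; elim: w G => [|w IH] G wW Gc.
  exists G; split => //; rewrite tp0 subr0 subrr set_itv1 Rintegral_set1.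
  exact: lexx.
have tww := tp_incr w wW.
have twT : tp w.+1 < T by apply: le_lt_trans tpW; exact: (partition_le _ _ W).
have tw0 : 0 <= tp w.
  by have := partition_le R tp W tp_incr 0 w (leq0n w) (ltnW wW); rewrite tp0.
have twW : tp w.+1 <= tp W by exact: (partition_le _ _ W).
pose g z := win (step_kernel vt (beta_w T tp w.+1 z)) G (beta_w T tp w.+1 z)
  (tp w.+1) (tp w) z.
have gc z : 0 < g z <= c.
  by apply: win_pos_le => //; [exact: beta_w_ge0|exact: ltW].
have [g0 [g0c E ineq]] := IH g (ltnW wW) gc.
exists g0; split => //.
  rewrite -E (rlaw_duality R K d vt T tp w G c)// => z.
  by have /andP[h ->] := Gc z; rewrite ltW.
have G0 z : 0 < G z by have /andP[] := Gc z.
have [glo glo0 hglo] := finite_lower_bound R _ G G0.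
have Gb z : glo <= G z <= c by rewrite hglo /=; have /andP[] := Gc z.
have il1 : lebesgue_measure.-integrable (`[tp w, tp w.+1] : set R) (EFin \o loss q vt T).
  apply: (integrableS _ _ _ il) => // v /=.
  by rewrite !in_itv /= => /andP[h1 h2]; apply/andP; split; lra.
have il2 : lebesgue_measure.-integrable (`[0, tp w.+1] : set R) (EFin \o loss q vt T).
  apply: (integrableS _ _ _ il) => // v /=.
  by rewrite !in_itv /= => /andP[h1 h2]; apply/andP; split; lra.
have := window_entropy m hm z1 hz1 qstar q hq0 hq1 hqE hA2 hqode vt vt_gt0 vt_meas T
  (tp w) (tp w.+1) (ltW tww) twT G glo c glo0 Gb il1.
rewrite -/(\sum_z q (T - tp w) z * ln (g z)).
suff -> : \int[lebesgue_measure]_(u in `[0, tp w.+1]) loss q vt T u =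
  \int[lebesgue_measure]_(u in `[0, tp w]) loss q vt T u +
  \int[lebesgue_measure]_(u in `[tp w, tp w.+1]) loss q vt T u.
  lra.
have bw : (BRight (tp w) <= BRight (tp w.+1))%O by rewrite bnd_simp ltW.
have bw0 : (BLeft 0%R <= BRight (tp w))%O by rewrite bnd_simp.
have := Rintegral_itvB il2 bw0 bw; rewrite Rintegral_itv_obnd_cbnd; first by move=> <-; lra.
apply: (integrableS _ _ _ il1) => // v /=.
by rewrite !in_itv /= => /andP[h1 h2]; apply/andP; split; lra.
Qed.

(** The delicate time is u = T, where the score divides by [q 0 y], which may be 0. Such a [y] has
    weight 0, and every other [y] has no mask and therefore no jump to sum over. *)
Lemma loss_ge0 u : u <= T -> 0 <= loss q vt T u.
Proof.
rewrite le_eqVlt => /orP[/eqP ->|uT]; apply: sumr_ge0 => y _; last first.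
  exact: (node_loss_ge0 z1 hz1 qstar q hq0 hqE hA2).
rewrite node_lossE subrr.
have q0E : q 0 y = qstar y.
  rewrite hqE (bigD1 y)//= Ptr0 eqxx mul1r big1 ?addr0// => x xy.
  by rewrite Ptr0 (negbTE xy) mul0r.
have [e|e] := eqVneq (qstar y) 0; first by rewrite q0E e mul0r.
rewrite big_pred0 ?mulr0// => y'; apply/negP => /unmask_pairP[i [a [mi _ _]]].
by move: mi; rewrite (qstar_neq0_unmasked qstar hq0 hA2).
Qed.

Lemma measurable_loss : measurable_fun setT (fun u => (loss q vt T u)%:E).
Proof.
apply/measurable_EFinP; apply: measurable_sum => y.
exact: measurable_node_loss.
Qed.

Lemma L_SE_loss : 0 < T ->
  (L_SE q T vt = (T^-1)%:E * \int[lebesgue_measure]_(u in `[0%R, T]) (loss q vt T u)%:E)%E.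
Proof.
move=> T0; rewrite -ge0_integral_reflect; last 2 first.
- exact: measurable_loss.
- by move=> u /andP[_ uT]; rewrite lee_fin loss_ge0.
congr (_ * _)%E; apply: eq_integral => t _; congr EFin.
by rewrite /loss /node_loss subKr.
Qed.

(** Nonnegativity of the loss up to T allows restriction to [0, tp W], and the finite bound then
    supplies the integrability required by the window estimates. *)
Lemma loss_integral_bound (B : R) : 0 < T -> 0 <= tp W ->
  (L_SE q T vt <= B%:E)%E ->
  lebesgue_measure.-integrable (`[0, tp W] : set R) (EFin \o loss q vt T) /\
  \int[lebesgue_measure]_(u in `[0, tp W]) loss q vt T u <= T * B.
Proof.
move=> T0 tW0; rewrite L_SE_loss// => hB; have tpW' := tpW.
have h1 : (\int[lebesgue_measure]_(u in `[0%R, T]) (loss q vt T u)%:E <= (T * B)%:E)%E.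
  rewrite EFinM -lee_pdivrMl//.
have ml := measurable_loss.
have h2 : (\int[lebesgue_measure]_(u in `[0%R, tp W]) (loss q vt T u)%:E <= (T * B)%:E)%E.
  apply: le_trans h1; apply: ge0_subset_integral => //.
  - exact: measurable_funTS ml.
  - by move=> u /=; rewrite in_itv /= => /andP[_ uT]; rewrite lee_fin loss_ge0.
  - move=> u /=; rewrite !in_itv /= => /andP[a b]; apply/andP; split; lra.
have nn u : `[0, tp W]%classic u -> (0 <= (loss q vt T u)%:E)%E.
  by rewrite /= in_itv /= => /andP[_ uT]; rewrite lee_fin loss_ge0//; lra.
have i0 : (0 <= \int[lebesgue_measure]_(u in `[0%R, tp W]) (loss q vt T u)%:E)%E.
  exact: integral_ge0.
split; last first.
  rewrite /Rintegral -lee_fin fineK// ge0_fin_numE//.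
  exact: le_lt_trans h2 (ltry _).
apply/integrableP; split; first exact: measurable_funTS ml.
rewrite (_ : \int[_]_(x in _) _ = \int[lebesgue_measure]_(u in `[0%R, tp W]) (loss q vt T u)%:E)%E.
  exact: le_lt_trans h2 (ltry _).
by apply: eq_integral => u /set_mem hu /=; rewrite ger0_norm// -lee_fin; exact: nn.
Qed.

End Chain.

(** * Conclusion *)

Lemma one_sided_bound (R : realType) (K d : nat) (hd : (1 <= d)%N)
    (m : 'I_K) (hm : is_mask m) (z1 : 'I_K) (hz1 : ~~ is_mask z1)
    (qstar : state K d -> R) (q : R -> state K d -> R)
    (hq0 : forall y, 0 <= qstar y) (hq1 : \sum_(y : state K d) qstar y = 1)
    (hqE : forall t y, q t y = \sum_x Ptr t x y * qstar x)
    (hA2 : forall y, 0 < qstar y <-> numK y = 0%N)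
    (hqode : forall (t : R) (y : state K d), is_derive t (1 : R) (fun s => q s y)
      (\sum_(y' : state K d) Rfwd R y y' * q t y'))
    (vt : R -> state K d -> state K d -> R)
    (vt_gt0 : forall t y y', unmask_pair y y' -> 0 < vt t y y')
    (vt_meas : forall y y', measurable_fun setT (fun t => vt t y y'))
    (T delta eps B : R) (W : nat) (tp : nat -> R)
    (heps : 0 < eps < 1) (hT : T = ln (4 * d%:R / eps ^+ 2))
    (hdelta0 : 0 < delta) (hdelta : delta <= eps / d%:R)
    (hB : T * B <= eps ^+ 2) (hA1 : (L_SE q T vt <= B%:E)%E)
    (htp0 : tp 0%N = 0) (htpW : tp W = T - delta)
    (htp_incr : forall w, (w < W)%N -> tp w < tp w.+1) (S : {set state K d}) :
  \sum_(y in S) qstar y - \sum_(y in S) rlaw vt T tp W y <= 2 * eps.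
Proof.
have /andP[e0 e1] := heps.
have d1 : 1 <= d%:R :> R by rewrite ler1n.
have d0 : 0 < d%:R :> R by lra.
have e2 : 0 < eps ^+ 2 by rewrite exprn_gt0.
have e2' : eps ^+ 2 <= eps by rewrite expr2; nra.
have A0 : 0 < 4 * d%:R / eps ^+ 2 by rewrite divr_gt0// mulr_gt0.
have T0 : 0 < T by rewrite hT ln_gt0// ltr_pdivlMr// mul1r; lra.
have eT : d%:R * expR (- T) = eps ^+ 2 / 4.
  by rewrite expRN hT lnK ?posrE//; field; rewrite !gt_eqF.
have tpW : tp W < T by rewrite htpW; lra.
have tW0 : 0 <= tp W.
  by have := partition_le R tp W htp_incr 0 W (leq0n W) (leqnn W); rewrite htp0.
have [il intB] := loss_integral_bound z1 hz1 qstar q hq0 hqE hA2 hqode vt vt_gt0 vt_meas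
  T tp W tpW B T0 tW0 hA1.
(* After division by [lam], the score entropy eps^2, Hoeffding's term lam^2 / 8 and the initial
   error lam eps^2 / 4 become eps / 2 + eps / 4 + eps^2 / 4 <= eps. *)
pose lam : R := 2 * eps; have lam0 : 0 < lam by rewrite /lam; lra.
pose G (y : state K d) : R := if y \in S then expR lam else 1.
have Gc y : 0 < G y <= expR lam.
  rewrite /G; case: ifP => _; first by rewrite expR_gt0 lexx.
  by rewrite ltr01 -expR0 ler_expR ltW.
have [g [gc gE gineq]] := chain_entropy m hm z1 hz1 qstar q hq0 hq1 hqE hA2 hqode vt vt_gt0
  vt_meas T tp W htp0 tpW htp_incr W G (expR lam) il (leqnn W) Gc.
pose P := \sum_(y in S) rlaw vt T tp W y.
have r0 y : 0 <= rlaw vt T tp W y by exact: (rlaw_ge0 R K d vt T tp W).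
have r1 : \sum_y rlaw vt T tp W y = 1 by exact: (sum_rlaw R K d vt T tp W m).
have P0 : 0 <= P by exact: sumr_ge0.
have rS : \sum_(y in ~: S) rlaw vt T tp W y = 1 - P.
  rewrite -r1 [X in _ = X - _](bigID (mem S)) /= -/P [P + _]addrC addrK.
  by apply: eq_bigl => y; rewrite inE.
have P1 : P <= 1.
  by rewrite -subr_ge0 -rS; exact: sumr_ge0.
pose mk : state K d := [ffun=> m].
have gmk : g mk = 1 - P + P * expR lam.
  rewrite -(sum_rlaw0 R K d vt T tp m g hm) -gE (bigID (mem S)) /= addrC; congr (_ + _).
    rewrite -rS; apply: eq_big => [y|y yS]; first by rewrite inE.
    by rewrite /G (negbTE yS) mulr1.
  by rewrite /P mulr_suml; apply: eq_bigr => y yS; rewrite /G yS.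
(* The sign permits replacing the weight [q T mk] by 1 below. *)
have lng0 : 0 <= ln (g mk).
  apply: ln_ge0; rewrite gmk.
  have : 1 <= expR lam by rewrite -expR0 ler_expR ltW.
  by move=> h; have : P * 1 <= P * expR lam by [rewrite ler_wpM2l]; lra.
have hoef : ln (g mk) <= lam * P + lam ^+ 2 / 8.
  by rewrite gmk; apply: bernoulli_hoeffding; [rewrite P0 P1|exact: ltW].
have qb y : 0 <= q T y <= 1 by apply: (marginal_bounds qstar q hq0 hq1 hqE); exact: ltW.
have qmk : 1 - eps ^+ 2 / 4 <= q T mk.
  rewrite -eT; apply: (marginal_mask qstar q hq0 hq1 hqE hA2); first exact: ltW.
  by apply/forallP => i; rewrite ffunE.
have qT1 : \sum_(y | y != mk) q T y = 1 - q T mk.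
  rewrite -(sum_marginal m hm qstar q hq1 hqE T) [X in _ = X - _](bigD1 mk)//=.
  by rewrite addrC addrK.
(* Off the fully masked state only the crude bound [ln (g z) <= lam] is used; the mass there is at
   most eps^2 / 4 by the choice of T. *)
have sumg : \sum_z q T z * ln (g z) <= ln (g mk) + lam * (1 - q T mk).
  rewrite (bigD1 mk)//=; apply: lerD.
    by have /andP[h1 h2] := qb mk; rewrite ler_piMl.
  rewrite -qT1 mulr_sumr; apply: ler_sum => y _; rewrite mulrC.
  have /andP[h1 h2] := qb y; have /andP[g1 g2] := gc y.
  by rewrite ler_wpM2r// -[leRHS]expRK ler_ln ?posrE ?expR_gt0.
have Tdelta : T - tp W = delta by rewrite htpW; ring.
have sumG : \sum_y q (T - tp W) y * ln (G y) = lam * \sum_(y in S) q delta y.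
  rewrite Tdelta mulr_sumr [RHS]big_mkcond; apply: eq_bigr => y _; rewrite /G.
  by case: ifP => _; [rewrite expRK mulrC|rewrite ln1 mulr0].
rewrite sumG in gineq.
have main : \sum_(y in S) q delta y - P <= eps.
  have h1 : lam * (\sum_(y in S) q delta y - P) <= eps ^+ 2 + lam ^+ 2 / 8 + lam * (eps ^+ 2 / 4).
    have : lam * (1 - q T mk) <= lam * (eps ^+ 2 / 4) by rewrite ler_pM2l//; lra.
    by lra.
  have h2 : eps ^+ 2 + lam ^+ 2 / 8 + lam * (eps ^+ 2 / 4) <= lam * eps.
    have : eps * eps ^+ 2 <= eps * eps by rewrite ler_pM2l.
    by rewrite /lam -[eps * eps]expr2; lra.
  by rewrite -(ler_pM2l lam0); exact: le_trans h1 h2.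
(* Early stopping moves at most a mass d delta <= eps out of [S]. *)
have small : \sum_(y in S) qstar y - \sum_(y in S) q delta y <= eps.
  have dd : d%:R * delta <= eps by rewrite mulrC -ler_pdivlMr.
  have h1 : \sum_(y in S) qstar y * (1 - d%:R * delta) <= \sum_(y in S) q delta y.
    apply: ler_sum => y _; apply: (marginal_small qstar q hq0 hq1 hqE hA2).
    exact: ltW.
  rewrite -mulr_suml in h1.
  have s0 : 0 <= \sum_(y in S) qstar y by exact: sumr_ge0.
  have s1 : \sum_(y in S) qstar y <= 1.
    by rewrite -hq1 [leRHS](bigID (mem S)) /= lerDl sumr_ge0.
  have : (\sum_(y in S) qstar y) * (d%:R * delta) <= 1 * eps.
    by apply: ler_pM => //; rewrite mulr_ge0// ltW.
  lra.
rewrite -/P; lra.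
Qed.

(** * Extension of the estimator to all times *)

(** Positivity and measurability are given on [0, T) only; the value 1 elsewhere makes them global.
    The algorithm reads times in [0, T - delta], so its law is unchanged, and so is the loss by
    [L_SE_ext]. *)
Definition vt_ext {R : realType} {K d : nat} (T : R)
    (vt : R -> state K d -> state K d -> R) (t : R) (y y' : state K d) : R :=
  if 0 <= t < T then vt t y y' else 1.

Lemma measurable_vt_ext (R : realType) (K d : nat) (T : R)
    (vt : R -> state K d -> state K d -> R) y y' :
  measurable_fun (`[0%R, T[ : set R) (fun t => vt t y y') ->
  measurable_fun setT (fun t => vt_ext T vt t y y').
Proof.
move=> mv; have mD : measurable (`[0%R, T[ : set R) by exact: measurable_itv.
have m1 := (measurable_restrictT (fun t => vt t y y') mD).1 mv.
have m2 : measurable_fun setT (fun t : R => 1 - \1_(`[0%R, T[ : set R) t : R).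
  by apply: measurable_funB => //; exact: measurable_indic.
have -> : (fun t => vt_ext T vt t y y') =
    ((fun t => vt t y y') \_ `[0%R, T[) \+ (fun t => 1 - \1_(`[0%R, T[ : set R) t).
  apply/funext => t; rewrite /vt_ext /= patchE indicE.
  have -> : (t \in (`[0%R, T[%classic : set R)) = (0 <= t < T).
    by apply/idP/idP; rewrite inE /= in_itv.
  by case: ifP => _; rewrite ?subrr ?addr0 ?subr0 ?add0r.
exact: measurable_funD.
Qed.

Lemma eq_unif_expect (R : realType) (a b : R) n (F G : seq R -> \bar R) :
  (forall s, (forall u, u \in s -> a <= u <= b) -> F s = G s) ->
  unif_expect a b n F = unif_expect a b n G.
Proof.
elim: n F G => [|n IH] F G FG /=; first exact: FG.
congr (_ * _)%E; apply: eq_integral => u /set_mem; rewrite /= in_itv /= => Du.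
by apply: IH => s Hs; apply: FG => v; rewrite in_cons => /orP[/eqP ->//|]; exact: Hs.
Qed.

Lemma eq_foldl_step_dist (R : realType) (K d : nat)
    (vt vt' : R -> state K d -> state K d -> R) (b : R) (s : seq R) p :
  (forall u, u \in s -> vt u = vt' u) ->
  foldl (step_dist vt b) p s = foldl (step_dist vt' b) p s.
Proof.
elim: s p => [|u s IH] p E //=.
have Eu : vt u = vt' u by apply: E; exact: mem_head.
rewrite (_ : step_dist vt b p u = step_dist vt' b p u).
  by apply: IH => v vs; apply: E; rewrite in_cons vs orbT.
by rewrite /step_dist /step_kernel /Rhat /Rest_tot /Rest Eu.
Qed.

Lemma eq_matu_law (R : realType) (K d : nat)
    (vt vt' : R -> state K d -> state K d -> R) (T : R) (tp : nat -> R) W :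
  (forall w, (w < W)%N -> tp w < tp w.+1) ->
  (forall u, tp 0%N <= u <= tp W -> vt u = vt' u) ->
  forall w, (w <= W)%N -> matu_law vt T tp w = matu_law vt' T tp w.
Proof.
move=> inc E; elim=> [//|w IH] wW; apply/funext => y /=.
rewrite (IH (ltnW wW)); apply: eq_bigr => z _; congr (_ * _)%E.
rewrite /window_kernel; apply: eq_eseriesr => n _; congr (_ * _)%E.
apply: eq_unif_expect => s Hs; congr EFin.
rewrite (eq_foldl_step_dist R K d vt vt')// => u; rewrite mem_sort => /Hs /andP[h1 h2].
apply: E; rewrite (le_trans _ h1) ?(le_trans h2)//.
  exact: (partition_le R tp W inc).
exact: (partition_le R tp W inc 0 w (leq0n w) (ltnW wW)).
Qed.

(** The estimators can differ on the range of integration only at t = 0, that is at reverse time T.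
    There a state either has weight 0 or carries no mask, so that no term involving the estimator
    survives. *)
Lemma L_SE_ext (R : realType) (K d : nat) (qstar : state K d -> R)
    (q : R -> state K d -> R) (T : R) (vt : R -> state K d -> state K d -> R) :
  (forall y, 0 <= qstar y) -> (forall y, 0 < qstar y <-> numK y = 0%N) ->
  q 0 = qstar -> L_SE q T (vt_ext T vt) = L_SE q T vt.
Proof.
move=> hq0 hA2 q0; congr (_ * _)%E; apply: eq_integral => t /set_mem.
rewrite /= in_itv /= => /andP[t0 tT]; congr EFin; apply: eq_bigr => y _.
have [e|tn] := eqVneq t 0; last first.
  congr (_ * _); apply: eq_bigr => y' _; congr (_ * Dphi _ _).
  rewrite /vt_ext ifT// subr_ge0 tT /= ltrBlDr ltrDl lt_neqAle eq_sym tn t0//.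
rewrite e q0; have [->|yn] := eqVneq (qstar y) 0; first by rewrite !mul0r.
congr (_ * _); apply: eq_bigr => y' yy'; rewrite Rfwd_neq//.
rewrite (_ : unmask_pair y y' = false) ?mul0r//; apply/negP.
move=> /unmask_pairP[i [a [mi _ _]]].
by move: mi; rewrite (qstar_neq0_unmasked qstar hq0 hA2).
Qed.

Theorem mainTheorem10 (R : realType) (K d : nat) (hK : (2 <= K)%N) (hd : (1 <= d)%N)
  (* data distribution q_* on Y *)
  (qstar : state K d -> R)
  (hq0 : forall y, 0 <= qstar y) (hq1 : \sum_(y : state K d) qstar y = 1)
  (* forward marginals q->_t : Kolmogorov forward equation of the masked chain *)
  (q : R -> state K d -> R) (hqinit : q 0 = qstar)
  (hqode : forall (t : R) (y : state K d),
      is_derive t (1 : R) (fun s => q s y) (\sum_(y' : state K d) Rfwd R y y' * q t y'))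
  (* score estimator *)
  (vt : R -> state K d -> state K d -> R)
  (T delta eps eps_score : R) (W : nat) (tp : nat -> R)
  (hvt_pos : forall t y y', 0 <= t < T -> Rfwd R y y' = 1 -> 0 < vt t y y')
  (hvt_meas : forall y y', measurable_fun (`[0%R, T[ : set R) (fun t => vt t y y'))
  (* (A2) *)
  (hA2 : forall y, 0 < qstar y <-> numK y = 0%N)
  (* parameters *)
  (heps : 0 < eps < 1)
  (hT : T = ln (4 * d%:R / eps ^+ 2))
  (hdelta0 : 0 < delta) (hdelta : delta <= eps / d%:R)
  (hes0 : 0 <= eps_score) (hes : eps_score <= Num.sqrt (T^-1) * eps)
  (* (A1) *)
  (hA1 : (L_SE q T vt <= (eps_score ^+ 2)%:E)%E)
  (* partition 0 = t_0 < t_1 < ... < t_W = T - delta *)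
  (htp0 : tp 0%N = 0) (htpW : tp W = T - delta)
  (htp_incr : forall w, (w < W)%N -> tp w < tp w.+1) :
  (TV qstar (matu_law vt T tp W) <= (2 * eps)%:E)%E.
Proof.
have /andP[e0 e1] := heps.
have K0 : (0 < K)%N by exact: ltnW.
have Km : (K.-1 < K)%N by rewrite prednK.
pose m : 'I_K := Ordinal Km; pose z1 : 'I_K := Ordinal K0.
have hm : is_mask m by exact: eqxx.
have hz1 : ~~ is_mask z1 by rewrite /is_mask /= eq_sym -lt0n -subn1 subn_gt0.
pose vt' := vt_ext T vt.
have vt_gt0 t y y' : unmask_pair y y' -> 0 < vt' t y y'.
  move=> yy'; rewrite /vt' /vt_ext; case: ifP => // tT; apply: hvt_pos => //.
  by rewrite Rfwd_neq ?yy'// eq_sym unmask_pair_neq.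
have vt_meas y y' : measurable_fun setT (fun t => vt' t y y').
  by apply: measurable_vt_ext; exact: hvt_meas.
have hqE := forward_marginal R K d qstar q hqinit hqode.
have T0 : 0 < T.
  rewrite hT ln_gt0// ltr_pdivlMr ?exprn_gt0// mul1r.
  have : 1 <= d%:R :> R by rewrite ler1n.
  have : eps ^+ 2 < 1 by rewrite expr_lt1// ltW.
  lra.
have hB : T * eps_score ^+ 2 <= eps ^+ 2.
  have h : eps_score ^+ 2 <= (Num.sqrt (T^-1) * eps) ^+ 2.
    by rewrite lerXn2r ?nnegrE// mulr_ge0 ?sqrtr_ge0// ltW.
  move: h; rewrite exprMn sqr_sqrtr ?invr_ge0 ?(ltW T0)// mulrC ler_pdivlMr//.
  by rewrite mulrC.
have hA1' : (L_SE q T vt' <= (eps_score ^+ 2)%:E)%E by rewrite (L_SE_ext R K d qstar).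
have tpW : tp W < T by rewrite htpW; lra.
have one_sided := one_sided_bound R K d hd m hm z1 hz1 qstar q hq0 hq1 hqE hA2 hqode vt'
  vt_gt0 vt_meas T delta eps (eps_score ^+ 2) W tp heps hT hdelta0 hdelta hB hA1' htp0 htpW
  htp_incr.
have lawE y : matu_law vt T tp W y = (rlaw vt' T tp W y)%:E.
  rewrite (eq_matu_law R K d vt vt' T tp W htp_incr)//; last first.
    move=> u /andP[u0 uW]; apply/funext => x; apply/funext => x'.
    by rewrite /vt' /vt_ext ifT// -htp0 u0 /=; exact: le_lt_trans uW tpW.
  exact: (matu_lawE R K d vt' T tp W).
have r1 : \sum_y rlaw vt' T tp W y = 1 by exact: (sum_rlaw R K d vt' T tp W m).
apply: bigmax_le => [|S _]; first by rewrite lee_fin; lra.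
rewrite [X in (_ - X)%E](eq_bigr (fun y => (rlaw vt' T tp W y)%:E)) => [|y _]; last exact: lawE.
rewrite sumEFin -EFinB lee_fin ler_norml.
(* Both laws have total mass 1, so the one-sided bound for the complement is the opposite inequality
   for [S]. *)
have h1 := one_sided S; have h2 := one_sided (~: S).
have split (f : state K d -> R) : \sum_(y in ~: S) f y = \sum_y f y - \sum_(y in S) f y.
  rewrite [X in _ = X - _](bigID (mem S)) /= [X in _ = X - _]addrC addrK.
  by apply: eq_bigl => y; rewrite inE.
rewrite !split hq1 r1 in h2.
by apply/andP; split; lra.
Qed.
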